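(* Let $a,b,c\in\mathbf{Z}$ be such that $f(x)=x^3+ax^2+bx+c$ has three distinct complex roots, let $E$ be the elliptic curve $y^2=f(x)$, and for $D\in\mathbf{Z}\setminus\{0\}$ let $E^{(D)}$ be the elliptic curve $Dy^2=f(x)$. Let $j$ be a positive real number. Then the following are equivalent: (a) $\operatorname{rank}_{\mathbf{Z}} E^{(D)}(\mathbf{Q})<2j$ for every $D\in\mathbf{Z}\setminus\{0\}$; (b) $S_E(j,k)$ converges for some real $k\ge 1$; (c) $S_E(j,k)$ converges for every real $k\ge 1$; (d) $R_E(j,k)$ converges for some real $k\ge 1$; (e) $R_E(j,k)$ converges for every real $k\ge 1$; (f) $Q_E(j,k)$ converges for some real $k\ge 1$; (g) $Q_E(j,k)$ converges for every real $k\ge 1$.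
   Context: Let $F(u,v)=v(u^3+au^2v+buv^2+cv^3)=v^4f(u/v)$ and $\Psi=\{(u,v)\in\mathbf{Z}^2:\gcd(u,v)=1,\ F(u,v)\neq 0\}$. For $n\in\mathbf{Q}^\times$, $s(n)$ denotes the square-free part of $n$: the unique square-free integer with $n=s(n)m^2$ for some $m\in\mathbf{Q}$. For a rational number written as $u/v$ with $u,v$ coprime integers, $h(u/v)=\max\{1,\log|u|,\log|v|\}$ (with $\log 0=-\infty$). For non-negative reals $j,k$: $S_E(j,k)=\sum_{(u,v)\in\Psi}\frac{1}{|s(F(u,v))|^k h(u/v)^j}$, $R_E(j,k)=\sum_{t=1}^\infty\sum_{(u,v)\in\Psi,\ t^2\mid F(u,v)}\frac{t^{2k}}{|F(u,v)|^k h(u/v)^j}$. For a positive integer $d$, $\Omega_d=\{\alpha\in\mathbf{Z}/d^2\mathbf{Z}: f(\alpha)\equiv 0 \pmod{d^2}\}$. For positive integers $d,d'$ and $\alpha\in\Omega_d$, let $\mathcal{L}_{\alpha,d,d'}=\{(u,v)\in\mathbf{Z}^2: u\equiv\alpha v \pmod{d^2},\ v\equiv 0\pmod{(d')^2}\}$ and let $\omega_{\alpha,d,d'}$ be a (arbitrarily chosen) shortest non-zero vector of $\mathcal{L}_{\alpha,d,d'}$ for the Euclidean norm $\|\cdot\|$. Then $Q_E(j,k)=\sum_{d,d'\ge1,\ \gcd(d,d')=1}\frac{(dd')^{2k}}{\max(1,\log(dd'))^j}\sum_{\alpha\in\Omega_d,\ \omega_{\alpha,d,d'}\in\Psi}\|\omega_{\alpha,d,d'}\|^{-4k}$.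 All these are series of non-negative terms; ''converges'' means has finite sum. *)

(* Defs.v *)
From mathcomp Require Import all_boot all_order all_algebra.
From mathcomp Require Import all_classical all_reals all_analysis.
From mathcomp Require Import complex.
Set Implicit Arguments.
Unset Strict Implicit.
Unset Printing Implicit Defensive.
Import Order.TTheory GRing.Theory Num.Theory.
Local Open Scope classical_set_scope.
Local Open Scope ring_scope.

(* f(x) = x^3 + a x^2 + b x + c *)
Definition cubic (a b c : int) : {poly int} :=
  'X^3 + a *: 'X^2 + b *: 'X + c%:P.

Definition has_three_distinct_complex_roots (R : realType) (f : {poly int}) :=
  exists s : seq (complex R),
    [/\ uniq s, size s = 3%N & all (root (map_poly intr f)) s].

(** Rational points of the curve D y^2 = x^3 + a x^2 + b x + c, where [None] is
    the point at infinity, i.e. the neutral element of the group law. *)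

Definition ec_point := option (rat * rat).

Definition ec_on (a b c D : int) (P : ec_point) : Prop :=
  if P is Some (x, y) then D%:~R * y ^+ 2 = (map_poly intr (cubic a b c)).[x]
  else True.

Definition ec_opp (P : ec_point) : ec_point :=
  if P is Some (x, y) then Some (x, - y) else None.

(* The line y = l x + m meets the curve in three points whose abscissae add up
   to D l^2 - a. For x1 = x2 and y1 != - y2 both points coincide, and l is the
   slope f'(x1) / (2 D y1) of the tangent line. *)
Definition ec_add (a b c D : int) (P Q : ec_point) : ec_point :=
  match P, Q with
  | None, _ => Q
  | _, None => P
  | Some (x1, y1), Some (x2, y2) =>
    if (x1 == x2) && (y1 == - y2) then None else
    let l := if x1 == x2
      then (map_poly intr (cubic a b c))^`().[x1] / (2 * D%:~R * y1)
      else (y2 - y1) / (x2 - x1) in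
    let x3 := D%:~R * l ^+ 2 - a%:~R - x1 - x2 in
    Some (x3, l * (x1 - x3) - y1)
  end.

Definition ec_mulz (a b c D m : int) (P : ec_point) : ec_point :=
  match m with
  | Posz n => iter n (ec_add a b c D P) None
  | Negz n => ec_opp (iter n.+1 (ec_add a b c D P) None)
  end.

Definition ec_independent (a b c D : int) (n : nat) (P : 'I_n -> ec_point) :=
  forall m : 'I_n -> int,
    \big[ec_add a b c D/None]_(i < n) ec_mulz a b c D (m i) (P i) = None ->
    forall i, m i = 0.

(* The rank is the supremum of the cardinalities of the Z-linearly independent
   families; with values in the extended reals it makes sense without
   appealing to the Mordell-Weil theorem. *)
Definition ec_rank (R : realType) (a b c D : int) : \bar R :=
  ereal_sup [set (n%:R)%:E | n in [set n : nat |
    exists P : 'I_n -> ec_point,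
      (forall i, ec_on a b c D (P i)) /\ ec_independent a b c D P]].

Definition quartic (a b c : int) (p : int * int) : int :=
  let: (u, v) := p in
  v * (u ^+ 3 + a * u ^+ 2 * v + b * u * v ^+ 2 + c * v ^+ 3).

Definition Psi (a b c : int) : set (int * int) :=
  [set p | coprimez p.1 p.2 /\ quartic a b c p != 0].

Definition squarefree (s : int) : Prop :=
  forall d : nat, (d%:Z ^+ 2 %| s)%Z -> d = 1%N.

(* For n != 0 the set below is a singleton. *)
Definition squarefree_part (n : rat) : int :=
  xget 0 [set s : int | squarefree s /\ exists m : rat, n = s%:~R * m ^+ 2].

(* The convention ln 0 = 0 (instead of -oo) is harmless because of the
   maximum with 1. *)
Definition height (R : realType) (q : rat) : R :=
  Num.max 1 (Num.max (ln `|(numq q)%:~R|) (ln `|(denq q)%:~R|)).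

Definition height_pair (R : realType) (p : int * int) : R :=
  height R (p.1%:~R / p.2%:~R).

Definition S_E (R : realType) (a b c : int) (j k : R) : \bar R :=
  \esum_(p in Psi a b c)
    (1 / (`|(squarefree_part (quartic a b c p)%:~R)%:~R| `^ k
          * height_pair R p `^ j))%:E.

Definition R_E (R : realType) (a b c : int) (j k : R) : \bar R :=
  \esum_(t in [set t : nat | (0 < t)%N])
    \esum_(p in [set p | Psi a b c p /\ (t%:Z ^+ 2 %| quartic a b c p)%Z])
      (t%:R `^ (2 * k)
       / (`|(quartic a b c p)%:~R| `^ k * height_pair R p `^ j))%:E.

Definition enorm (R : realType) (p : int * int) : R :=
  Num.sqrt (p.1%:~R ^+ 2 + p.2%:~R ^+ 2).

(* Z/d^2Z is represented by 'I_(d ^ 2), which is also correct for d = 1 (the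
   type 'Z_1 is not the trivial ring). *)
Definition Omega (a b c : int) (d : nat) : {set 'I_(d ^ 2)} :=
  [set alpha : 'I_(d ^ 2) | (d%:Z ^+ 2 %| (cubic a b c).[alpha%:Z])%Z].

Definition lattice (d d' : nat) (alpha : 'I_(d ^ 2)) : set (int * int) :=
  [set p | (p.1 = alpha%:Z * p.2 %[mod d%:Z ^+ 2])%Z
           /\ (p.2 = 0 %[mod d'%:Z ^+ 2])%Z].

Definition shortest_nonzero (R : realType) (L : set (int * int))
    (w : int * int) : Prop :=
  [/\ L w, w != (0, 0) &
      forall z, L z -> z != (0, 0) -> enorm R w <= enorm R z].

Definition shortest_vector_choice (R : realType) (a b c : int)
    (omega : forall d d' : nat, 'I_(d ^ 2) -> int * int) : Prop :=
  forall (d d' : nat) (alpha : 'I_(d ^ 2)),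
    (0 < d)%N -> (0 < d')%N -> alpha \in Omega a b c d ->
    shortest_nonzero R (lattice d' alpha) (omega d d' alpha).

Definition Q_E (R : realType) (a b c : int)
    (omega : forall d d' : nat, 'I_(d ^ 2) -> int * int) (j k : R) : \bar R :=
  \esum_(e in [set e : nat * nat | [/\ (0 < e.1)%N, (0 < e.2)%N &
                                       coprime e.1 e.2]])
    ((e.1 * e.2)%N%:R `^ (2 * k) / Num.max 1 (ln (e.1 * e.2)%N%:R) `^ j
     * \sum_(alpha in Omega a b c e.1 | `[< Psi a b c (omega e.1 e.2 alpha) >])
         enorm R (omega e.1 e.2 alpha) `^ (- (4 * k)))%:E.

(* Main.v *)
(* (a) => (b), (c): heights on the curves E^(D) are compared uniformly in D.
   Duplication and the quasi-parallelogram law give h(2P) >= 4 h(P) - C, and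
   h(P) >= c log|D| for squarefree D and P not of 2-torsion; if the ranks are at
   most r, the classes modulo 2^i show that O(2^(ri)) points of E^(D) have
   height at most 4^i log|D|. The part of S_E belonging to a given D is then
   O(|D|^-1 (log|D|)^-j) because r < 2j, and these terms have a finite sum
   when j > 1. For j <= 1 condition (a) never holds: every E has a twist of
   rank at least 2, obtained from a one-parameter family of twists with two
   points whose Gram determinant is positive for large parameters.
   The series S_E, R_E and Q_E are compared term by term: the pair
   (d d', omega) determines (d, d', alpha).
   (f) => (a): if E^(D) has n >= 2j independent points, then among the
   combinations with coefficients below M, up to a translation by one fixed
   point, there are at least c M^n points (u : v) of height O(M^2) with
   |F(u, v)| comparable to max(|u|, |v|)^4. For such a pair
   F(u, v) = s (d d')^2 with |s| <= |D|, so a large (u, v) is shorter than d d'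
   and is a shortest vector of its lattice up to sign; it contributes at least
   c M^(-2j) to Q_E. Disjoint batches of such pairs make Q_E diverge. *)
From HB Require Import structures.
Require Import Defs.
From mathcomp Require Import all_boot all_order all_algebra.
From mathcomp Require Import all_classical all_reals all_analysis.
From mathcomp Require Import finmap complex ring lra zify.
Set Implicit Arguments.
Unset Strict Implicit.
Unset Printing Implicit Defensive.
Import Order.TTheory GRing.Theory Num.Theory.
Import numFieldNormedType.Exports.
Local Open Scope classical_set_scope.
Local Open Scope ring_scope.

(** * The group law of a twist *)

(** Two obstacles shape the proof. The height estimates must be uniform in the twist D; this is
    possible because the forms that express x(P + Q) and x(P - Q) through x(P) and x(Q) do not
    involve D, so that their constants depend on a, b, c alone. Moreover, a rank bound limits the
    sizes of independent families but says nothing about torsion: classes are therefore taken modulo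
    2^k and modulo torsion, and torsion is handled through its vanishing canonical height.

    The exponent k disappears in both directions: above, |s|^-k <= |s|^-1; below, (d d')^2 and the
    fourth power of the norm of omega have the same order of magnitude in the terms that are kept,
    so that their k-th powers cancel up to a constant.

    For a twist of rank two, exact canonical heights are avoided. Two-sided bounds for the naive
    heights of P and Q and lower bounds for those of P + Q and P - Q, all in multiples of log n,
    already force a positive Gram determinant. *)

Definition discr (R : comPzRingType) (a b c : R) : R :=
  a ^+ 2 * b ^+ 2 - 4 * b ^+ 3 - 4 * a ^+ 3 * c - 27 * c ^+ 2
  + 18 * a * b * c.

Section Chords.
Variables a b c d : rat.
Hypothesis discr_neq0 : discr a b c != 0.
Hypothesis d_neq0 : d != 0.

(* The line [y = l x + m] meets the curve in the abscissae [x1], [x2], [x3],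
   counted with multiplicity; this treats chords and tangents alike. *)
Definition collinear (l m x1 x2 x3 : rat) : Prop :=
  [/\ x1 + x2 + x3 = d * l ^+ 2 - a,
      x1 * x2 + x1 * x3 + x2 * x3 = b - 2 * d * l * m &
      x1 * x2 * x3 = d * m ^+ 2 - c].

Lemma collinearC12 l m x1 x2 x3 :
  collinear l m x1 x2 x3 -> collinear l m x2 x1 x3.
Proof. by case=> h1 h2 h3; split; rewrite -?h1 -?h2 -?h3; ring. Qed.

Lemma collinearC23 l m x1 x2 x3 :
  collinear l m x1 x2 x3 -> collinear l m x1 x3 x2.
Proof. by case=> h1 h2 h3; split; rewrite -?h1 -?h2 -?h3; ring. Qed.

Definition on_curve (x y : rat) :=
  d * y ^+ 2 == x ^+ 3 + a * x ^+ 2 + b * x + c.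

Lemma on_curveN x y : on_curve x (- y) = on_curve x y.
Proof. by rewrite /on_curve sqrrN. Qed.

Lemma collinear_on l m x1 x2 x3 :
  collinear l m x1 x2 x3 -> on_curve x1 (l * x1 + m).
Proof.
case=> h1 h2 h3; apply/eqP.
have -> : c = d * m ^+ 2 - x1 * x2 * x3 by rewrite h3; ring.
have -> : b = x1 * x2 + x1 * x3 + x2 * x3 + 2 * d * l * m by rewrite h2; ring.
have -> : a = d * l ^+ 2 - (x1 + x2 + x3) by rewrite h1; ring.
by ring.
Qed.

(** The discriminant lies in the ideal generated by f and f', so that both cannot vanish at the same
    x. *)
Lemma on_simple_root x :
  on_curve x 0 -> 3 * x ^+ 2 + 2 * a * x + b != 0.
Proof.
move=> /eqP h; apply: contra_neq discr_neq0 => h'.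
pose f := x ^+ 3 + a * x ^+ 2 + b * x + c.
have f0 : f = 0 by rewrite /f -h; ring.
have : discr a b c = ((18 * b - 6 * a ^+ 2) * x
     + (15 * a * b - 4 * a ^+ 3 - 27 * c)) * f
  + ((2 * a ^+ 2 - 6 * b) * x ^+ 2 + (2 * a ^+ 3 - 7 * a * b + 9 * c) * x
     + (a ^+ 2 * b + 3 * a * c - 4 * b ^+ 2))
    * (3 * x ^+ 2 + 2 * a * x + b).
  by rewrite /f /discr; ring.
by rewrite f0 h' !mulr0 addr0.
Qed.

Definition slope (x1 y1 x2 y2 : rat) :=
  if x1 == x2 then (3 * x1 ^+ 2 + 2 * a * x1 + b) / (2 * d * y1)
  else (y2 - y1) / (x2 - x1).

Lemma slopeP x1 y1 x2 y2 :
  on_curve x1 y1 -> on_curve x2 y2 -> ~~ ((x1 == x2) && (y1 == - y2)) ->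
  let l := slope x1 y1 x2 y2 in let m := y1 - l * x1 in
  y2 = l * x2 + m /\ collinear l m x1 x2 (d * l ^+ 2 - a - x1 - x2).
Proof.
move=> /eqP h1 /eqP h2 hne l m.
have [x12|x12] := eqVneq x1 x2.
  have ey : y1 = y2.
    move: hne; rewrite x12 eqxx /=; apply: contra_neq_eq => ny.
    have : d * y1 ^+ 2 = d * y2 ^+ 2 by rewrite h1 h2 x12.
    move/(mulfI d_neq0)/eqP; rewrite eqf_sqr (negbTE ny) /=.
    by move/eqP.
  have y0 : y1 != 0.
    by move: hne; rewrite x12 ey eqxx /= -subr_eq0 opprK -mulr2n mulrn_eq0.
  have hl : 2 * d * y1 * l = 3 * x1 ^+ 2 + 2 * a * x1 + b.
    by rewrite /l /slope x12 eqxx; field; rewrite d_neq0 ey -?ey y0.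
  split; first by rewrite /m -ey x12; ring.
  have hb : b = 2 * d * y1 * l - 3 * x1 ^+ 2 - 2 * a * x1 by rewrite hl; ring.
  have hc : c = d * y1 ^+ 2 - x1 ^+ 3 - a * x1 ^+ 2 - b * x1 by rewrite h1; ring.
  by rewrite -x12 /collinear hc hb /m; split; ring.
have x0 : x2 - x1 != 0 by rewrite subr_eq0 eq_sym.
have hl : y2 = y1 + l * (x2 - x1).
  by rewrite /l /slope (negbTE x12); field.
split; first by rewrite hl /m; ring.
(* The divided difference at x1, x2 of the cubic minus d (l x + m)^2. With the curve equation at x1
   it determines b and c, and the Vieta relations follow. *)
have hq : x1 ^+ 2 + x1 * x2 + x2 ^+ 2 + (a - d * l ^+ 2) * (x1 + x2)
          + (b - 2 * d * l * m) = 0.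
  apply: (mulfI x0); rewrite mulr0.
  transitivity ((x2 ^+ 3 + a * x2 ^+ 2 + b * x2 + c)
     - (x1 ^+ 3 + a * x1 ^+ 2 + b * x1 + c)
     - d * (l * x2 + m) ^+ 2 + d * (l * x1 + m) ^+ 2); first by ring.
  by rewrite -h1 -h2 hl /m; ring.
have hb : b = 2 * d * l * m - (x1 ^+ 2 + x1 * x2 + x2 ^+ 2
                 + (a - d * l ^+ 2) * (x1 + x2)).
  by apply/eqP; rewrite -subr_eq0; apply/eqP; rewrite -[RHS]hq; ring.
have hc : c = d * y1 ^+ 2 - x1 ^+ 3 - a * x1 ^+ 2 - b * x1 by rewrite h1; ring.
by split; rewrite ?hc ?hb /m; ring.
Qed.

(** Converse of [slopeP]: the three abscissae determine the line. If x1 = x2, then f'(x1) = 2 d l y,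
    so y = 0 would make x1 a double root of f; hence the two points are not opposite. *)
Lemma slope_collinear l m x1 x2 x3 :
  collinear l m x1 x2 x3 ->
  ~~ ((x1 == x2) && (l * x1 + m == - (l * x2 + m))) /\
  slope x1 (l * x1 + m) x2 (l * x2 + m) = l.
Proof.
move=> hc; have on1 := collinear_on hc; case: hc => h1 h2 h3.
rewrite /slope; have [x12|x12] := eqVneq x1 x2; last first.
  have x0 : x2 - x1 != 0 by rewrite subr_eq0 eq_sym.
  by split=> //; field.
have hd : 3 * x1 ^+ 2 + 2 * a * x1 + b = 2 * d * l * (l * x1 + m).
  have -> : b = x1 * x2 + x1 * x3 + x2 * x3 + 2 * d * l * m by rewrite h2; ring.
  have -> : a = d * l ^+ 2 - (x1 + x2 + x3) by rewrite h1; ring.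
  by rewrite -x12; ring.
have y0 : l * x1 + m != 0.
  apply/eqP => y0; move: on1 => /[dup]; rewrite {1}y0 => /on_simple_root.
  by rewrite hd y0 mulr0 eqxx.
split; last by rewrite hd; field; rewrite d_neq0 y0.
by rewrite /= -x12 -subr_eq0 opprK -mulr2n mulrn_eq0.
Qed.

(** The addition of the definitions with rational coefficients in place of integral ones, so that
    the proofs are about identities in a field. *)
Definition addc (P Q : ec_point) : ec_point :=
  match P, Q with
  | None, _ => Q
  | _, None => P
  | Some (x1, y1), Some (x2, y2) =>
    if (x1 == x2) && (y1 == - y2) then None else
    let l := slope x1 y1 x2 y2 in
    let x3 := d * l ^+ 2 - a - x1 - x2 in
    Some (x3, l * (x1 - x3) - y1)
  end.

Arguments addc : simpl never.

Definition onc (P : ec_point) : bool :=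
  if P is Some (x, y) then on_curve x y else true.

Lemma addc_collinear l m x1 x2 x3 : collinear l m x1 x2 x3 ->
  addc (Some (x1, l * x1 + m)) (Some (x2, l * x2 + m)) =
  Some (x3, - (l * x3 + m)).
Proof.
move=> hc; have [h1 h2] := slope_collinear hc.
rewrite /addc (negbTE h1) h2; case: hc => h _ _.
have -> : d * l ^+ 2 - a - x1 - x2 = x3 by rewrite -h; ring.
by congr (Some (_, _)); ring.
Qed.

(** Case analysis for a sum in which chords and tangents form a single case. *)
Variant addc_spec (P Q : ec_point) : ec_point -> Type :=
| AddcNone : P = ec_opp Q -> addc_spec P Q None
| AddcLine (l m x1 x2 x3 : rat) of P = Some (x1, l * x1 + m) &
   Q = Some (x2, l * x2 + m) & collinear l m x1 x2 x3 :
   addc_spec P Q (Some (x3, - (l * x3 + m))).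

Lemma addcP x1 y1 x2 y2 : on_curve x1 y1 -> on_curve x2 y2 ->
  addc_spec (Some (x1, y1)) (Some (x2, y2))
    (addc (Some (x1, y1)) (Some (x2, y2))).
Proof.
move=> on1 on2; rewrite /addc; case: ifPn => h.
  by apply: AddcNone; case/andP: h => /eqP-> /eqP->.
have [ey hc] := slopeP on1 on2 h.
set l := slope _ _ _ _ in ey hc *; set x3 := _ - x2 in hc *.
have -> : l * (x1 - x3) - y1 = - (l * x3 + (y1 - l * x1)) by ring.
by apply: (AddcLine _ _ hc); rewrite ?ey //; congr (Some (_, _)); ring.
Qed.

Lemma onc_opp P : onc (ec_opp P) = onc P.
Proof. by case: P => [[x y]|] //=; rewrite on_curveN. Qed.

Lemma onc_add P Q : onc P -> onc Q -> onc (addc P Q).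
Proof.
case: P Q => [[x1 y1]|] [[x2 y2]|] //= on1 on2.
case: (addcP on1 on2) => // l m ? ? x3 _ _ hc.
by rewrite /= on_curveN; apply: collinear_on (collinearC12 (collinearC23 hc)).
Qed.

Lemma addcC P Q : onc P -> onc Q -> addc P Q = addc Q P.
Proof.
case: P Q => [[x1 y1]|] [[x2 y2]|] //= on1 on2.
case: (addcP on1 on2) => // [[-> ->]|l m x1' x2' x3 [-> ->] [-> ->] hc].
  by rewrite /addc opprK !eqxx.
by rewrite (addc_collinear (collinearC12 hc)).
Qed.

Lemma addc0 P : addc P None = P.
Proof. by case: P => [[x y]|]. Qed.

Lemma addcN P : addc (ec_opp P) P = None.
Proof. by case: P => [[x y]|] //; rewrite /addc /= !eqxx. Qed.

Lemma collinearN l m x1 x2 x3 :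
  collinear l m x1 x2 x3 -> collinear (- l) (- m) x1 x2 x3.
Proof. by case=> h1 h2 h3; split; rewrite ?h1 ?h2 ?h3; ring. Qed.

(** Reflecting the line through P, Q and -(P + Q) in the x-axis gives the line through -P, -Q and P
    + Q. This is the degenerate case of associativity, and it yields cancellation. *)
Lemma addc_oppK P Q : onc P -> onc Q -> addc (ec_opp P) (addc P Q) = Q.
Proof.
case: P Q => [[x1 y1]|] [[x2 y2]|] //= on1 on2; last by rewrite /addc !eqxx.
case: (addcP on1 on2) => // [[-> ->]|l m x1' x2' x3 [-> ->] [-> ->] hc].
  by rewrite /= opprK.
have eN x : - l * x + - m = - (l * x + m) by ring.
have := addc_collinear (collinearC23 (collinearN hc)); rewrite !eN => ->.
by rewrite opprK.
Qed.

Lemma addc_eq0 P Q : onc P -> onc Q -> addc P Q = None -> P = ec_opp Q.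
Proof.
move=> onP onQ h; have := addc_oppK onQ onP; rewrite addcC ?onc_opp ?onc_add //.
by rewrite (addcC onQ onP) h => <-.
Qed.

(* When the two lines through [Q] are distinct, all data are rational functions
   of the abscissae and of the difference [k - l] of the slopes. *)
Lemma collinear_assoc k l m n q p s r t :
  k * q + m = l * q + n -> k != l ->
  collinear k m p q s -> collinear l n q r t ->
  exists z,
    addc (Some (s, - (k * s + m))) (Some (r, l * r + n)) = z /\
    addc (Some (p, k * p + m)) (Some (t, - (l * t + n))) = z.
Proof.
move=> hq kl [h1 h2 h3] [h1' h2' h3'].
(* In terms of g, u, v and the abscissae r, s all of k, l, p, t become polynomials; what remains are
   identities that [field] can check. *)
pose g := (k - l) / 2.
have dg0 : d * g != 0 by rewrite !mulf_neq0 ?subr_eq0.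
pose v := (p - r) / (2 * d * g).
pose u := (p + t - r - s) / (4 * d * g).
have [d0 g0] : d != 0 /\ g != 0 by apply/andP; rewrite -negb_or -mulf_eq0.
have hp : p = r + 2 * d * g * v by rewrite /v; field; rewrite d0 g0.
have ht : t = s + 2 * d * g * (2 * u - v).
  by rewrite /u /v; field; rewrite d0 g0.
have hkl : d * (k + l) * (2 * g) = p + s - r - t.
  transitivity ((d * k ^+ 2 - a) - (d * l ^+ 2 - a)); first by rewrite /g; field.
  by rewrite -h1 -h1'; ring.
have hk : k = v - u + g.
  rewrite (_ : k = (k + l) / 2 + g); last by rewrite /g; field.
  rewrite (_ : k + l = (p + s - r - t) / (2 * d * g)); last first.
    by rewrite -hkl; field; rewrite d0 g0.
  by rewrite /u /v; field; rewrite d0 g0.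
have hl : l = v - u - g.
  have -> : v - u - g = k - 2 * g by rewrite hk; ring.
  by rewrite /g; field.
pose y := k * q + m.
have hm : m = y - k * q by rewrite /y; ring.
have hn : n = y - l * q by rewrite /y hq; ring.
have hy : y = q * (v - u) - (v * (r + s) - 2 * r * u) / 2.
  apply: (mulfI dg0).
  have e1 : p * s = b - 2 * d * k * m - q * (p + s) by rewrite -h2; ring.
  have e2 : r * t = b - 2 * d * l * n - q * (r + t) by rewrite -h2'; ring.
  have e3 : (d * g) * (4 * y) = q * (p + s - r - t) - (p * s - r * t).
    have -> : p * s - r * t = (b - 2 * d * k * m - q * (p + s))
        - (b - 2 * d * l * n - q * (r + t)) by rewrite -e1 -e2.
    rewrite hm hn (_ : q * (p + s) = q * (p + s - r - t) + q * (r + t)); last by ring.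
    by rewrite -hkl /g; field.
  transitivity ((d * g) * (4 * y) / 4); first by field.
  by rewrite e3 hp ht; field.
have ha : a = d * k ^+ 2 - (p + q + s) by rewrite h1; ring.
have hb : b = p * q + p * s + q * s + 2 * d * k * m by rewrite h2; ring.
have hc : c = d * m ^+ 2 - p * q * s by rewrite h3; ring.
(* The line of slope u - g joins P + Q and R, the line of slope u + g joins P and Q + R; both meet
   the curve again at the abscissa z, and at the same ordinate. *)
pose m1 := - (k * s + m) - (u - g) * s.
pose n1 := (k * p + m) - (u + g) * p.
pose z := d * (u - g) ^+ 2 - a - s - r.
clearbody g v u y.
have e1 : (u - g) * r + m1 = l * r + n.
  by rewrite /m1 hm hn hk hl hy; field.
have e2 : (u + g) * t + n1 = - (l * t + n).
  by rewrite /n1 hm hn hk hl hy ht hp; field.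
have c1 : collinear (u - g) m1 s r z.
  rewrite /collinear /z; split; first by ring.
    by rewrite hb ha /m1 hm hk hy hp; field.
  by rewrite hc ha /m1 hm hk hy hp; field.
have c2 : collinear (u + g) n1 p t z.
  rewrite /collinear /z; split.
  - by rewrite ha hk ht hp; field.
  - by rewrite hb ha /n1 hm hk hy ht hp; field.
  - by rewrite hc ha /n1 hm hk hy ht hp; field.
have := addc_collinear c1; have := addc_collinear c2.
rewrite e1 e2 (_ : (u - g) * s + m1 = - (k * s + m)); last by rewrite /m1; ring.
rewrite (_ : (u + g) * p + n1 = k * p + m); last by rewrite /n1; ring.
move=> -> ->; eexists; split; first by [].
congr (Some (_, _)).
by rewrite /z ha /m1 /n1 hm hk hy hp; field.
Qed.

Lemma addcA P Q R : onc P -> onc Q -> onc R ->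
  addc P (addc Q R) = addc (addc P Q) R.
Proof.
move=> onP onQ onR.
case: P onP => [[x1 y1]|] // onP.
case: Q onQ => [[x2 y2]|] // onQ.
case: R onR => [[x3 y3]|] onR; last by rewrite !addc0.
have onPQ := onc_add onP onQ; have onQR := onc_add onQ onR.
case ePQ : (addc (Some (x1, y1)) (Some (x2, y2))) (onPQ) => [[s ys]|] onA; last first.
  have e := addc_eq0 onP onQ ePQ.
  have -> : addc None (Some (x3, y3)) = Some (x3, y3) by [].
  by rewrite e addc_oppK.
case eQR : (addc (Some (x2, y2)) (Some (x3, y3))) (onQR) => [[t yt]|] onB; last first.
  have e := addc_eq0 onQ onR eQR.
  have e' : Some (x3, y3) = ec_opp (Some (x2, y2)) by rewrite e /= opprK.
  rewrite e' -ePQ addcC ?onc_opp // [in RHS]addcC ?onc_opp //.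
  by rewrite (addcC onP onQ) addc_oppK.
case: (addcP onP onQ) ePQ => // l m p q s' [ex1 ey1] [ex2 ey2] cPQ [es eys].
case: (addcP onQ onR) eQR => // l' m' q' r t' [ex2' ey2'] [ex3 ey3] cQR [et eyt].
subst x1 x2 x3 s' t' q'.
have hq : l * q + m = l' * q + m' by rewrite -ey2.
have [ell|ell] := eqVneq l l'; last first.
  have [z [hz1 hz2]] := collinear_assoc hq ell cPQ cQR.
  by rewrite ey1 ey3 -eys -eyt hz1 hz2.
(* With equal slopes both triples lie on one line. Then p + s = r + t and p s = r t, hence p = r or
   p = t, and each case is a cancellation. *)
subst l'; have em : m = m' by apply: (@addrI _ (l * q)).
subst m'.
have e1 : p + s = r + t.
  case: cPQ cQR => h _ _ [h' _ _].
  have e : q + (p + s) = q + (r + t).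
    transitivity (p + q + s); first by ring.
    by rewrite h -h'; ring.
  exact: addrI e.
have e2 : p * s = r * t.
  case: cPQ cQR => _ h _ [_ h' _].
  have e : q * (p + s) + p * s = q * (p + s) + r * t.
    transitivity (p * q + p * s + q * s); first by ring.
    by rewrite h -h' e1; ring.
  exact: addrI e.
have : (p - r) * (p - t) == 0.
  rewrite (_ : _ * _ = p ^+ 2 - p * (r + t) + r * t); last by ring.
  by rewrite -e1 -e2; apply/eqP; ring.
rewrite mulf_eq0 !subr_eq0 => /orP[] /eqP e.
  have es' : s = t by apply: (@addrI _ p); rewrite e1 e.
  by rewrite addcC // -eys -eyt es' ey1 ey3 e.
have es' : s = r by apply: (@addrI _ p); rewrite e1 e addrC.
rewrite -eys -eyt ey1 ey3 e es'.
by rewrite /addc opprK !eqxx.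
Qed.

End Chords.

(** The conditions on discriminant and twist are packed into the index so that the group structure
    of [point E] can be found by inference. *)
Record curve := Curve {
  coefa : int; coefb : int; coefc : int; twist : int;
  _ : discr coefa coefb coefc != 0; _ : twist != 0 }.

Lemma discr_intr (R : comNzRingType) (a b c : int) :
  discr a%:~R b%:~R c%:~R = (discr a b c)%:~R :> R.
Proof. by rewrite /discr; ring. Qed.

Lemma curve_discr (E : curve) :
  discr (coefa E)%:~R (coefb E)%:~R (coefc E)%:~R != 0 :> rat.
Proof. by case: E => a b c d h h' /=; rewrite discr_intr intr_eq0. Qed.

Lemma curve_twist (E : curve) : (twist E)%:~R != 0 :> rat.
Proof. by case: E => a b c d h h' /=; rewrite intr_eq0. Qed.

Definition onE (E : curve) : pred ec_point :=
  onc (coefa E)%:~R (coefb E)%:~R (coefc E)%:~R (twist E)%:~R.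

Definition point (E : curve) := {P : ec_point | onE E P}.

HB.instance Definition _ (E : curve) := Choice.on (point E).
HB.instance Definition _ (E : curve) := SubChoice.on (point E).

Definition addE (E : curve) : ec_point -> ec_point -> ec_point :=
  addc (coefa E)%:~R (coefb E)%:~R (twist E)%:~R.

Section PointGroup.
Variable E : curve.
Let hd := curve_discr E.
Let hD := curve_twist E.

Definition point0 : point E := exist _ None isT.
Definition pointN (P : point E) : point E :=
  exist _ (ec_opp (val P)) (etrans (onc_opp _ _ _ _ _) (valP P)).
Definition pointD (P Q : point E) : point E :=
  exist _ (addE E (val P) (val Q)) (onc_add hD (valP P) (valP Q)).

Lemma pointDA : associative pointD.
Proof.
move=> P Q R; apply: val_inj.
exact: (addcA hd hD (valP P) (valP Q) (valP R)).
Qed.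

Lemma pointDC : commutative pointD.
Proof. by move=> P Q; apply: val_inj; apply: (addcC hd hD (valP P) (valP Q)). Qed.

Lemma point0D : left_id point0 pointD.
Proof. by move=> P; apply: val_inj. Qed.

Lemma pointND : left_inverse point0 pointN pointD.
Proof. by move=> P; apply: val_inj; apply: addcN. Qed.
End PointGroup.

HB.instance Definition _ (E : curve) := GRing.isZmodule.Build (point E)
  (@pointDA E) (@pointDC E) (@point0D E) (@pointND E).

Lemma cubicE (a b c : int) (x : rat) :
  (map_poly intr (cubic a b c)).[x]
  = x ^+ 3 + a%:~R * x ^+ 2 + b%:~R * x + c%:~R.
Proof.
rewrite /cubic !rmorphD /= !map_polyZ /= !map_polyXn map_polyX map_polyC /=.
by rewrite !hornerE.
Qed.

Lemma cubic_derivE (a b c : int) (x : rat) :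
  (map_poly intr (cubic a b c))^`().[x]
  = 3 * x ^+ 2 + 2 * a%:~R * x + b%:~R.
Proof.
rewrite /cubic !rmorphD /= !map_polyZ /= !map_polyXn map_polyX map_polyC /=.
rewrite !derivD !derivZ !derivXn derivX derivC !hornerE /=.
by rewrite !mulr_natl; ring.
Qed.

Lemma ec_onP (E : curve) (P : ec_point) :
  ec_on (coefa E) (coefb E) (coefc E) (twist E) P <-> onE E P.
Proof.
case: P => [[x y]|] //=; rewrite cubicE; split; first by move=> ?; apply/eqP.
by move/eqP.
Qed.

Lemma ec_addE (E : curve) (P Q : ec_point) :
  ec_add (coefa E) (coefb E) (coefc E) (twist E) P Q = addE E P Q.
Proof.
case: P Q => [[x1 y1]|] [[x2 y2]|] //; rewrite /addE /ec_add /addc.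
by rewrite /slope cubic_derivE.
Qed.

Lemma val_pointD (E : curve) (P Q : point E) : val (P + Q) = addE E (val P) (val Q).
Proof. by []. Qed.

Lemma val_pointN (E : curve) (P : point E) : val (- P) = ec_opp (val P).
Proof. by []. Qed.

Lemma val_pointMn (E : curve) (P : point E) n :
  val (P *+ n) = iter n (ec_add (coefa E) (coefb E) (coefc E) (twist E) (val P)) None.
Proof.
elim: n => [|n IHn]; first by rewrite mulr0n.
by rewrite mulrS val_pointD iterS IHn ec_addE.
Qed.

Lemma val_pointMz (E : curve) (P : point E) (m : int) :
  val (P *~ m) = ec_mulz (coefa E) (coefb E) (coefc E) (twist E) m (val P).
Proof.
case: m => n; first by rewrite /ec_mulz -val_pointMn.
by rewrite NegzE mulrNz val_pointN val_pointMn.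
Qed.

Definition independent (A : zmodType) (n : nat) (P : 'I_n -> A) : Prop :=
  forall m : 'I_n -> int, \sum_(i < n) P i *~ m i = 0 -> forall i, m i = 0.

Lemma ec_independentE (E : curve) (n : nat) (P : 'I_n -> point E) :
  ec_independent (coefa E) (coefb E) (coefc E) (twist E) (val \o P) <->
  independent P.
Proof.
have sumE (m : 'I_n -> int) : val (\sum_(i < n) P i *~ m i) =
  \big[ec_add (coefa E) (coefb E) (coefc E) (twist E)/None]_(i < n)
     ec_mulz (coefa E) (coefb E) (coefc E) (twist E) (m i) (val (P i)).
  have valD : {morph (val : point E -> ec_point) : P Q / P + Q >->
      ec_add (coefa E) (coefb E) (coefc E) (twist E) P Q}.
    by move=> x y; rewrite ec_addE.
  rewrite (big_morph _ valD (erefl (val (0 : point E)))).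
  by apply: eq_bigr => i _; rewrite val_pointMz.
split=> h m hm.
  by have := h m (etrans (esym (sumE m)) (congr1 val hm)).
by apply: h; apply: val_inj; exact: etrans (sumE m) hm.
Qed.

Lemma ec_rank_lt (R : realType) (E : curve) (x : R) :
  (ec_rank R (coefa E) (coefb E) (coefc E) (twist E) < x%:E)%E ->
  forall n (P : 'I_n -> point E), independent P -> n%:R < x.
Proof.
move=> hx n P hP; rewrite -lte_fin; apply: le_lt_trans hx.
apply: ereal_sup_ubound => /=; exists n => //; exists (val \o P).
by split; [move=> i; apply/ec_onP/valP | apply/ec_independentE].
Qed.

(** Cardinalities are integers: if all were below x, they would be at most ceil x - 1, and so would
    their supremum. The bound is thus attained by an actual family even if the supremum is
    infinite. *)
Lemma ec_rank_ge (R : realType) (E : curve) (x : R) :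
  (x%:E <= ec_rank R (coefa E) (coefb E) (coefc E) (twist E))%E ->
  exists n (P : 'I_n -> point E), independent P /\ x <= n%:R.
Proof.
move=> hx; apply: contrapT => hn.
suff : (ec_rank R (coefa E) (coefb E) (coefc E) (twist E)
        <= (Num.ceil x - 1)%:~R%:E)%E.
  by move/(le_trans hx); rewrite lee_fin leNgt ceilB1_lt.
apply: ge_ereal_sup => _ [n [P [honP hP]] <-].
pose P' i : point E := exist _ (P i) ((ec_onP E (P i)).1 (honP i)).
have iP' : independent P' by apply/ec_independentE.
have : n%:R < x by rewrite ltNge; apply/negP => hxn; apply: hn; exists n, P'.
rewrite lee_fin -[n%:R]/((Posz n)%:~R) -ceil_gt_int ler_int => h.
by rewrite lerBrDr lezD1.
Qed.

(** * Naive heights and the biquadratic forms of the group law *)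

Definition coords (P : ec_point) : int * int :=
  if P is Some (x, _) then (numq x, denq x) else (1, 0).

Definition maxnorm (p : int * int) : int := Num.max `|p.1| `|p.2|.

Lemma coords_opp P : coords (ec_opp P) = coords P.
Proof. by case: P => [[]|]. Qed.

Lemma coords_coprime P : coprimez (coords P).1 (coords P).2.
Proof. by case: P => [[x y]|] //=; exact: coprime_num_den. Qed.

Lemma maxnorm_coprime_gt0 p : coprimez p.1 p.2 -> 0 < maxnorm p.
Proof.
case: p => u v /= h; rewrite /maxnorm lt_max !normr_gt0 /=.
apply: contraLR h; rewrite negb_or !negbK => /andP[/eqP-> /eqP->].
by rewrite /coprimez gcdz0.
Qed.

Lemma norm1_maxnorm p : `|p.1| <= maxnorm p.
Proof. by rewrite le_max lexx. Qed.

Lemma norm2_maxnorm p : `|p.2| <= maxnorm p.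
Proof. by rewrite le_max lexx orbT. Qed.

(* The abscissae of [P + Q] and [P - Q] are the roots of a quadratic equation
   whose coefficients are forms of bidegree (2, 2) in the abscissae of [P] and
   [Q]; the twist does not occur in these forms. *)
Section Kummer.
Variables a b c : int.

Definition kummer0 (p q : int * int) : int := (p.1 * q.2 - q.1 * p.2) ^+ 2.
Definition kummer1 (p q : int * int) : int :=
  2 * ((p.1 * q.1 + b * (p.2 * q.2)) * (p.1 * q.2 + q.1 * p.2)
       + 2 * a * (p.1 * q.1) * (p.2 * q.2) + 2 * c * (p.2 * q.2) ^+ 2).
Definition kummer2 (p q : int * int) : int :=
  (p.1 * q.1 - b * (p.2 * q.2)) ^+ 2
  - 4 * c * (p.2 * q.2) * (p.1 * q.2 + q.1 * p.2) - 4 * a * c * (p.2 * q.2) ^+ 2.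

Definition kummer_const : int := 4 * (1 + `|a| + `|b| + `|c|) ^+ 2.

Lemma kummer_le p q :
  let M := kummer_const * (maxnorm p * maxnorm q) ^+ 2 in
  [/\ `|kummer0 p q| <= M, `|kummer1 p q| <= M & `|kummer2 p q| <= M].
Proof.
set N := maxnorm p * maxnorm q => M.
have hle (x y : int) : `|x| <= maxnorm p -> `|y| <= maxnorm q -> `|x * y| <= N.
  by move=> hx hy; rewrite normrM ler_pM.
have h11 := hle _ _ (norm1_maxnorm p) (norm1_maxnorm q).
have h12 := hle _ _ (norm1_maxnorm p) (norm2_maxnorm q).
have h21 := hle _ _ (norm2_maxnorm p) (norm1_maxnorm q).
have h22 := hle _ _ (norm2_maxnorm p) (norm2_maxnorm q).
rewrite (mulrC p.2 q.1) in h21.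
rewrite {}/M /kummer0 /kummer1 /kummer2 /kummer_const.
move: h11 h12 h21 h22.
set x := p.1 * q.1; set y := p.1 * q.2; set z := q.1 * p.2; set t := p.2 * q.2.
clearbody N x y z t => hx hy hz ht.
have N0 : 0 <= N by apply: le_trans hx.
have hmul (r s : int) k l : `|r| <= k -> `|s| <= l -> `|r * s| <= k * l.
  by move=> hr hs; rewrite normrM ler_pM.
have hadd (r s : int) k l : `|r| <= k -> `|s| <= l -> `|r + s| <= k + l.
  by move=> hr hs; apply: le_trans (ler_normD _ _) _; apply: lerD.
have hsub (r s : int) k l : `|r| <= k -> `|s| <= l -> `|r - s| <= k + l.
  by move=> hr hs; apply: le_trans (ler_normB _ _) _; apply: lerD.
have ha := lexx `|a|; have hb := lexx `|b|; have hc := lexx `|c|.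
have h2 : `|2 : int| <= 2 by []. have h4 : `|4 : int| <= 4 by [].
have A0 := normr_ge0 a; have B0 := normr_ge0 b; have C0 := normr_ge0 c.
have N2 : 0 <= N ^+ 2 by apply: sqr_ge0.
have AC : 0 <= `|a| * `|c| by apply: mulr_ge0.
have AB : 0 <= `|a| * `|b| by apply: mulr_ge0.
have BC : 0 <= `|b| * `|c| by apply: mulr_ge0.
have A2 := sqr_ge0 `|a|; have B2 := sqr_ge0 `|b|; have C2 := sqr_ge0 `|c|.
have fin (r : int) k : `|r| <= k * N ^+ 2 ->
   k <= 4 * (1 + `|a| + `|b| + `|c|) ^+ 2 ->
   `|r| <= 4 * (1 + `|a| + `|b| + `|c|) ^+ 2 * N ^+ 2.
  by move=> h h'; apply: le_trans h _; apply: ler_wpM2r.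
split.
- apply: (fin _ 4); last by lra.
  rewrite (_ : 4 * N ^+ 2 = (N + N) * (N + N)); last by ring.
  by rewrite expr2; apply: (hmul); apply: (hsub).
- apply: (fin _ (4 * (1 + `|b| + `|a| + `|c|))); last by lra.
  rewrite (_ : _ * N ^+ 2 = 2 * ((N + `|b| * N) * (N + N) + 2 * `|a| * N * N
    + 2 * `|c| * (N * N))); last by ring.
  apply: (hmul) => //; apply: (hadd); first apply: (hadd).
  + by apply: (hmul); apply: (hadd) => //; apply: (hmul).
  + by do !apply: (hmul).
  + by rewrite expr2; do !apply: (hmul).
- apply: (fin _ ((1 + `|b|) ^+ 2 + 8 * `|c| + 4 * `|a| * `|c|)); last by lra.
  rewrite (_ : _ * N ^+ 2 = (N + `|b| * N) * (N + `|b| * N)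
     + 4 * `|c| * N * (N + N) + 4 * `|a| * `|c| * (N * N)); last by ring.
  apply: (hsub); first apply: (hsub).
  + by rewrite expr2; apply: (hmul); apply: (hsub) => //; apply: (hmul).
  + by apply: (hmul); [do !apply: (hmul) | apply: (hadd)].
  + by rewrite expr2; do !apply: (hmul).
Qed.
End Kummer.

Section KummerRat.
Variables (a b c d x1 y1 x2 y2 : rat).
Hypothesis on1 : on_curve a b c d x1 y1.
Hypothesis on2 : on_curve a b c d x2 y2.
Hypothesis neq12 : x1 != x2.

Let x3 := d * ((y2 - y1) / (x2 - x1)) ^+ 2 - a - x1 - x2.
Let x4 := d * ((- y2 - y1) / (x2 - x1)) ^+ 2 - a - x1 - x2.

(** The terms with y1 y2 cancel in the symmetric functions of x3 and x4; only d y1^2 and d y2^2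
    remain, and the curve equation replaces them by the cubic. This is how d disappears. *)
Lemma kummer_sum : (x1 - x2) ^+ 2 * (x3 + x4)
  = 2 * ((x1 * x2 + b) * (x1 + x2) + 2 * a * (x1 * x2) + 2 * c).
Proof.
have n0 : x2 - x1 != 0 by rewrite subr_eq0 eq_sym.
have -> : (x1 - x2) ^+ 2 * (x3 + x4) =
  2 * (d * y1 ^+ 2 + d * y2 ^+ 2) - 2 * (x1 - x2) ^+ 2 * (a + x1 + x2).
  by rewrite /x3 /x4; field.
by rewrite (eqP on1) (eqP on2); ring.
Qed.

Lemma kummer_prod : (x1 - x2) ^+ 2 * (x3 * x4)
  = (x1 * x2 - b) ^+ 2 - 4 * c * (x1 + x2) - 4 * a * c.
Proof.
have n0 : x2 - x1 != 0 by rewrite subr_eq0 eq_sym.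
have -> : (x1 - x2) ^+ 2 * (x3 * x4) =
  (d * y1 ^+ 2 - d * y2 ^+ 2) ^+ 2 / (x1 - x2) ^+ 2
  - 2 * (a + x1 + x2) * (d * y1 ^+ 2 + d * y2 ^+ 2)
  + (x1 - x2) ^+ 2 * (a + x1 + x2) ^+ 2.
  by rewrite /x3 /x4; field; rewrite n0 subr_eq0 neq12.
by rewrite (eqP on1) (eqP on2); field; rewrite subr_eq0.
Qed.
End KummerRat.

Lemma duplication_abscissa (a b c d x y : rat) : d != 0 ->
  on_curve a b c d x y -> y != 0 ->
  let f := x ^+ 3 + a * x ^+ 2 + b * x + c in
  4 * f * (d * ((3 * x ^+ 2 + 2 * a * x + b) / (2 * d * y)) ^+ 2 - a - x - x)
  = (x ^+ 2 - b) ^+ 2 - 8 * c * x - 4 * a * c.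
Proof.
move=> d0 /eqP on1 y0 f; rewrite /f -on1.
transitivity ((3 * x ^+ 2 + 2 * a * x + b) ^+ 2
   - 4 * (d * y ^+ 2) * (a + x + x)); first by field; rewrite d0 y0.
by rewrite on1; ring.
Qed.

(** In the projective plane, (w0 : w1 : w2) is the symmetric product of the points r and s of the
    projective line. *)
Definition proportional (w0 w1 w2 : int) (r s : int * int) : Prop :=
  exists2 k : rat, k != 0 &
    [/\ w0%:~R = k * (r.2 * s.2)%:~R,
        w1%:~R = k * (r.1 * s.2 + s.1 * r.2)%:~R &
        w2%:~R = k * (r.1 * s.1)%:~R].

Lemma proportionalC w0 w1 w2 r s :
  proportional w0 w1 w2 r s -> proportional w0 w1 w2 s r.
Proof.
case=> k k0 [h0 h1 h2]; exists k => //.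
by split; rewrite ?h0 ?h1 ?h2; congr (_ * _%:~R); ring.
Qed.

(** For distinct abscissae these are [kummer_sum] and [kummer_prod]. If x1 = x2, then Q = P or Q =
    -P, so that one of P + Q, P - Q is the point (1 : 0) and the other is given by the duplication
    formula. *)
Lemma kummerP (E : curve) (P Q : point E) :
  let p := coords (val P) in let q := coords (val Q) in
  proportional (kummer0 p q) (kummer1 (coefa E) (coefb E) (coefc E) p q)
    (kummer2 (coefa E) (coefb E) (coefc E) p q)
    (coords (val (P + Q))) (coords (val (P - Q))).
Proof.
have hd := curve_discr E; have hD := curve_twist E.
set a := coefa E; set b := coefb E; set c := coefc E.
rewrite !val_pointD val_pointN /addE.
case: P Q => [[[x1 y1]|] onP] [[[x2 y2]|] onQ] /=; last first.
- by exists 1; rewrite ?oner_neq0 // /kummer0 /kummer1 /kummer2 /=; split;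
    rewrite [RHS]mul1r; congr (_%:~R); ring.
- by exists 1; rewrite ?oner_neq0 // /kummer0 /kummer1 /kummer2 /=; split;
    rewrite [RHS]mul1r; congr (_%:~R); ring.
- by exists 1; rewrite ?oner_neq0 // /kummer0 /kummer1 /kummer2 /=; split;
    rewrite [RHS]mul1r; congr (_%:~R); ring.
have d1 : (denq x1)%:~R != 0 :> rat by rewrite intr_eq0 denq_neq0.
have d2 : (denq x2)%:~R != 0 :> rat by rewrite intr_eq0 denq_neq0.
have n1 := numqE x1; have n2 := numqE x2.
set v1 := (denq x1)%:~R in d1 n1; set v2 := (denq x2)%:~R in d2 n2.
have k0 : (kummer0 (numq x1, denq x1) (numq x2, denq x2))%:~R
    = (v1 * v2) ^+ 2 * (x1 - x2) ^+ 2.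
  rewrite /kummer0 /= rmorphXn rmorphB !rmorphM /= n1 n2 -/v1 -/v2; ring.
have k1 : (kummer1 a b c (numq x1, denq x1) (numq x2, denq x2))%:~R
    = (v1 * v2) ^+ 2 * (2 * ((x1 * x2 + b%:~R) * (x1 + x2)
        + 2 * a%:~R * (x1 * x2) + 2 * c%:~R)).
  transitivity (2 * ((numq x1)%:~R * (numq x2)%:~R + b%:~R * (v1 * v2)) *
    ((numq x1)%:~R * v2 + (numq x2)%:~R * v1) + 4 * a%:~R * ((numq x1)%:~R *
    (numq x2)%:~R) * (v1 * v2) + 4 * c%:~R * (v1 * v2) ^+ 2).
    by rewrite /kummer1 /= /v1 /v2; ring.
  by rewrite n1 n2; ring.
have k2 : (kummer2 a b c (numq x1, denq x1) (numq x2, denq x2))%:~R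
    = (v1 * v2) ^+ 2 * ((x1 * x2 - b%:~R) ^+ 2 - 4 * c%:~R * (x1 + x2)
        - 4 * a%:~R * c%:~R).
  transitivity (((numq x1)%:~R * (numq x2)%:~R - b%:~R * (v1 * v2)) ^+ 2 -
    4 * c%:~R * (v1 * v2) * ((numq x1)%:~R * v2 + (numq x2)%:~R * v1)
    - 4 * a%:~R * c%:~R * (v1 * v2) ^+ 2).
    by rewrite /kummer2 /= /v1 /v2; ring.
  by rewrite n1 n2; ring.
have [x12|x12] := eqVneq x1 x2; last first.
  have := kummer_sum onP onQ x12; have := kummer_prod onP onQ x12.
  rewrite -/a -/b -/c /addc /slope (negbTE x12) /=.
  set x3 := _ * ((y2 - y1) / _) ^+ 2 - _ - _ - _.
  set x4 := _ * ((- y2 - y1) / _) ^+ 2 - _ - _ - _ => e1 e2.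
  have n3 := numqE x3; have n4 := numqE x4.
  have d3 : (denq x3)%:~R != 0 :> rat by rewrite intr_eq0 denq_neq0.
  have d4 : (denq x4)%:~R != 0 :> rat by rewrite intr_eq0 denq_neq0.
  exists ((v1 * v2) ^+ 2 * (x1 - x2) ^+ 2 / ((denq x3)%:~R * (denq x4)%:~R)).
    by rewrite !mulf_neq0 ?invr_eq0 ?expf_neq0 ?mulf_neq0 ?subr_eq0.
  rewrite k0 k1 k2 -e1 -e2 !(intrD, intrM) /=. rewrite n3 n4.
  by split; field; rewrite d3 d4.
have x21 : x2 = x1 by [].
subst x2.
have e21 : v2 = v1 by [].
rewrite e21 in k0 k1 k2.
have hdbl : proportional (kummer0 (numq x1, denq x1) (numq x1, denq x1))
  (kummer1 a b c (numq x1, denq x1) (numq x1, denq x1))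
  (kummer2 a b c (numq x1, denq x1) (numq x1, denq x1))
  (coords (addc a%:~R b%:~R (twist E)%:~R (Some (x1, y1)) (Some (x1, y1))))
  (1, 0).
  rewrite /proportional k0 k1 k2 /addc /slope eqxx /=.
  have [y0|y0] := eqVneq y1 (- y1).
    (* P has order 2: both sums are (1 : 0), and only [kummer2] survives. It equals f'(x1)^2 up to a
       power of the denominator, hence does not vanish. *)
    have {}y0 : y1 = 0 by lra.
    subst y1; have f0 := on_simple_root hd onP.
    have := eqP onP; rewrite expr0n mulr0 => /esym fx.
    exists ((v1 * v1) ^+ 2 *
        (3 * x1 ^+ 2 + 2 * (coefa E)%:~R * x1 + (coefb E)%:~R) ^+ 2).
      by rewrite !mulf_neq0 ?expf_neq0 ?mulf_neq0.
    split; rewrite /= ?mulr0 ?mulr1 ?subrr ?expr0n ?mulr0 //.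
      rewrite -[RHS](mulr0 (4 * (v1 * v1) ^+ 2)) -fx; ring.
    rewrite -[RHS](subr0) -(mulr0 ((8 * x1 + 4 * a%:~R) * (v1 * v1) ^+ 2)) -fx /a /b /c; ring.
  have y0' : y1 != 0 by apply: contra_neq y0 => ->; rewrite oppr0.
  have f0 : x1 ^+ 3 + a%:~R * x1 ^+ 2 + b%:~R * x1 + c%:~R != 0 :> rat.
    by rewrite -(eqP onP) mulf_neq0 ?expf_neq0.
  have := duplication_abscissa hD onP y0'.
  rewrite -/a -/b -/c; set x3 := _ - _ - _ - _ => e.
  have n3 := numqE x3.
  have d3 : (denq x3)%:~R != 0 :> rat by rewrite intr_eq0 denq_neq0.
  exists ((v1 * v1) ^+ 2 * (4 * (x1 ^+ 3 + a%:~R * x1 ^+ 2 + b%:~R * x1 + c%:~R))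
          / (denq x3)%:~R).
    by rewrite !mulf_neq0 ?invr_eq0 ?expf_neq0 ?mulf_neq0.
  rewrite /= !(intrD, intrM) n3; split; first by ring.
    by field.
  transitivity ((v1 * v1) ^+ 2 * ((x1 ^+ 2 - b%:~R) ^+ 2 - 8 * c%:~R * x1
     - 4 * a%:~R * c%:~R)); first by ring.
  by rewrite -e; field.
have : (y1 == y2) || (y1 == - y2).
  rewrite -eqf_sqr; apply/eqP/(mulfI hD).
  by rewrite (eqP onP) (eqP onQ).
have addNN y : addc a%:~R b%:~R (twist E)%:~R (Some (x1, y)) (Some (x1, - y)) = None.
  by rewrite /addc opprK !eqxx.
case/orP => /eqP ey.
  suff : proportional (kummer0 (numq x1, denq x1) (numq x1, denq x1))
     (kummer1 a b c (numq x1, denq x1) (numq x1, denq x1))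
     (kummer2 a b c (numq x1, denq x1) (numq x1, denq x1))
     (coords (addc a%:~R b%:~R (twist E)%:~R (Some (x1, y1)) (Some (x1, y1))))
     (coords (addc a%:~R b%:~R (twist E)%:~R (Some (x1, y1)) (Some (x1, - y1)))).
    by rewrite -ey /addc eqxx.
  by rewrite addNN.
have {}ey : y2 = - y1 by rewrite ey opprK.
suff : proportional (kummer0 (numq x1, denq x1) (numq x1, denq x1))
     (kummer1 a b c (numq x1, denq x1) (numq x1, denq x1))
     (kummer2 a b c (numq x1, denq x1) (numq x1, denq x1))
     (coords (addc a%:~R b%:~R (twist E)%:~R (Some (x1, y1)) (Some (x1, - y1))))
     (coords (addc a%:~R b%:~R (twist E)%:~R (Some (x1, y1)) (Some (x1, y1)))).
  by rewrite ey /addc eqxx opprK.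
by rewrite addNN; apply: proportionalC.
Qed.

Lemma dvdz_add (d x y : int) : (d %| x)%Z -> (d %| y)%Z -> (d %| x + y)%Z.
Proof. by move=> /dvdzP[m ->] /dvdzP[n ->]; rewrite -mulrDl dvdz_mull. Qed.

Lemma dvdz_cancel_add (d x y : int) :
  (d %| x)%Z -> (d %| x + y)%Z -> (d %| y)%Z.
Proof.
move=> /dvdzP[m ->] /dvdzP[n e]; apply/dvdzP; exists (n - m).
by rewrite mulrBl -e addrC addKr.
Qed.

(** Gauss's lemma for the product of two primitive linear forms. *)
Lemma dvdz_primitive (d : int) (r s : int * int) :
  coprimez r.1 r.2 -> coprimez s.1 s.2 ->
  (d %| r.2 * s.2)%Z -> (d %| r.1 * s.2 + s.1 * r.2)%Z -> (d %| r.1 * s.1)%Z ->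
  (d %| 1)%Z.
Proof.
case: r s => [u v] [w t] /= cuv cwt d0 d1 d2.
have cdu : coprimez d u.
  rewrite /coprimez; set g := gcdz d u.
  have gd : (g %| d)%Z by apply: dvdz_gcdl.
  have gu : (g %| u)%Z by apply: dvdz_gcdr.
  have cgv : coprimez g v by apply: coprimez_dvdl cuv.
  have gt : (g %| t)%Z by rewrite -(Gauss_dvdzr _ cgv) (dvdz_trans gd).
  have gw : (g %| w)%Z.
    rewrite -(Gauss_dvdzl _ cgv); apply: (@dvdz_cancel_add _ (u * t)).
      by rewrite dvdz_mulr.
    exact: dvdz_trans gd d1.
  have : (g %| gcdz w t)%Z by rewrite dvdz_gcd gw gt.
  by rewrite (eqP cwt) dvdz1 /g /gcdz absz_nat.
have dw : (d %| w)%Z by rewrite -(Gauss_dvdzr _ cdu).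
have cdt : coprimez d t by apply: coprimez_dvdl cwt.
have dv : (d %| v)%Z by rewrite -(Gauss_dvdzl _ cdt).
have dut : (d %| u * t)%Z.
  by apply: (@dvdz_cancel_add _ (w * v)); rewrite ?dvdz_mulr // addrC.
have dt : (d %| t)%Z by rewrite -(Gauss_dvdzr _ cdu).
by have := dvdz_gcd d w t; rewrite (eqP cwt) dw dt.
Qed.

(** The denominator of the rational factor divides all three coefficients of a primitive form. *)
Lemma proportional_int (w0 w1 w2 : int) (r s : int * int) :
  coprimez r.1 r.2 -> coprimez s.1 s.2 -> proportional w0 w1 w2 r s ->
  exists2 k : int, k != 0 &
    [/\ w0 = k * (r.2 * s.2), w1 = k * (r.1 * s.2 + s.1 * r.2) &
        w2 = k * (r.1 * s.1)].
Proof.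
move=> cr cs [k k0 [h0 h1 h2]].
have hk (w t : int) : w%:~R = k * t%:~R -> denq k * w = numq k * t.
  move=> e; apply: (@intr_inj rat); rewrite !intrM e numqE; ring.
have hd (w t : int) : w%:~R = k * t%:~R -> (denq k %| t)%Z.
  move=> /hk e; rewrite -(@Gauss_dvdzr _ (numq k)) -?e ?dvdz_mulr //.
  by rewrite coprimez_sym; exact: coprime_num_den.
have : (denq k %| 1)%Z := dvdz_primitive cr cs (hd _ _ h0) (hd _ _ h1) (hd _ _ h2).
rewrite dvdz1 => /eqP h1'.
have d1 : denq k = 1 by rewrite -(absz_denq k) h1'.
have e (w t : int) : w%:~R = k * t%:~R -> w = numq k * t.
  by move=> /hk; rewrite d1 mul1r.
exists (numq k); first by rewrite numq_eq0.
by split; apply: e.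
Qed.

(** Only the mixed products u t and w v need an argument. They differ in absolute value by at most
    M, and their product (v t)(u w) is at most M^2; so neither exceeds 2 M. *)
Lemma maxnorm_prod (M : int) (r s : int * int) :
  `|r.2 * s.2| <= M -> `|r.1 * s.2 + s.1 * r.2| <= M -> `|r.1 * s.1| <= M ->
  maxnorm r * maxnorm s <= 2 * M.
Proof.
case: r s => [u v] [w t] /=; rewrite /maxnorm /= => h0 h1 h2.
have M0 : 0 <= M by apply: le_trans h0.
have hx : `|u * t| <= 2 * M /\ `|w * v| <= 2 * M.
  have hp : `|u * t| * `|w * v| <= M * M.
    have -> : `|u * t| * `|w * v| = `|v * t| * `|u * w|.
      by rewrite -!normrM; congr `|_|; ring.
    exact: ler_pM.
  have : `|u * t| <= M + `|w * v|.
    rewrite (_ : u * t = (u * t + w * v) - w * v); last by ring.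
    by apply: le_trans (ler_normB _ _) _; rewrite lerD2r.
  have : `|w * v| <= M + `|u * t|.
    rewrite [X in `|X| <= _](_ : _ = (u * t + w * v) - u * t); last by ring.
    by apply: le_trans (ler_normB _ _) _; rewrite lerD2r.
  move: (normr_ge0 (u * t)) (normr_ge0 (w * v)) hp => *.
  by split; rewrite leNgt; apply/negP => ?; nia.
rewrite !normrM in h0 h2 hx.
case: (leP `|u| `|v|) => _; case: (leP `|w| `|t|) => _.
- by rewrite (le_trans h0) // ler_peMl.
- by rewrite mulrC; case: hx.
- by case: hx.
- by rewrite (le_trans h2) // ler_peMl.
Qed.

Lemma maxnorm_parallelogram (E : curve) (P Q : point E) :
  maxnorm (coords (val (P + Q))) * maxnorm (coords (val (P - Q))) <=
  2 * (kummer_const (coefa E) (coefb E) (coefc E)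
       * (maxnorm (coords (val P)) * maxnorm (coords (val Q))) ^+ 2).
Proof.
have [k k0 [h0 h1 h2]] :=
  proportional_int (coords_coprime _) (coords_coprime _) (kummerP P Q).
have [l0 l1 l2] := kummer_le (coefa E) (coefb E) (coefc E)
  (coords (val P)) (coords (val Q)).
have k1 : 1 <= `|k| by rewrite -gtz0_ge1 normr_gt0.
by apply: maxnorm_prod; [move: l0; rewrite h0|move: l1; rewrite h1|
  move: l2; rewrite h2]; apply: le_trans; rewrite [leRHS]normrM ler_peMl.
Qed.

(** In homogeneous coordinates x(2 P) is ([phi] : 4 [quartic]). *)
Definition phi (a b c : int) (p : int * int) : int :=
  let: (u, v) := p in
  u ^+ 4 - 2 * b * u ^+ 2 * v ^+ 2 - 8 * c * u * v ^+ 3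
  + (b ^+ 2 - 4 * a * c) * v ^+ 4.

Definition cubic_form (g0 g1 g2 g3 : int) (p : int * int) : int :=
  let: (u, v) := p in
  g0 * v ^+ 3 + g1 * u * v ^+ 2 + g2 * u ^+ 2 * v + g3 * u ^+ 3.

Lemma cubic_form_le g0 g1 g2 g3 p :
  `|cubic_form g0 g1 g2 g3 p|
    <= (`|g0| + `|g1| + `|g2| + `|g3|) * maxnorm p ^+ 3.
Proof.
case: p => u v; rewrite /cubic_form.
have hu := norm1_maxnorm (u, v); have hv := norm2_maxnorm (u, v).
move: hu hv => /=; set N := maxnorm _; move: N => N hu hv.
have N0 : 0 <= N by apply: le_trans hu.
have hu' n : `|u ^+ n| <= N ^+ n by rewrite normrX lerXn2r // nnegrE.
have hv' n : `|v ^+ n| <= N ^+ n by rewrite normrX lerXn2r // nnegrE.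
have h (g : int) m n : `|g * (u ^+ m * v ^+ n)| <= `|g| * N ^+ (m + n).
  by rewrite normrM ler_wpM2l // normrM exprD ler_pM.
rewrite !mulrDl; apply: le_trans (ler_normD _ _) _; apply: lerD; last first.
  by have := h g3 3 0%N; rewrite expr0 mulr1.
apply: le_trans (ler_normD _ _) _; apply: lerD; last first.
  by have := h g2 2 1%N; rewrite expr1 mulrA.
apply: le_trans (ler_normD _ _) _; apply: lerD.
  by have := h g0 0%N 3; rewrite expr0 mul1r.
by have := h g1 1%N 2; rewrite expr1 mulrA.
Qed.

(** This and [bezout_u] are Bezout identities for the two quartic forms of the duplication formula;
    they show that the forms have no common zero when the discriminant is not 0. *)
Lemma bezout_v (a b c : int) p :
  cubic_form (4 * a ^+ 2 - 16 * b) (- 8 * a) (- 12) 0 p * phi a b c p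
  + cubic_form (2 * a * b - 27 * c) (- 5 * b) (- a) 3 p
    * (4 * quartic a b c p) = 4 * discr a b c * p.2 ^+ 7.
Proof.
by case: p => u v; rewrite /cubic_form /phi /quartic /discr /=; ring.
Qed.

Lemma bezout_u (a b c : int) p :
  cubic_form
    (- 12 * b ^+ 3 * c + 48 * a * b * c ^+ 2 - 96 * c ^+ 3)
    (- 12 * b ^+ 4 + 52 * a * b ^+ 2 * c - 16 * a ^+ 2 * c ^+ 2
     - 88 * b * c ^+ 2)
    (- 8 * a * b ^+ 3 + 32 * a ^+ 2 * b * c + 4 * b ^+ 2 * c
     - 80 * a * c ^+ 2)
    (4 * a ^+ 2 * b ^+ 2 - 16 * b ^+ 3 - 16 * a ^+ 3 * c + 72 * a * b * c
     - 108 * c ^+ 2) p * phi a b c p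
  + cubic_form
    (3 * b ^+ 5 - 24 * a * b ^+ 3 * c + 48 * a ^+ 2 * b * c ^+ 2
     + 24 * b ^+ 2 * c ^+ 2 - 96 * a * c ^+ 3)
    (- a * b ^+ 4 + 8 * a ^+ 2 * b ^+ 2 * c - 26 * b ^+ 3 * c
     - 16 * a ^+ 3 * c ^+ 2 + 104 * a * b * c ^+ 2 - 192 * c ^+ 3)
    (- 5 * b ^+ 4 + 24 * a * b ^+ 2 * c - 16 * a ^+ 2 * c ^+ 2
     - 32 * b * c ^+ 2)
    (2 * a * b ^+ 3 - 8 * a ^+ 2 * b * c - b ^+ 2 * c + 20 * a * c ^+ 2) p
    * (4 * quartic a b c p) = 4 * discr a b c * p.1 ^+ 7.
Proof.
by case: p => u v; rewrite /cubic_form /phi /quartic /discr /=; ring.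
Qed.

(** Here k is the factor cancelled in the duplication formula. It divides 4 [discr] u^7 and 4
    [discr] v^7 with coprime u, v. The size estimate applies the identity for the larger of |u|,
    |v|, whose cofactors are cubic forms. *)
Lemma bezout_bound (a b c : int) :
  exists2 C : int, 0 < C & forall p : int * int, coprimez p.1 p.2 ->
  forall k x y : int, phi a b c p = k * x -> 4 * quartic a b c p = k * y ->
  (k %| 4 * discr a b c)%Z /\
  `|4 * discr a b c| * maxnorm p ^+ 4 <= C * `|k| * maxnorm (x, y).
Proof.
have hu := @bezout_u a b c; have hv := @bezout_v a b c.
move: hu hv.
set e0 := 4 * a ^+ 2 - _; set e1 := - 8 * a; set e2 := - 12; set e3 := 0.
set f0 := 2 * a * b - _; set f1 := - 5 * b; set f2 := - a; set f3 := 3.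
set g0 := - 12 * b ^+ 3 * c + _ + _; set g1 := - 12 * b ^+ 4 + _ + _ + _.
set g2 := - 8 * a * b ^+ 3 + _ + _ + _; set g3 := 4 * a ^+ 2 * _ + _ + _ + _ + _.
set h0 := 3 * b ^+ 5 + _ + _ + _ + _; set h1 := - a * b ^+ 4 + _ + _ + _ + _ + _.
set h2 := - 5 * b ^+ 4 + _ + _ + _; set h3 := 2 * a * b ^+ 3 + _ + _ + _.
move=> hu hv.
pose nrm (x y z t : int) : int := `|x| + `|y| + `|z| + `|t|.
pose C := 1 + nrm e0 e1 e2 e3 + nrm f0 f1 f2 f3 + nrm g0 g1 g2 g3 + nrm h0 h1 h2 h3.
have nrm0 x y z t : 0 <= nrm x y z t by rewrite /nrm !addr_ge0.
have C0 : 0 < C by rewrite /C !(ltr_wpDr, ltr_wpDl).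
exists C => // p cp k x y ex ey.
have H0 := maxnorm_coprime_gt0 cp.
have kd : (k %| 4 * discr a b c)%Z.
  have cuv : coprimez (p.1 ^+ 7) (p.2 ^+ 7) by rewrite coprimezXl // coprimezXr.
  have d1 : (k %| 4 * discr a b c * p.1 ^+ 7)%Z.
    by rewrite -hu ex ey dvdz_add // mulrCA dvdz_mulr.
  have d2 : (k %| 4 * discr a b c * p.2 ^+ 7)%Z.
    by rewrite -hv ex ey dvdz_add // mulrCA dvdz_mulr.
  have : (k %| gcdz (4 * discr a b c * p.1 ^+ 7) (4 * discr a b c * p.2 ^+ 7))%Z.
    by rewrite dvdz_gcd d1 d2.
  by rewrite -mulz_gcdr (eqP cuv) mulr1 !dvdzE absz_nat.
split=> //.
have hx := norm1_maxnorm (x, y); have hy := norm2_maxnorm (x, y).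
have hb x0 x1 x2 x3 y0 y1 y2 y3 z :
  cubic_form x0 x1 x2 x3 p * phi a b c p
  + cubic_form y0 y1 y2 y3 p * (4 * quartic a b c p)
  = 4 * discr a b c * z ^+ 7 ->
  nrm x0 x1 x2 x3 + nrm y0 y1 y2 y3 <= C ->
  `|4 * discr a b c| * `|z| ^+ 7
   <= C * `|k| * maxnorm (x, y) * maxnorm p ^+ 3.
  move=> e hC; rewrite -normrX -normrM -e ex ey.
  apply: le_trans (ler_normD _ _) _.
  rewrite !normrM.
  apply: (@le_trans _ _ ((nrm x0 x1 x2 x3 * maxnorm p ^+ 3) * (`|k| * maxnorm (x, y))
    + (nrm y0 y1 y2 y3 * maxnorm p ^+ 3) * (`|k| * maxnorm (x, y)))).
    by apply: lerD; apply: ler_pM => //; rewrite ?mulr_ge0 ?cubic_form_le //;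
      apply: ler_wpM2l.
  rewrite (_ : _ + _ = (nrm x0 x1 x2 x3 + nrm y0 y1 y2 y3) *
    (`|k| * maxnorm (x, y) * maxnorm p ^+ 3)); last by ring.
  have m0 : 0 <= maxnorm (x, y) by apply: le_trans hx.
  rewrite -(mulrA C) -(mulrA C); apply: ler_wpM2r => //.
  by rewrite !mulr_ge0 ?exprn_ge0 // ltW.
have hmax : `|4 * discr a b c| * maxnorm p ^+ 7
   <= C * `|k| * maxnorm (x, y) * maxnorm p ^+ 3.
  rewrite {1}/maxnorm; case: (leP `|p.1| `|p.2|) => _.
    apply: hb (hv p) _; rewrite /C; have := nrm0 g0 g1 g2 g3.
    by have := nrm0 h0 h1 h2 h3; lra.
  apply: hb (hu p) _; rewrite /C; have := nrm0 e0 e1 e2 e3.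
  by have := nrm0 f0 f1 f2 f3; lra.
by move: hmax; rewrite (exprD _ 4 3) mulrA ler_pM2r // exprn_gt0.
Qed.

Lemma kummer_diag (a b c : int) p :
  [/\ kummer0 p p = 0, kummer1 a b c p p = 4 * quartic a b c p &
      kummer2 a b c p p = phi a b c p].
Proof.
by case: p => u v; rewrite /kummer0 /kummer1 /kummer2 /quartic /phi /=;
  split; ring.
Qed.

Lemma maxnorm_double (a b c : int) : discr a b c != 0 ->
  exists2 C : int, 0 < C & forall E : curve,
  [/\ coefa E = a, coefb E = b & coefc E = c] -> forall P : point E,
  maxnorm (coords (val P)) ^+ 4 <= C * maxnorm (coords (val (P + P))).
Proof.
move=> hd; have [C C0 hC] := bezout_bound a b c; exists C => //.
move=> E [ea eb ec] P.
have := proportional_int (coords_coprime _) (coords_coprime _) (kummerP P P).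
rewrite ea eb ec; have [-> -> ->] := kummer_diag a b c (coords (val P)).
rewrite subrr /= !mulr0 !mulr1 mul1r add0r => -[k k0 [_ ey ex]].
have [kd] := hC _ (coords_coprime (val P)) _ _ _ ex ey.
have d0 : 4 * discr a b c != 0 by rewrite mulf_neq0.
have hk : `|k| <= `|4 * discr a b c|.
  by rewrite dvdzE in kd; rewrite -!abszE lez_nat dvdn_leq // absz_gt0.
rewrite (_ : ((coords (val (P + P))).1, _) = coords (val (P + P))); last by case: (coords _).
move=> h; rewrite -(ler_pM2l (_ : 0 < `|4 * discr a b c|)) ?normr_gt0 //.
apply: le_trans h _; rewrite [leRHS]mulrCA -mulrA ler_pM2l //.
by rewrite ler_pM // ltW // maxnorm_coprime_gt0 // coords_coprime.
Qed.

(** * Canonical heights *)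

Section QuadraticForm.
Variables (R : realFieldType) (A : zmodType) (q : A -> R).
Hypothesis parallelogram : forall x y,
  q (x + y) + q (x - y) = 2 * q x + 2 * q y.

Lemma quad0 : q 0 = 0.
Proof. by have := parallelogram 0 0; rewrite addr0 subr0; lra. Qed.

Lemma second_difference (g : int -> R) (s : R) :
  (forall m, g (m + 1) + g (m - 1) = 2 * g m + 2 * s) ->
  forall m, g m = s * m%:~R ^+ 2 + (g 1 - g 0 - s) * m%:~R + g 0.
Proof.
move=> hg m.
pose e (k : int) := s * k%:~R ^+ 2 + (g 1 - g 0 - s) * k%:~R + g 0.
have he k : e (k + 1) + e (k - 1) = 2 * e k + 2 * s.
  by rewrite /e !(rmorphD, rmorphB) /=; ring.
suff h (n : nat) : g n = e n /\ g (- n%:Z) = e (- n%:Z) /\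
    g n.+1 = e n.+1 /\ g (- n.+1%:Z) = e (- n.+1%:Z).
  by case: m => n; [case: (h n) | rewrite NegzE; case: (h n) => _ [_ []]].
have e1 (k : nat) : k.+1%:Z - 1 = k by lia.
have e2 (k : nat) : k.+1%:Z + 1 = k.+2 by lia.
have e3 (k : nat) : - k.+1%:Z - 1 = - k.+2%:Z by lia.
have e4 (k : nat) : - k.+1%:Z + 1 = - k%:Z by lia.
elim: n => [|n [h1 [h2 [h3 h4]]]].
  have g0 : g 0 = e 0 by rewrite /e; ring.
  have g1 : g 1 = e 1 by rewrite /e; ring.
  split; first by []; split; first by []; split; first by [].
  by have := hg 0; have := he 0; rewrite sub0r add0r; lra.
split; first by []; split; first by []; split.
  by have := hg n.+1; have := he n.+1; rewrite e1 e2; lra.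
by have := hg (- n.+1%:Z); have := he (- n.+1%:Z); rewrite e3 e4; lra.
Qed.

Lemma quad_affine x z m :
  q (x *~ m + z) = q x * m%:~R ^+ 2 + (q (x + z) - q z - q x) * m%:~R + q z.
Proof.
rewrite (@second_difference (fun m => q (x *~ m + z)) (q x)) => [|{}m].
  by rewrite mulr1z mulr0z add0r.
have -> : x *~ (m + 1) + z = x *~ m + z + x by rewrite mulrzDr mulr1z addrAC.
have -> : x *~ (m - 1) + z = x *~ m + z - x.
  by rewrite mulrzBr mulr1z addrAC.
exact: parallelogram.
Qed.

Lemma quadMz x m : q (x *~ m) = m%:~R ^+ 2 * q x.
Proof. by have := quad_affine x 0 m; rewrite !addr0 quad0 => ->; ring. Qed.

Lemma quadMn x n : q (x *+ n) = n%:R ^+ 2 * q x.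
Proof. exact: (quadMz x n). Qed.

Lemma quad_bilinear x y m n : q (x *~ m + y *~ n) =
  q x * m%:~R ^+ 2 + (q (x + y) - q x - q y) * m%:~R * n%:~R
  + q y * n%:~R ^+ 2.
Proof.
rewrite quad_affine [x + _]addrC quad_affine quadMz [y + x]addrC.
by ring.
Qed.

(** A relation would be an isotropic vector of a binary quadratic form that is definite, as
    completing the square shows. *)
Lemma gram_independent x y :
  (q (x + y) - q x - q y) ^+ 2 < 4 * q x * q y ->
  forall m n, x *~ m + y *~ n = 0 -> m = 0 /\ n = 0.
Proof.
move=> hB m n h; have := quad_bilinear x y m n; rewrite h quad0.
set B := q (x + y) - _ - _ in hB *; move: hB.
move: (q x) (q y) B => s t B hB e.
have hs : s != 0.
  by apply: contraTneq hB => ->; rewrite mulr0 mul0r -leNgt sqr_ge0.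
have e2 : (2 * s * m%:~R + B * n%:~R) ^+ 2
   + (4 * s * t - B ^+ 2) * n%:~R ^+ 2 = 0.
  by rewrite -[RHS](mulr0 (4 * s)) e; ring.
have n0 : n = 0.
  apply/eqP; rewrite -(intr_eq0 R); apply/negP => /negP n0.
  have : 0 < (4 * s * t - B ^+ 2) * n%:~R ^+ 2.
    by rewrite mulr_gt0 ?subr_gt0 // exprn_even_gt0.
  by have := sqr_ge0 (2 * s * m%:~R + B * n%:~R); lra.
split=> //; move: e; rewrite n0 mulr0 addr0 expr0n mulr0 addr0 => /esym/eqP.
by rewrite mulf_eq0 (negbTE hs) expf_eq0 /= intr_eq0 => /eqP.
Qed.

Hypothesis quad_ge0 : forall x, 0 <= q x.

Lemma quadD_le x y : q (x + y) <= 2 * q x + 2 * q y.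
Proof. by rewrite -parallelogram lerDl. Qed.

Lemma quadB_le x y : q (x - y) <= 2 * q x + 2 * q y.
Proof. by rewrite -parallelogram lerDr. Qed.

Lemma quad_sum_le n (x : 'I_n -> A) :
  q (\sum_(i < n) x i) <= 2 ^+ n * \sum_(i < n) q (x i).
Proof.
elim: n x => [|n IHn] x; first by rewrite !big_ord0 quad0 mulr0.
rewrite !big_ord_recl /=; apply: le_trans (quadD_le _ _) _.
rewrite exprS mulrDr; apply: lerD.
  rewrite ler_wpM2r // ler_peMr ?exprn_ege1 //; lra.
by rewrite -mulrA ler_wpM2l // IHn.
Qed.

(** Multiplication by n scales q by n^2 and makes x vanish. *)
Lemma quad_torsion x n : (0 < n)%N -> x *+ n = 0 ->
  q x = 0 /\ forall y, q (y + x) = q y.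
Proof.
move=> n0 hx.
have n2 : (n%:R : R) ^+ 2 != 0 by rewrite expf_neq0 // pnatr_eq0 -lt0n.
split.
  by apply: (mulfI n2); rewrite -quadMn hx quad0 mulr0.
by move=> y; apply: (mulfI n2); rewrite -!quadMn mulrnDl hx addr0.
Qed.
End QuadraticForm.

Section CanonicalHeight.
Variables (R : realType) (A : zmodType) (h : A -> R) (C : R).
Hypothesis h_ge0 : forall x, 0 <= h x.
Hypothesis h0 : h 0 = 0.
Hypothesis quasi_parallelogram : forall x y,
  `|h (x + y) + h (x - y) - (2 * h x + 2 * h y)| <= C.

Local Notation approx x := (fun n : nat => (h (x *+ (2 ^ n)) + C / 3) / 4 ^+ n).

(* Tate's limit; the term [C / 3] makes the sequence nonincreasing. *)
Definition canonical_height (x : A) : R := limn (approx x).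

Lemma quasi_double x : `|h (x *+ 2) - 4 * h x| <= C.
Proof.
have := quasi_parallelogram x x; rewrite subrr h0 addr0 -mulr2n.
by rewrite (_ : 2 * h x + 2 * h x = 4 * h x); last by ring.
Qed.

Lemma C_ge0 : 0 <= C.
Proof. exact: le_trans (quasi_double 0). Qed.

Lemma approx_noninc x : nonincreasing_seq (approx x).
Proof.
apply/nonincreasing_seqP => n.
have := quasi_double (x *+ (2 ^ n)); rewrite -mulrnA -expnSr ler_norml => /andP[_ hC].
rewrite ler_pdivrMr ?exprn_gt0 // exprS.
have n4 : (4 : R) ^+ n != 0 by rewrite expf_neq0.
rewrite [leRHS](_ : _ = 4 * (h (x *+ 2 ^ n) + C / 3)); last by field.
by lra.
Qed.

Lemma approx_ge x n : h x - C / 3 <= approx x n.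
Proof.
suff : (h x - C / 3) * 4 ^+ n <= h (x *+ (2 ^ n)) - C / 3.
  move=> hn; rewrite ler_pdivlMr ?exprn_gt0 //; apply: le_trans hn _.
  by have := C_ge0; lra.
elim: n => [|n IHn]; first by rewrite expr0 mulr1 expn0 mulr1n.
have := quasi_double (x *+ (2 ^ n)); rewrite -mulrnA -expnSr ler_norml => /andP[hC _].
by rewrite exprSr mulrA; lra.
Qed.

Lemma approx_cvg x : cvgn (approx x).
Proof.
apply: nonincreasing_is_cvgn (@approx_noninc x) _.
by exists (h x - C / 3) => _ [n _ <-]; exact: approx_ge.
Qed.

Lemma canonical_height_near x : `|canonical_height x - h x| <= C / 3.
Proof.
rewrite ler_norml; apply/andP; split.
  rewrite lerBrDr addrC; apply: limr_ge (@approx_cvg x) _.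
  by apply: nearW => n; apply: approx_ge.
rewrite lerBlDr addrC.
have := nonincreasing_cvgn_ge (@approx_noninc x) (@approx_cvg x) 0.
by rewrite expn0 mulr1n expr0 divr1.
Qed.

Lemma canonical_height_ge0 x : 0 <= canonical_height x.
Proof.
apply: limr_ge (@approx_cvg x) _; apply: nearW => n.
by rewrite divr_ge0 ?exprn_ge0 // addr_ge0 ?divr_ge0 ?C_ge0.
Qed.

Lemma canonical_parallelogram x y :
  canonical_height (x + y) + canonical_height (x - y)
  = 2 * canonical_height x + 2 * canonical_height y.
Proof.
pose u n := approx (x + y) n + approx (x - y) n - (2 * approx x n + 2 * approx y n).
have cu : u @ \oo --> canonical_height (x + y) + canonical_height (x - y)
   - (2 * canonical_height x + 2 * canonical_height y).
  apply: cvgB; first by apply: cvgD; apply: approx_cvg.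
  by apply: cvgD; apply: cvgMr; apply: approx_cvg.
have c0 : u @ \oo --> (0 : R).
  have c4 : (fun n => (5 * C) * (4^-1 : R) ^+ n) @ \oo --> (0 : R).
    rewrite -(mulr0 (5 * C)); apply: cvgMr; apply: cvg_expr.
    by rewrite ger0_norm ?invr_ge0 // invf_lt1 //; lra.
  have c4N : (fun n => - ((5 * C) * (4^-1 : R) ^+ n)) @ \oo --> (0 : R).
    by rewrite -oppr0; apply: cvgN.
  apply: squeeze_cvgr c4N c4; apply: nearW => n; rewrite -ler_norml.
  have := quasi_parallelogram (x *+ 2 ^ n) (y *+ 2 ^ n).
  rewrite -mulrnDl -mulrnBl => hC.
  rewrite exprVn (_ : u n = (h ((x + y) *+ 2 ^ n) + h ((x - y) *+ 2 ^ n) -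
     (2 * h (x *+ 2 ^ n) + 2 * h (y *+ 2 ^ n)) - 2 * C / 3) / 4 ^+ n); last first.
    by rewrite /u; field; rewrite expf_neq0.
  rewrite normrM [X in _ * X]ger0_norm ?invr_ge0 ?exprn_ge0 //.
  apply: ler_wpM2r; first by rewrite invr_ge0 exprn_ge0.
  by move: hC; have := C_ge0; rewrite !ler_norml => ? /andP[? ?]; apply/andP; split; lra.
by apply/eqP; rewrite -subr_eq0; apply/eqP; apply: cvg_unique cu c0.
Qed.
End CanonicalHeight.

Definition nheight (R : realType) (P : ec_point) : R :=
  ln (maxnorm (coords P))%:~R.

Lemma maxnorm_coords_ge1 (R : realType) P : 1 <= (maxnorm (coords P))%:~R :> R.
Proof. by rewrite ler1z -gtz0_ge1 maxnorm_coprime_gt0 // coords_coprime. Qed.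

Lemma maxnorm_coords_gt0 (R : realType) P : 0 < (maxnorm (coords P))%:~R :> R.
Proof. exact: lt_le_trans (maxnorm_coords_ge1 R P). Qed.

Lemma nheight_ge0 (R : realType) P : 0 <= nheight R P.
Proof. by rewrite ln_ge0 // maxnorm_coords_ge1. Qed.

Lemma nheight0 (R : realType) : nheight R None = 0.
Proof. by rewrite /nheight /= /maxnorm /= -[Num.max _ _]/(1 : int) ln1. Qed.

Lemma nheight_opp (R : realType) P : nheight R (ec_opp P) = nheight R P.
Proof. by rewrite /nheight coords_opp. Qed.

(** The bit that separates a point from its opposite, which has the same abscissa. *)
Definition ysign (P : ec_point) : bool := if P is Some (_, y) then 0 <= y else true.

Lemma point_coords_inj (E : curve) (P Q : point E) :
  coords (val P) = coords (val Q) -> ysign (val P) = ysign (val Q) -> P = Q.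
Proof.
case: P Q => [[[x1 y1]|] onP] [[[x2 y2]|] onQ] /= ec es; apply: val_inj => //=.
- case: ec => en ed.
  have ex : x1 = x2 by rewrite -(divq_num_den x1) -(divq_num_den x2) en ed.
  subst x2; congr (Some (_, _)).
  have : (y1 == y2) || (y1 == - y2).
    rewrite -eqf_sqr; apply/eqP/(mulfI (curve_twist E)).
    by rewrite (eqP onP) (eqP onQ).
  case/orP => /eqP // ey; move: es; rewrite ey oppr_ge0.
  case: (ltgtP y2 0) => // [->]; by rewrite oppr0.
- by case: ec => _ ed; have := denq_neq0 x1; rewrite ed.
- by case: ec => _ ed; have := denq_neq0 x2; rewrite -ed.
Qed.

Lemma maxnorm_box (N : nat) : exists J : seq (int * int),
  forall p, maxnorm p <= N%:Z -> p \in J.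
Proof.
pose I := [seq (Posz i - Posz N : int) | i <- iota 0 (N + N).+1].
have memI (x : int) : `|x| <= N%:Z -> x \in I.
  move=> hx; apply/mapP; exists (absz (x + N%:Z)); last by lia.
  by rewrite mem_iota; lia.
exists [seq (u, v) | u <- I, v <- I] => p hp; rewrite [p]surjective_pairing.
apply: allpairs_f; apply: memI.
  exact: le_trans (norm1_maxnorm p) hp.
exact: le_trans (norm2_maxnorm p) hp.
Qed.

(** The bound does not depend on the curve, in particular not on the twist: a point is determined by
    a pair of integers from a fixed box and a sign. *)
Lemma northcott (R : realType) (k : R) : exists M : nat, forall E : curve,
  exists2 s : seq (point E), (size s <= M)%N &
    forall P, nheight R (val P) <= k -> P \in s.
Proof.
pose N := (Num.truncn (expR k)).+1.
have [I memI] := maxnorm_box N.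
pose J := [seq (p, e) | p <- I, e <- [:: true; false]].
exists (size J) => E.
pose g (t : int * int * bool) : point E :=
  xget 0 [set P : point E | coords (val P) = t.1 /\ ysign (val P) = t.2].
exists [seq g t | t <- J]; first by rewrite size_map.
move=> P hP; apply/mapP; exists (coords (val P), ysign (val P)); last first.
  rewrite /g; case: xgetP => [Q _ [e1 e2]|/(_ P)]; last by case.
  by apply: point_coords_inj.
have hN : maxnorm (coords (val P)) <= N%:Z.
  rewrite -(ler_int R) ltW //; apply: le_lt_trans (truncnS_gt _).
  by rewrite -ler_ln ?posrE ?maxnorm_coords_gt0 ?expR_gt0 // expRK.
by apply: allpairs_f; [apply: memI|case: ysign].
Qed.

Section Family.
Variables (R : realType) (a b c : int).
Hypothesis hd : discr a b c != 0.
Definition twistE (D : int) (hD : D != 0) : curve := Curve hd hD.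

Lemma nheight_double : exists C : R, forall D (hD : D != 0) (P : point (twistE hD)),
  4 * nheight R (val P) <= nheight R (val (P + P)) + C.
Proof.
have [C C0 hC] := maxnorm_double hd; exists (ln C%:~R) => D hD P.
have := hC (twistE hD) _ P => /(_ (And3 erefl erefl erefl)).
rewrite /nheight -lnM ?posrE ?maxnorm_coords_gt0 ?ltr0z //.
rewrite mulr_natl -lnXn ?maxnorm_coords_gt0 // mulrC => h.
by rewrite ler_ln ?posrE ?mulr_gt0 ?exprn_gt0 ?maxnorm_coords_gt0 ?ltr0z //
  -rmorphXn -rmorphM ler_int.
Qed.

(** The biquadratic forms give the upper bound. Applied to P + Q and P - Q, whose sum and difference
    are 2 P and 2 Q, it gives together with [nheight_double] the lower bound. *)
Lemma nheight_parallelogram : exists C : R,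
  forall D (hD : D != 0) (P Q : point (twistE hD)),
  `|nheight R (val (P + Q)) + nheight R (val (P - Q))
    - (2 * nheight R (val P) + 2 * nheight R (val Q))| <= C.
Proof.
have [C hC] := nheight_double.
pose K := 2 * kummer_const a b c.
have K0 : 0 < K by rewrite /K /kummer_const !mulr_gt0 // exprn_gt0 // ltr_wpDr // ltr_wpDr // ltr_wpDr.
have up D (hD : D != 0) (P Q : point (twistE hD)) :
  nheight R (val (P + Q)) + nheight R (val (P - Q)) <=
  2 * nheight R (val P) + 2 * nheight R (val Q) + ln K%:~R.
  rewrite /nheight -mulrDr -!lnM ?posrE ?maxnorm_coords_gt0 //.
  rewrite mulr_natl -lnXn ?mulr_gt0 ?maxnorm_coords_gt0 //.
  rewrite -lnM ?posrE ?exprn_gt0 ?mulr_gt0 ?maxnorm_coords_gt0 ?ltr0z // [X in ln X]mulrC.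
  rewrite ler_ln ?posrE ?mulr_gt0 ?exprn_gt0 ?mulr_gt0 ?maxnorm_coords_gt0 ?ltr0z //.
  rewrite -!rmorphM -rmorphXn -rmorphM ler_int /K.
  rewrite [leLHS]mulrC.
  apply: le_trans (maxnorm_parallelogram P Q) _.
  by rewrite le_eqVlt; apply/orP; left; apply/eqP; rewrite /=; ring.
exists (`|ln K%:~R| + `|C|) => D hD P Q.
have h1 := up _ _ P Q; have h2 := up _ _ (P + Q) (P - Q).
have h3 := hC _ _ P; have h4 := hC _ _ Q.
have e1 : P + Q + (P - Q) = P + P by rewrite addrACA subrr addr0.
have e2 : P + Q - (P - Q) = Q + Q by rewrite opprB addrC addrA subrK.
rewrite {}e1 {}e2 in h2.
have l1 := ler_norm (ln K%:~R : R); have l2 := ler_norm C.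
have l3 := normr_ge0 (ln K%:~R : R); have l4 := normr_ge0 C.
move: h1 h2 h3 h4 l1 l2 l3 l4.
move: (nheight R (val (P + Q))) (nheight R (val (P - Q))) (nheight R (val P))
  (nheight R (val Q)) (nheight R (val (P + P))) (nheight R (val (Q + Q)))
  (ln K%:~R : R) => x3 x4 x1 x2 y1 y2 z *.
by rewrite ler_norml; apply/andP; split; lra.
Qed.

End Family.

(** * Counting the points of a twist *)

Section TwoPowerClasses.
Variable A : zmodType.

Definition torsion (x : A) : Prop := exists2 n : nat, (0 < n)%N & x *+ n = 0.

Lemma torsion0 : torsion 0.
Proof. by exists 1%N. Qed.

Lemma torsionD x y : torsion x -> torsion y -> torsion (x + y).
Proof.
move=> [m m0 hx] [n n0 hy]; exists (m * n)%N; first by rewrite muln_gt0 m0.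
by rewrite mulrnDl mulrnA hx mul0rn mulnC mulrnA hy mul0rn addr0.
Qed.

Lemma torsionN x : torsion x -> torsion (- x).
Proof. by move=> [n n0 hx]; exists n => //; rewrite mulNrn hx oppr0. Qed.

Lemma torsionMn x n : torsion x -> torsion (x *+ n).
Proof. by move=> [m m0 hx]; exists m => //; rewrite -mulrnA mulnC mulrnA hx mul0rn. Qed.

(** Congruence modulo 2^k A plus the torsion subgroup; dividing out the torsion makes the number of
    classes depend on the rank only. *)
Definition congr2 (k : nat) (x y : A) : Prop :=
  exists z t, torsion t /\ x - y = z *+ (2 ^ k) + t.

(** Linear independence over the field of two elements in A / (2 A + torsion); [S] is the vector of
    coefficients. *)
Definition independent2 (n : nat) (e : 'I_n -> A) : Prop :=
  forall S : {ffun 'I_n -> bool}, congr2 1 (\sum_(i < n | S i) e i) 0 ->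
  forall i, ~~ S i.

(** Descent: in a relation up to torsion all coefficients are even, and halving them leaves a
    relation up to torsion. For this reason the induction concerns sums that are torsion rather than
    0. *)
Lemma independent2_independent n (e : 'I_n -> A) :
  independent2 e -> independent e.
Proof.
move=> he m hm.
suff h (N : nat) : forall m : 'I_n -> int, torsion (\sum_(i < n) e i *~ m i) ->
    (forall i, `|m i| <= N%:Z) -> forall i, m i = 0.
  apply: (h (\max_(i < n) absz (m i))%N m); first by rewrite hm; exact: torsion0.
  move=> i; rewrite -abszE lez_nat; exact: leq_bigmax.
elim/ltn_ind: N => N IHN {}m {}hm hN.
pose m' i := (m i %/ 2)%Z.
have em i : m i = m' i * 2 + (m i %% 2)%Z by rewrite /m' -divz_eq.
have b i : (m i %% 2)%Z = 0 \/ (m i %% 2)%Z = 1.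
  by have := modz_ge0 (m i) (isT : 2 != 0 :> int);
    have := ltz_pmod (m i) (isT : 0 < 2 :> int); lia.
have em' i : e i *~ m i = (e i *~ m' i) *+ 2 + e i *~ (m i %% 2)%Z.
  by rewrite {1}em mulrzDr mulrzA.
have hS : forall i, ~~ [ffun i => (m i %% 2)%Z == 1] i.
  apply: he; exists (- \sum_(i < n) e i *~ m' i), (\sum_(i < n) e i *~ m i).
  split=> //; rewrite subr0 expn1 mulNrn -sumrMnl addrC -sumrB big_mkcond.
  apply: eq_bigr => i _; rewrite ffunE em' addrAC subrr add0r.
  by case: (b i) => ->.
have ev i : (m i %% 2)%Z = 0.
  by have := hS i; rewrite ffunE; case: (b i) => // ->.
have {}em i : m i = m' i * 2 by rewrite {1}em ev addr0.
have [N0|N0] := posnP N.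
  by move=> i; apply/eqP; rewrite -normr_eq0; have := hN i; rewrite N0; lia.
have hm0 : forall i, m' i = 0.
  apply: (IHN (N./2)); first by lia.
    case: hm => l l0 hl; exists (2 * l)%N; first by lia.
    rewrite mulrnA -sumrMnl -[RHS]hl; congr (_ *+ _); apply: eq_bigr => i _.
    by rewrite em mulrzA -pmulrn.
  by move=> i; have := hN i; rewrite em; lia.
by move=> i; rewrite em hm0.
Qed.

Lemma congr2_trans k x y z : congr2 k x y -> congr2 k z y -> congr2 k x z.
Proof.
move=> [u [s [hs e]]] [v [t [ht e']]]; exists (u - v), (s - t); split.
  exact/torsionD/torsionN.
by rewrite mulrnBl addrACA -e -opprD -e' opprB addrA subrK.
Qed.

Variable r : nat.
Hypothesis rank_le : forall n (P : 'I_n -> A), independent P -> (n <= r)%N.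

(** A maximal family with [independent2] has at most r members, since it is independent over the
    integers; by maximality its partial sums represent every class. *)
Lemma classes_mod2 : exists (K : finType) (code : A -> K),
  (#|K| <= 2 ^ r)%N /\ forall x y, code x = code y -> congr2 1 x y.
Proof.
pose p m : bool := `[< exists e : 'I_m -> A, independent2 e >].
have p0 : exists m, p m.
  by exists 0%N; apply/asboolP; exists (fun=> 0) => S _ [].
have pr m : p m -> (m <= r)%N.
  by move=> /asboolP[e /independent2_independent/rank_le].
case: (ex_maxnP p0 pr) => m /asboolP[e he] hmax.
have hcode x : exists S : {ffun 'I_m -> bool},
    congr2 1 x (- \sum_(i < m | S i) e i).
  pose f (i : 'I_m.+1) := if unlift ord0 i is Some j then e j else x.
  have fE (S : {ffun 'I_m.+1 -> bool}) : \sum_(i < m.+1 | S i) f i =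
     (if S ord0 then x else 0) + \sum_(i < m | S (lift ord0 i)) e i.
    rewrite big_mkcond big_ord_recl /f unlift_none; congr (_ + _).
    by rewrite [RHS]big_mkcond; apply: eq_bigr => i _; rewrite liftK.
  have : ~ independent2 f.
    move=> hf; have : (m.+1 <= m)%N by apply: hmax; apply/asboolP; exists f.
    by rewrite ltnn.
  move=> /existsNP[S] /not_implyP[hS] /existsNP[i /negP/negPn Si].
  have [S0|S0] := boolP (S ord0).
    exists [ffun j => S (lift ord0 j)]; case: hS => z [t [ht]].
    rewrite fE S0 subr0 => ez; exists z, t; split=> //; rewrite -ez opprK.
    by congr (_ + _); apply: eq_bigl => j; rewrite ffunE.
  have h : forall j, ~~ [ffun j => S (lift ord0 j)] j.
    apply: he; case: hS => z [t [ht]]; rewrite fE (negbTE S0) add0r => ez.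
    by exists z, t; split=> //; rewrite -ez; congr (_ - _); apply: eq_bigl => j; rewrite ffunE.
  case: (unliftP ord0 i) Si => [j ->|-> Si]; last by rewrite Si in S0.
  by have := h j; rewrite ffunE => /negbTE->.
have [code hc] := choice hcode.
exists {ffun 'I_m -> bool}, code; split.
  by rewrite card_ffun card_bool card_ord leq_exp2l // pr //; apply/asboolP; exists e.
by move=> x y e'; apply: (congr2_trans (hc x)); rewrite e'; exact: hc.
Qed.

(** A class modulo 2^(k+1) is given by the class modulo 2 and by the class modulo 2^k of half the
    difference from a fixed representative. *)
Lemma classes_mod_2pow k : exists (K : finType) (code : A -> K),
  (#|K| <= 2 ^ (r * k))%N /\ forall x y, code x = code y -> congr2 k x y.
Proof.
elim: k => [|k [K [code [cK hK]]]].
  exists unit, (fun=> tt); split; first by rewrite card_unit muln0.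
  by move=> x y _; exists (x - y), 0; split; [exact: torsion0 | rewrite addr0].
have [K1 [code1 [cK1 hK1]]] := classes_mod2.
pose rep (c : K1) : A := xget 0 [set y | code1 y = c].
have hrep x : code1 x = code1 (rep (code1 x)).
  by rewrite /rep; case: xgetP => [y _ <-|/(_ x) h] //; case: h.
have /choice[half hhalf] : forall x, exists z, exists t,
    torsion t /\ x - rep (code1 x) = z *+ (2 ^ 1) + t.
  by move=> x; exact: hK1 (hrep x).
exists (K1 * K)%type, (fun x => (code1 x, code (half x))); split.
  by rewrite card_prod mulnS expnD leq_mul.
move=> x y [e1 /hK [z [t [ht ez]]]].
have [s [hs es]] := hhalf x; have [s' [hs' es']] := hhalf y.
exists z, (t *+ 2 + (s - s')); split.
  exact: torsionD (torsionMn 2 ht) (torsionD hs (torsionN hs')).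
have -> : x - y = (x - rep (code1 x)) - (y - rep (code1 y)).
  by rewrite e1 opprB addrA subrK.
by rewrite es es' expn1 opprD addrACA -mulrnBl ez mulrnDl expnSr (mulrnA z) -addrA.
Qed.
End TwoPowerClasses.

Lemma size_le_classes (T : eqType) (K : finType) (code : T -> K) (s : seq T) B :
  (forall k, (size [seq x <- s | code x == k] <= B)%N) -> (size s <= #|K| * B)%N.
Proof.
move=> hB.
have -> : size s = (\sum_(k : K) size [seq x <- s | code x == k])%N.
  elim: s {hB} => [|x s IH] /=; first by rewrite big1.
  rewrite IH [in RHS](bigD1 (code x)) //= eqxx /= [in LHS](bigD1 (code x)) //= -addSn.
  by congr (_ + _)%N; apply: eq_bigr => k /negbTE; rewrite eq_sym => ->.
rewrite -sum_nat_const; exact: leq_sum.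
Qed.

Definition affine_y_neq0 (P : ec_point) : bool :=
  if P is Some (_, y) then y != 0 else false.

(** The square of the denominator of w divides D. *)
Lemma squarefree_square_quotient (D n : int) (w : rat) : squarefree D ->
  n%:~R = D%:~R * w ^+ 2 -> exists m : int, w = m%:~R.
Proof.
move=> hD e; exists (numq w); rewrite -[LHS]divq_num_den.
suff -> : denq w = 1 by rewrite divr1.
have e' : n * denq w ^+ 2 = D * numq w ^+ 2.
  apply: (@intr_inj rat).
  transitivity (n%:~R * (denq w)%:~R ^+ 2 : rat); first by ring.
  transitivity (D%:~R * (numq w)%:~R ^+ 2 : rat); last by ring.
  by rewrite e numqE; ring.
have dv : (denq w ^+ 2 %| D)%Z.
  have cw : coprimez (denq w ^+ 2) (numq w ^+ 2).
    apply/coprimezXl/coprimezXr; rewrite coprimez_sym; exact: coprime_num_den.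
  by rewrite -(Gauss_dvdzl D cw) -e' dvdz_mull.
have := hD (absz (denq w)); rewrite absz_denq => /(_ dv) e1.
by rewrite -(absz_denq w) e1.
Qed.

(** The link between pairs and points: F at the coordinates of an abscissa is the twist times a
    square. *)
Lemma quartic_coords (E : curve) x y : onE E (Some (x, y)) ->
  (quartic (coefa E) (coefb E) (coefc E) (numq x, denq x))%:~R
  = (twist E)%:~R * (y * (denq x)%:~R ^+ 2) ^+ 2 :> rat.
Proof.
move=> /eqP onP.
transitivity ((denq x)%:~R * ((numq x)%:~R ^+ 3 +
  (coefa E)%:~R * (numq x)%:~R ^+ 2 * (denq x)%:~R + (coefb E)%:~R
  * (numq x)%:~R * (denq x)%:~R ^+ 2 + (coefc E)%:~R * (denq x)%:~R ^+ 3) : rat).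
  by rewrite /quartic; ring.
have -> : (twist E)%:~R * (y * (denq x)%:~R ^+ 2) ^+ 2
  = (twist E)%:~R * y ^+ 2 * (denq x)%:~R ^+ 4 by ring.
by rewrite onP numqE; ring.
Qed.

Lemma quartic_le (a b c : int) p : `|quartic a b c p| <=
  (`|c| + `|b| + `|a| + `|1|) * maxnorm p ^+ 4.
Proof.
have -> : quartic a b c p = p.2 * cubic_form c b a 1 p.
  by case: p => u v; rewrite /quartic /cubic_form /=; ring.
rewrite normrM exprS mulrCA; apply: ler_pM => //; first exact: norm2_maxnorm.
exact: cubic_form_le.
Qed.

Section TwistCounts.
Variables (R : realType) (a b c : int).
Hypothesis hd : discr a b c != 0.

Definition logtwist (D : int) : R := Num.max 1 (ln `|D|%:~R).

Definition height1 (P : ec_point) : R := Num.max 1 (nheight R P).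

Lemma logtwist_ge1 D : 1 <= logtwist D.
Proof. by rewrite le_max lexx. Qed.

Lemma height1_ge1 P : 1 <= height1 P.
Proof. by rewrite le_max lexx. Qed.

(** For squarefree D the square in F(u, v) = D m^2 is that of an integer m, nonzero when y is; hence
    |D| <= |F(u, v)| <= K max(|u|, |v|)^4. *)
Lemma height_ge_logtwist : exists2 k : R, 0 < k & forall D (hD : D != 0),
  squarefree D -> forall P : point (twistE hd hD), affine_y_neq0 (val P) ->
  k * logtwist D <= height1 (val P).
Proof.
pose K : int := `|c| + `|b| + `|a| + `|1|.
have K1 : 1 <= K by rewrite /K normr1 lerDr !addr_ge0.
have lK0 : 0 <= ln K%:~R :> R by rewrite ln_ge0 // ler1z.
exists (5 + ln K%:~R)^-1; first by rewrite invr_gt0 ltr_wpDr.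
move=> D hD sD [[[x y]|] onP] //= y0.
have hq := quartic_coords onP.
have [m hm] := squarefree_square_quotient sD hq.
rewrite {}hm /= in hq.
have {}hq : quartic a b c (numq x, denq x) = D * m ^+ 2.
  by apply: (@intr_inj rat); rewrite hq; ring.
have v0 : quartic a b c (numq x, denq x) != 0.
  have := quartic_coords onP; rewrite /= => e.
  rewrite -(intr_eq0 rat) e !(mulf_neq0, expf_neq0) ?intr_eq0 ?denq_neq0 //.
have m0 : m != 0 by apply: contra_neq v0 => m0; rewrite hq m0 expr0n mulr0.
have h1 : `|D| <= K * maxnorm (numq x, denq x) ^+ 4.
  apply: le_trans (quartic_le a b c _); rewrite hq normrM ler_peMr //.
  by rewrite normrX exprn_ege1 // -gtz0_ge1 normr_gt0.
have h2 : ln `|D|%:~R <= ln K%:~R + 4 * nheight R (Some (x, y)).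
  rewrite /nheight mulr_natl -lnXn ?maxnorm_coords_gt0 // -lnM ?posrE
    ?exprn_gt0 ?maxnorm_coords_gt0 // ?ltr0z ?(lt_le_trans ltr01 K1) //.
  rewrite ler_ln ?posrE ?mulr_gt0 ?exprn_gt0 ?maxnorm_coords_gt0 ?ltr0z
     ?normr_gt0 ?(lt_le_trans ltr01 K1) //.
  by rewrite -rmorphXn -rmorphM ler_int.
rewrite mulrC ler_pdivrMr ?ltr_wpDr // /logtwist.
have l1 := height1_ge1 (Some (x, y)).
have l2 : nheight R (Some (x, y)) <= height1 (Some (x, y)) by rewrite le_max lexx orbT.
have l3 : 0 <= ln K%:~R * (height1 (Some (x, y)) - 1) by rewrite mulr_ge0 ?subr_ge0.
move: h2 l1 l2 l3 lK0.
move: (nheight R (Some (x, y))) (height1 (Some (x, y))) (ln `|D|%:~R : R) (ln K%:~R : R).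
move=> h H d k *; rewrite ge_max; apply/andP; split; lra.
Qed.

Variable r : nat.
Hypothesis rank_le : forall D (hD : D != 0) n (P : 'I_n -> point (twistE hd hD)),
  independent P -> (n <= r)%N.

(** Two points of one class modulo 2^(i+e) differ by 2^(i+e) x + t with t torsion. The height of t
    is bounded, and that of x turns out to be bounded too, so that [northcott] leaves at most N^2
    points in each of the 2^(r(i+e)) classes. *)
Lemma count_points : exists M : nat, forall D (hD : D != 0), squarefree D ->
  forall i (s : seq (point (twistE hd hD))), uniq s ->
  (forall P, P \in s -> nheight R (val P) <= 4 ^+ i * logtwist D) ->
  (size s <= M * 2 ^ (r * i))%N.
Proof.
have [C hC] := @nheight_parallelogram R a b c hd.
have [k k0 hk] := height_ge_logtwist.
have C0 : 0 <= C by apply: le_trans (hC 1 isT 0 0).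
(* This e makes the canonical height of x at most (k / 2) log|D|, half of the lower bound k log|D|
   for points with y != 0. Comparing the two bounds log|D| for such an x, and then the height of
   x. *)
have [e he] : exists e : nat, (4 + 2 * C) / 4 ^+ e <= k / 2.
  have h0 : 0 < (4 + 2 * C) / (k / 2) by rewrite divr_gt0 ?divr_gt0 //; lra.
  exists (Num.truncn ((4 + 2 * C) / (k / 2))).+1.
  have hn := truncnS_gt ((4 + 2 * C) / (k / 2)); move: hn.
  move: (Num.truncn _).+1 => n hn.
  rewrite ler_pdivrMr ?exprn_gt0 // -ler_pdivrMl ?divr_gt0 // mulrC.
  apply: le_trans (ltW hn) _; rewrite -natrX ler_nat.
  by apply: ltnW; apply: ltn_expl.
pose kap : R := 1 + C + 2 * (1 + C).
have [N hN] := northcott kap.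
exists (N * N * 2 ^ (r * e))%N => D hD sD i s us hs.
pose h (P : point (twistE hd hD)) := nheight R (val P).
pose q := canonical_height h C.
have h0 x : 0 <= h x by exact: nheight_ge0.
have h00 : h 0 = 0 by exact: nheight0.
have qh x : `|q x - h x| <= C / 3 := canonical_height_near h00 (hC D hD) x.
have qh1 x : q x <= h x + C / 3 by have := qh x; rewrite ler_norml => /andP[_]; lra.
have qh2 x : h x <= q x + C / 3 by have := qh x; rewrite ler_norml => /andP[]; lra.
have qpar x y : q (x + y) + q (x - y) = 2 * q x + 2 * q y
  := canonical_parallelogram h00 (hC D hD) x y.
have q0 x : 0 <= q x := canonical_height_ge0 h0 h00 (hC D hD) x.
clearbody q.
have [K [code [cK hcode]]] := classes_mod_2pow (@rank_le D hD) (i + e).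
have L1 := logtwist_ge1 D.
have [SR sSR memSR] := hN (twistE hd hD).
have hclass Q P : Q \in s -> P \in s -> code P = code Q ->
    P \in [seq Q + (x *+ 2 ^ (i + e) + t) | x <- SR, t <- SR].
  move=> Qs Ps /hcode [x [t [[n n0 ht] ex]]].
  have [qt qtD] := quad_torsion qpar n0 ht.
  apply/allpairsP; exists (x, t); split => /=; last by rewrite -ex addrC subrK.
    apply: memSR.
    have qx : 4 ^+ (i + e) * q x <= 4 * (4 ^+ i * logtwist D + C / 3).
      have -> : 4 ^+ (i + e) * q x = q (x *+ 2 ^ (i + e)).
        rewrite (quadMn qpar) natrX.
        by have -> : (4 : R) = 2%:R ^+ 2; [rewrite -natrX | rewrite exprAC].
      rewrite -(qtD (x *+ _)) -ex; apply: le_trans (quadB_le qpar q0 _ _) _.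
      have := qh1 P; have := qh1 Q; have := hs _ Ps; have := hs _ Qs.
      by rewrite -/(h P) -/(h Q); lra.
    have {}qx : q x <= k / 2 * logtwist D.
      apply: le_trans (_ : (4 + 2 * C) / 4 ^+ e * logtwist D <= _); last first.
        by rewrite ler_wpM2r //; lra.
      rewrite -(ler_pM2l (_ : 0 < 4 ^+ (i + e))) ?exprn_gt0 //.
      apply: le_trans qx _; rewrite exprD.
      have -> : 4 ^+ i * 4 ^+ e * ((4 + 2 * C) / 4 ^+ e * logtwist D)
        = 4 ^+ i * ((4 + 2 * C) * logtwist D).
        by field; rewrite expf_neq0.
      have e1 : 1 <= 4 ^+ i * logtwist D.
        by rewrite -[1]mulr1 ler_pM // exprn_ege1 //; lra.
      have := mulr_ge0 C0 (_ : 0 <= 4 ^+ i * logtwist D - 1); rewrite subr_ge0.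
      by move=> /(_ e1); lra.
    have [yx|yx] := boolP (affine_y_neq0 (val x)).
      have hkx := hk _ _ sD _ yx.
      have := qh2 x; rewrite /h => hx.
      have : height1 (val x) <= 1 + nheight R (val x).
        by rewrite ge_max lerDl nheight_ge0 /= lerDr.
      by move: hkx hx qx; rewrite /kap; lra.
    (* Otherwise x is the neutral element or has order 2, and the quasi-parallelogram law for x, x
       bounds its height. *)
    have x2 : x + x = 0.
      apply: val_inj; rewrite val_pointD; move: yx; case: (val x) => [[u v]|] //=.
      by rewrite negbK => /eqP->; rewrite /addE /addc oppr0 !eqxx.
    have := hC _ _ x x; rewrite x2 subrr /= nheight0 ler_norml => /andP[+ _].
    by rewrite /kap; lra.
  apply: memSR; have := qh2 t; rewrite qt /h /kap; lra.
have : (size s <= #|K| * (N * N))%N.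
  apply: (size_le_classes (code := code)) => kk.
  case E : [seq x <- s | code x == kk] => [|Q s'] //; rewrite -E.
  have : Q \in [seq x <- s | code x == kk] by rewrite E mem_head.
  rewrite mem_filter => /andP[/eqP cQ Qs].
  apply: (@leq_trans (size [seq Q + (x *+ 2 ^ (i + e) + t) | x <- SR, t <- SR])).
    apply: uniq_leq_size; first exact: filter_uniq.
    move=> P; rewrite mem_filter => /andP[/eqP cP Ps].
    by apply: hclass => //; rewrite cP.
  by rewrite size_allpairs leq_mul.
move/leq_trans; apply; rewrite mulnC -!mulnA leq_mul2l; apply/orP; right.
rewrite leq_mul2l; apply/orP; right.
by rewrite -expnD -mulnDr [(e + i)%N]addnC.
Qed.
End TwistCounts.

(** * Convergence of S_E when the ranks are small *)

Lemma sum_fiber (R : nmodType) (T K : eqType) (f : T -> K) (G : T -> R)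
    (s : seq T) (U : seq K) : uniq U -> (forall x, x \in s -> f x \in U) ->
  \sum_(x <- s) G x = \sum_(k <- U) \sum_(x <- s | f x == k) G x.
Proof.
move=> uU hf; elim: s hf => [|x s IHs] hf.
  by rewrite big_nil big1 // => k _; rewrite big_nil.
rewrite big_cons IHs => [|y ys]; last by apply: hf; rewrite in_cons ys orbT.
under [RHS]eq_bigr do rewrite big_cons.
rewrite [in RHS](bigD1_seq (f x)) ?hf ?mem_head //= eqxx.
rewrite [in LHS](bigD1_seq (f x)) ?hf ?mem_head //= addrA; congr (_ + _).
by apply: eq_bigr => k /negbTE; rewrite eq_sym => ->.
Qed.

Lemma sum_layers_le (R : numDomainType) (T : eqType) (G : T -> R)
    (ind : T -> nat) (N : nat -> nat) (w : nat -> R) (B : R) (s : seq T) :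
  (forall e, 0 <= w e) ->
  (forall x, x \in s -> G x <= w (ind x)) ->
  (forall e, (size [seq x <- s | ind x == e] <= N e)%N) ->
  (forall I, \sum_(e < I) (N e)%:R * w e <= B) ->
  \sum_(x <- s) G x <= B.
Proof.
move=> w0 hG hN hB; pose I := (\max_(x <- s) ind x).+1.
rewrite (@sum_fiber _ _ _ ind _ _ (iota 0 I)) ?iota_uniq //; last first.
  by move=> x xs; rewrite mem_iota add0n ltnS; exact: leq_bigmax_seq.
apply: le_trans (hB I); rewrite -(big_mkord xpredT (fun e => (N e)%:R * w e)).
rewrite /index_iota subn0; apply: ler_sum => e _.
rewrite -big_filter.
apply: (@le_trans _ _ (\sum_(x <- [seq x <- s | ind x == e]) w e)).
  rewrite big_seq [leRHS]big_seq; apply: ler_sum => x.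
  by rewrite mem_filter => /andP[/eqP <- /hG].
rewrite big_const_seq count_predT iter_addr addr0 -[leLHS]mulr_natl ler_wpM2r //.
by rewrite ler_nat.
Qed.

Lemma geometric_sum_le (R : realFieldType) (x : R) n : 0 <= x -> x < 1 ->
  \sum_(e < n) x ^+ e <= (1 - x)^-1.
Proof.
move=> x0 x1; have x1' : 0 < 1 - x by rewrite subr_gt0.
rewrite -(ler_pM2l x1') mulfV ?gt_eqF // -[X in X <= _]opprK -mulNr opprB -subrX1.
by rewrite opprB lerBlDr lerDl exprn_ge0.
Qed.

Lemma powRXN (R : realType) (x j : R) n : 0 <= x ->
  (x ^+ n) `^ (- j) = (x `^ (- j)) ^+ n.
Proof.
by move=> x0; rewrite -(powR_mulrn n x0) -powRrM mulrC powRrM powR_mulrn ?powR_ge0.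
Qed.

Lemma ler_powRN (R : realType) (j x y : R) : 0 <= j -> 0 < x -> x <= y ->
  y `^ (- j) <= x `^ (- j).
Proof.
move=> j0 x0 xy; have y0 := lt_le_trans x0 xy.
rewrite !powRN lef_pV2 ?posrE ?powR_gt0 //.
by rewrite ge0_ler_powR ?nnegrE // ltW.
Qed.

Lemma ltr_powR_exp (R : realType) (a x y : R) : 1 < a -> x < y -> a `^ x < a `^ y.
Proof.
move=> a1 xy; have a0 : a != 0 by rewrite gt_eqF // (lt_trans ltr01).
by rewrite /powR (negbTE a0) ltr_expR ltr_pM2r // ln_gt0.
Qed.

(** The ratio 2^(r - 2 j) of the geometric series; the strict inequality of (a) enters here. *)
Lemma ratio_lt1 (R : realType) (r : nat) (j : R) : r%:R < 2 * j ->
  2 ^+ r * 4 `^ (- j) < 1.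
Proof.
move=> hr; rewrite powRN ltr_pdivrMr ?powR_gt0 // mul1r.
rewrite (_ : 4 = 2%:R ^+ 2); last by rewrite -natrX.
by rewrite -!powR_mulrn // -powRrM ltr_powR_exp // ltr1n.
Qed.

(* Layers [h <= 4 ^ i l] of at most [M 2 ^ (r i)] elements: since [r < 2 j] the
   sum of [H ^ - j] is dominated by a geometric series. *)
Lemma height_sum_le (R : realType) (r M : nat) (j k : R) :
  0 < j -> r%:R < 2 * j -> 0 < k -> k <= 4^-1 ->
  exists2 B : R, 0 <= B & forall (T : eqType) (h H : T -> R) (l : R) (s : seq T),
  1 <= l -> uniq s -> (forall x, h x <= H x) ->
  (forall x, x \in s -> k * l <= H x) ->
  (forall i (s' : seq T), uniq s' -> {subset s' <= s} ->
    (forall x, x \in s' -> h x <= 4 ^+ i * l) -> (size s' <= M * 2 ^ (r * i))%N) ->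
  \sum_(x <- s) H x `^ (- j) <= B * l `^ (- j).
Proof.
move=> j0 hr k0 k4; set rho : R := 2 ^+ r * 4 `^ (- j).
have rho1 : rho < 1 by apply: ratio_lt1.
have rho0 : 0 <= rho by rewrite /rho mulr_ge0 ?exprn_ge0 ?powR_ge0.
exists (M%:R * k `^ (- j) / (1 - rho)).
  by rewrite divr_ge0 ?mulr_ge0 ?powR_ge0 // subr_ge0 ltW.
move=> T h H l s l1 us hH hk hcount.
have l0 : 0 < l by apply: lt_le_trans l1.
have hex x : exists n, h x <= 4 ^+ n * l.
  exists (Num.truncn (h x)).+1; have := truncnS_gt (h x).
  move: (Num.truncn _).+1 => n hn; apply: le_trans (ltW hn) _.
  rewrite -[leLHS]mulr1 ler_pM // -natrX ler_nat.
  by apply/ltnW/ltn_expl.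
pose ind x := ex_minn (hex x).
have hind x : h x <= 4 ^+ ind x * l by rewrite /ind; case: ex_minnP.
have hmin x n : (n < ind x)%N -> 4 ^+ n * l < h x.
  rewrite /ind; case: ex_minnP => m _ hm nm; rewrite ltNge; apply/negP => /hm.
  by rewrite leqNgt nm.
pose w e : R := (k * l) `^ (- j) * (4 `^ (- j)) ^+ e.
apply: (@sum_layers_le _ _ _ ind (fun e => M * 2 ^ (r * e))%N w).
- by move=> e; rewrite mulr_ge0 ?powR_ge0 // exprn_ge0 // powR_ge0.
- move=> x xs; rewrite /w -powRXN // -powRM ?mulr_ge0 ?exprn_ge0 ?(ltW k0) ?(ltW l0) //.
  apply: ler_powRN; rewrite ?mulr_gt0 ?exprn_gt0 ?(ltW j0) //.
  (* Layer 0 uses the lower bound k l. In layer n + 1, minimality gives H x > 4^n l >= k 4^(n+1) l,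
     which is where k <= 1/4 is used. *)
  case E : (ind x) => [|n]; first by rewrite expr0 mulr1; exact: hk.
  apply: le_trans (hH x); apply: le_trans (ltW (hmin x n _)); last by rewrite E.
  have h4 : k * 4 ^+ n.+1 <= 4 ^+ n.
    by rewrite exprS mulrA ler_piMl ?exprn_ge0 // -ler_pdivlMr // mul1r.
  by rewrite mulrAC ler_wpM2r // ltW.
- move=> e; apply: hcount; first exact: filter_uniq.
    by move=> x; rewrite mem_filter => /andP[].
  by move=> x; rewrite mem_filter => /andP[/eqP <- _].
- move=> I; rewrite (eq_bigr (fun e : 'I_I => M%:R * (k * l) `^ (- j) * rho ^+ e)).
    rewrite -mulr_sumr powRM ?(ltW k0) ?(ltW l0) //.
    rewrite [leRHS](_ : _ = M%:R * (k `^ (- j) * l `^ (- j)) * (1 - rho)^-1); last first.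
      by ring.
    by rewrite ler_wpM2l ?mulr_ge0 ?powR_ge0 // geometric_sum_le.
  move=> e _; rewrite /w /rho natrM natrX exprM exprMn; ring.
Qed.

Lemma power_sum_le (R : realType) (j : R) : 1 < j ->
  exists2 B : R, 0 <= B & forall s : seq nat, uniq s -> (forall n, n \in s -> (0 < n)%N) ->
  \sum_(n <- s) n%:R `^ (- j) <= B.
Proof.
move=> j1; have j0 : 0 <= j by lra.
pose rho : R := 2 * 2 `^ (- j).
have rho1 : rho < 1.
  by rewrite /rho powRN ltr_pdivrMr ?powR_gt0 // mul1r -[ltLHS](@powRr1 _ 2) // ltr_powR_exp // ltr1n.
have rho0 : 0 <= rho by rewrite /rho mulr_ge0 ?powR_ge0.
exists (1 - rho)^-1; first by rewrite invr_ge0 subr_ge0 ltW.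
move=> s us hs.
apply: (@sum_layers_le _ _ _ (trunc_log 2) (fun e => 2 ^ e)%N (fun e => (2 `^ (- j)) ^+ e)).
- by move=> e; rewrite exprn_ge0 ?powR_ge0.
- move=> n ns; rewrite -(@powRXN _ 2 j) //.
  apply: ler_powRN => //.
  by rewrite -natrX ler_nat trunc_logP // hs.
- move=> e; apply: (@leq_trans (size (iota (2 ^ e) (2 ^ e)))); last by rewrite size_iota.
  apply: uniq_leq_size; first exact: filter_uniq.
  move=> n; rewrite mem_filter mem_iota => /andP[/eqP <- /hs n0].
  by rewrite trunc_logP //= addnn -mul2n -expnS trunc_log_ltn.
- move=> I; rewrite (eq_bigr (fun e : 'I_I => rho ^+ e)) ?geometric_sum_le // => e _.
  by rewrite natrX -exprMn.
Qed.

(** Condensation: the 2 * 2^e integers with 2^e <= |D| < 2^(e+1) contribute O((e + 1)^-j)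
    altogether, which is summable for j > 1. *)
Lemma log_sum_le (R : realType) (j : R) : 1 < j ->
  exists2 B : R, 0 <= B & forall s : seq int, uniq s -> (forall D, D \in s -> D != 0) ->
  \sum_(D <- s) (`|D|%:~R)^-1 * logtwist R D `^ (- j) <= B.
Proof.
move=> j1; have j0 : 0 <= j by lra.
have [B B0 hB] := power_sum_le j1.
have l2 : 0 < ln 2 :> R by rewrite ln_gt0 // ltr1n.
pose k : R := Num.min 2^-1 (ln 2 / 2).
have k0 : 0 < k by rewrite lt_min invr_gt0 ltr0n divr_gt0.
exists (2 * k `^ (- j) * B); first by rewrite !mulr_ge0 ?powR_ge0.
move=> s us hs.
apply: (@sum_layers_le _ _ _ (fun D => trunc_log 2 (absz D)) (fun e => 2 * 2 ^ e)%N
   (fun e => (2 ^- e) * (k * e.+1%:R) `^ (- j))).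
- by move=> e; rewrite mulr_ge0 ?powR_ge0 // invr_ge0 exprn_ge0.
- move=> D Ds; have D0 := hs _ Ds; set e := trunc_log _ _.
  have he : 2 ^+ e <= `|D|%:~R :> R.
    by rewrite -natrX -abszE -[(Posz _)%:~R]/((absz D)%:R : R) ler_nat trunc_logP // absz_gt0.
  apply: ler_pM; rewrite ?powR_ge0 ?invr_ge0 ?ler0z //.
    by rewrite lef_pV2 ?posrE ?exprn_gt0 // ltr0z normr_gt0.
  apply: ler_powRN => //; first by rewrite mulr_gt0.
  have hl : e%:R * ln 2 <= logtwist R D.
    rewrite /logtwist le_max; apply/orP; right.
    by rewrite mulr_natl -lnXn // ler_ln // ?posrE ?exprn_gt0 // ltr0z normr_gt0.
  have h1 := logtwist_ge1 R D.
  have h2 : k <= 2^-1 by rewrite ge_min lexx.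
  have h3 : k * e%:R <= ln 2 / 2 * e%:R.
    by rewrite ler_wpM2r // ge_min lexx orbT.
  rewrite -natr1 mulrDr mulr1.
  move: hl h1 h2 h3; move: (logtwist R D) (k * e%:R) => x y; lra.
- move=> e; pose t := iota (2 ^ e) (2 ^ e).
  apply: (@leq_trans (size ([seq Posz n | n <- t] ++ [seq - Posz n | n <- t]))); last first.
    by rewrite size_cat !size_map size_iota mul2n addnn.
  apply: uniq_leq_size; first exact: filter_uniq.
  move=> D; rewrite mem_filter => /andP[/eqP eD /hs D0].
  have mD : absz D \in t.
    rewrite mem_iota -eD trunc_logP ?absz_gt0 //=.
    by rewrite addnn -mul2n -expnS trunc_log_ltn.
  rewrite mem_cat; have [D1|D1] := leP 0 D.
    by apply/orP; left; apply/mapP; exists (absz D) => //; rewrite gez0_abs.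
  by apply/orP; right; apply/mapP; exists (absz D) => //; rewrite ltz0_abs // opprK.
- move=> I; rewrite (eq_bigr (fun e : 'I_I => 2 * k `^ (- j) * (e.+1%:R `^ (- j)))).
    rewrite -mulr_sumr ler_wpM2l ?mulr_ge0 ?powR_ge0 //.
    have h0 n : n \in iota 1 I -> (0 < n)%N by rewrite mem_iota => /andP[].
    have := hB _ (iota_uniq 1 I) h0.
    have -> : iota 1 I = index_iota 1 I.+1 by rewrite /index_iota subn1.
    by rewrite big_add1 big_mkord.
  move=> e _; rewrite natrM natrX powRM ?(ltW k0) //; field.
  by rewrite expf_neq0.
Qed.

Lemma esum_le_fin (R : realType) (T : choiceType) (P : set T) (f : T -> R) (M : R) :
  (forall s : seq T, uniq s -> (forall x, x \in s -> P x) ->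
     \sum_(x <- s) f x <= M) ->
  (\esum_(x in P) (f x)%:E <= M%:E)%E.
Proof.
move=> h; apply: ge_ereal_sup => _ [A [finA AP] <-].
rewrite fsbig_finite // sumEFin lee_fin; apply: h; first exact: fset_uniq.
by move=> x; rewrite in_fset_set // => /set_mem/AP.
Qed.

Lemma fin_le_esum (R : realType) (T : choiceType) (P : set T) (f : T -> R) (s : seq T) :
  uniq s -> (forall x, x \in s -> P x) ->
  ((\sum_(x <- s) f x)%:E <= \esum_(x in P) (f x)%:E)%E.
Proof.
move=> us sP; apply: ereal_sup_ubound; exists [set` s].
  by split; [exact: finite_seq | move=> x /= /sP].
by rewrite -fsbig_seq // sumEFin.
Qed.

Lemma esum_lt_bounded (R : realType) (T : choiceType) (P : set T) (f : T -> R) :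
  (forall x, P x -> 0 <= f x) -> (\esum_(x in P) (f x)%:E < +oo)%E ->
  exists M : R, forall s : seq T, uniq s -> (forall x, x \in s -> P x) ->
     \sum_(x <- s) f x <= M.
Proof.
move=> f0 hfin; have h0 : (0 <= \esum_(x in P) (f x)%:E)%E.
  by apply: esum_ge0 => x /f0; rewrite lee_fin.
exists (fine (\esum_(x in P) (f x)%:E)) => s us sP.
by rewrite -lee_fin fineK ?ge0_fin_numE //; exact: fin_le_esum.
Qed.

Lemma squarefree_decomposition (n : int) : n != 0 ->
  exists2 s : int, squarefree s & exists m : int, n = s * m ^+ 2.
Proof.
move: {2}(absz n) (leqnn (absz n)) => N; elim: N n => [|N IHN] n hn n0.
  by move: hn; rewrite leqn0 absz_eq0 (negbTE n0).
have [sn|] := pselect (squarefree n).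
  by exists n => //; exists 1; rewrite expr1n mulr1.
move=> /existsNP[d] /not_implyP[dn d1].
case/dvdzP: dn => q eq.
have d0 : (0 < d)%N.
  by rewrite lt0n; apply: contra_neq n0 => d0; rewrite eq d0 expr0n mulr0.
have d2 : (2 <= d)%N by case: d d0 d1 {eq} => [|[|]].
have q0 : q != 0 by apply: contra_neq n0 => q0; rewrite eq q0 mul0r.
have [|s ss [m em]] := IHN q _ q0.
  have : (absz n = absz q * d ^ 2)%N by rewrite eq abszM abszX absz_nat.
  have : (0 < absz q)%N by rewrite absz_gt0.
  move: (absz q) (absz n) hn => x y; have : (4 <= d ^ 2)%N by rewrite -[4%N]/(2 ^ 2)%N leq_exp2r.
  nia.
by exists s => //; exists (m * d%:Z); rewrite eq em; ring.
Qed.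

Lemma squarefree_neq0 (s : int) : squarefree s -> s != 0.
Proof. by move=> h; apply/eqP => s0; have := h 2; rewrite s0 dvdz0 => /(_ isT). Qed.

Lemma squarefree_partP (n : int) : n != 0 ->
  squarefree (squarefree_part n%:~R) /\
  exists2 m : int, m != 0 & n = squarefree_part n%:~R * m ^+ 2.
Proof.
move=> n0; rewrite /squarefree_part.
case: xgetP => [s _ [hs [m em]]|/(_ _)].
  have [m' em'] := squarefree_square_quotient hs em; split=> //.
  have e : n = s * m' ^+ 2.
    by apply: (@intr_inj rat); rewrite em em'; ring.
  exists m' => //; apply: contra_neq n0 => m0; by rewrite e m0 expr0n mulr0.
have [s hs [m em]] := squarefree_decomposition n0.
move/(_ s) => h; exfalso; apply: h; split=> //; exists m%:~R.
by rewrite em; ring.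
Qed.

(** The ordinate is arbitrary, because heights only see the abscissa; this transfers the estimates
    for points to pairs. *)
Lemma height_pairE (R : realType) (p : int * int) y :
  height_pair R p = height1 R (Some (p.1%:~R / p.2%:~R, y)).
Proof.
rewrite /height_pair /height /height1 /nheight /= /maxnorm /=.
move: (p.1%:~R / p.2%:~R : rat) => x.
have d0 : 0 < `|(denq x)%:~R| :> R by rewrite normr_gt0 intr_eq0 denq_neq0.
have [x0|x0] := eqVneq x 0.
  have -> : Num.max `|numq x| `|denq x| = 1 by rewrite x0.
  by rewrite x0 /= normr0 normr1 ln0 // ln1 maxxx.
have n0 : 0 < `|(numq x)%:~R| :> R by rewrite normr_gt0 intr_eq0 numq_eq0.
congr (Num.max _ _).
have -> : (Num.max `|numq x| `|denq x|)%:~R = Num.max `|(numq x)%:~R| `|(denq x)%:~R| :> R.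
  by rewrite -!intr_norm; case: (leP `|numq x| `|denq x|) => h; apply/esym;
    [apply: max_r | apply: max_l]; rewrite ler_int // ltW.
case: (leP `|(numq x)%:~R : R| `|(denq x)%:~R|) => h.
  by rewrite max_r // ler_ln.
by rewrite max_l // ler_ln // ltW.
Qed.

Section PairPoints.
Variables (R : realType) (a b c : int).
Hypothesis hd : discr a b c != 0.

Definition sfpart (p : int * int) : int := squarefree_part (quartic a b c p)%:~R.

Lemma quartic_snd_neq0 p : quartic a b c p != 0 -> p.2 != 0.
Proof. by case: p => u v; apply: contra_neq => /= ->; rewrite mul0r. Qed.

Lemma coprime_ratio (u v u' v' : int) : coprimez u v -> coprimez u' v' ->
  v != 0 -> v' != 0 -> u%:~R / v%:~R = u'%:~R / v'%:~R :> rat ->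
  (0 <= v) = (0 <= v') -> (u, v) = (u', v').
Proof.
move=> cuv cuv' v0 v0' e sv.
have e' : u * v' = u' * v.
  apply: (@intr_inj rat); rewrite !intrM.
  have hv : v%:~R != 0 :> rat by rewrite intr_eq0.
  have hv' : v'%:~R != 0 :> rat by rewrite intr_eq0.
  transitivity (u%:~R / v%:~R * (v%:~R * v'%:~R) : rat); first by field.
  by rewrite e; field.
have d1 : (v %| v')%Z.
  by rewrite -(@Gauss_dvdzr _ u) 1?coprimez_sym // e' dvdz_mull.
have d2 : (v' %| v)%Z.
  by rewrite -(@Gauss_dvdzr _ u') 1?coprimez_sym // -e' dvdz_mull.
have ev : v = v'.
  have ea : absz v = absz v' by apply/eqP; rewrite eqn_dvd -!dvdzE d1 d2.
  case: v v' sv ea {e e' d1 d2 v0 v0' cuv cuv'} => [m|m] [n|n] //= _.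
    by move->.
  by case=> ->.
rewrite ev in e' *; congr (_, _); apply: (mulIf v0'); exact: e'.
Qed.

(** Converse of [quartic_coords]: F(u, v) = D m^2 yields the point (u / v, m / v^2). *)
Lemma pair_point D (hD : D != 0) p : Psi a b c p -> sfpart p = D ->
  exists P : point (twistE hd hD), exists2 y : rat, y != 0 &
    val P = Some (p.1%:~R / p.2%:~R, y).
Proof.
move=> [cp q0] ep; have [_ [m m0 em]] := squarefree_partP q0.
rewrite -/(sfpart p) ep in em.
have v0 : p.2%:~R != 0 :> rat by rewrite intr_eq0 (quartic_snd_neq0 q0).
have m0' : m%:~R != 0 :> rat by rewrite intr_eq0.
pose y : rat := m%:~R / p.2%:~R ^+ 2.
have y0 : y != 0 by rewrite mulf_neq0 // invr_eq0 expf_neq0.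
have onP : onE (twistE hd hD) (Some (p.1%:~R / p.2%:~R, y)).
  apply/eqP => /=; apply: (mulfI (expf_neq0 4 v0)).
  transitivity (D%:~R * m%:~R ^+ 2 : rat); first by rewrite /y; field.
  transitivity ((quartic a b c p)%:~R : rat); first by rewrite em; ring.
  transitivity (p.2%:~R * (p.1%:~R ^+ 3 + a%:~R * p.1%:~R ^+ 2 * p.2%:~R
    + b%:~R * p.1%:~R * p.2%:~R ^+ 2 + c%:~R * p.2%:~R ^+ 3) : rat).
    by case: (p) => u v /=; ring.
  by field.
by exists (exist (fun P => onE (twistE hd hD) P) _ onP), y.
Qed.

Variable r : nat.
Hypothesis rank_le : forall D (hD : D != 0) n (P : 'I_n -> point (twistE hd hD)),
  independent P -> (n <= r)%N.

Lemma S_E_bounded (j k : R) : r%:R < 2 * j -> 1 < j -> 1 <= k ->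
  (S_E a b c j k < +oo)%E.
Proof.
move=> hr j1 k1; have j0 : 0 < j by lra.
have [M hM] := @count_points R a b c hd r rank_le.
have [k' k'0 hk'] := @height_ge_logtwist R a b c hd.
pose kk := Num.min k' 4^-1.
have kk0 : 0 < kk by rewrite lt_min k'0 invr_gt0 ltr0n.
have kk4 : kk <= 4^-1 by rewrite ge_min lexx orbT.
(* The factor 2 accounts for (u, v) and (-u, -v), which give the same abscissa. *)
have [B B0 hB] := height_sum_le (2 * M) j0 hr kk0 kk4.
have [B' B'0 hB'] := log_sum_le j1.
suff h : (S_E a b c j k <= (B * B')%:E)%E by apply: le_lt_trans h (ltry _).
apply: esum_le_fin => s us hs.
pose U := undup [seq sfpart p | p <- s].
have sfp p : p \in s -> squarefree (sfpart p) /\ sfpart p != 0.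
  move=> ps; have [_ q0] := hs p ps; have [hsf _] := squarefree_partP q0.
  by split=> //; exact: squarefree_neq0.
rewrite (@sum_fiber _ _ _ sfpart _ _ U) ?undup_uniq //; last first.
  by move=> p ps; rewrite mem_undup map_f.
apply: (@le_trans _ _ (\sum_(D <- U) B * ((`|D|%:~R)^-1 * logtwist R D `^ (- j)))).
  rewrite big_seq [leRHS]big_seq; apply: ler_sum => D.
  rewrite mem_undup => /mapP[p0 p0s eD].
  have [sD D0] := sfp _ p0s; rewrite -eD in sD D0.
  pose sD' := [seq p <- s | sfpart p == D].
  have hsD p : p \in sD' -> Psi a b c p /\ sfpart p = D.
    by rewrite mem_filter => /andP[/eqP ? /hs].
  pose g p : point (twistE hd D0) := xget 0
    [set P : point (twistE hd D0) | exists2 y : rat, y != 0 & val P = Some (p.1%:~R / p.2%:~R, y)].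
  have hg p : p \in sD' -> exists2 y : rat, y != 0 & val (g p) = Some (p.1%:~R / p.2%:~R, y).
    move=> /hsD[h1 h2]; have [P hP] := pair_point D0 h1 h2.
    by rewrite /g; case: xgetP => [Q _ //|/(_ P) h]; case: h.
  have Dn : 0 < (`|D|%:~R : R) by rewrite ltr0z normr_gt0.
  have D1 : 1 <= (`|D|%:~R : R) by rewrite ler1z -gtz0_ge1 normr_gt0.
  rewrite -big_filter -/sD'.
  apply: (@le_trans _ _ (\sum_(p <- sD') (`|D|%:~R)^-1 * height1 R (val (g p)) `^ (- j))).
    rewrite big_seq [leRHS]big_seq; apply: ler_sum => p psD.
    have [hp1 hp2] := hsD _ psD; have [y y0 ey] := hg _ psD.
    rewrite ey (height_pairE R p y) /sfpart in hp2 *.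
    rewrite -/(sfpart p) /sfpart hp2 powRN mul1r invfM ler_wpM2r ?invr_ge0 ?powR_ge0 //.
    by rewrite intr_norm lef_pV2 ?posrE ?powR_gt0 -?intr_norm // -[leLHS]powRr1 ?ler_powR // ltW.
  rewrite -mulr_sumr mulrCA ler_wpM2l ?invr_ge0 ?(ltW Dn) //.
  apply: (hB _ (fun p => nheight R (val (g p)))).
  - exact: logtwist_ge1.
  - exact: filter_uniq.
  - by move=> p; rewrite le_max lexx orbT.
  - move=> p psD; apply: le_trans (hk' _ D0 sD (g p) _); last first.
      by have [y y0 ->] := hg _ psD.
    by rewrite ler_wpM2r ?ge_min ?lexx // (le_trans ler01) // logtwist_ge1.
  - move=> i s' us' s's hs'.
    pose t := undup [seq g p | p <- s'].
    have ht : (size t <= M * 2 ^ (r * i))%N.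
      apply: hM sD _ _ (undup_uniq _) _ => P.
      by rewrite mem_undup => /mapP[p ps ->]; exact: hs'.
    apply: (@leq_trans (size [seq (P, e) | P <- t, e <- [:: true; false]])); last first.
      by rewrite size_allpairs mulnC -mulnA leq_mul2l.
    rewrite -(size_map (fun p => (g p, 0 <= p.2)) s'); apply: uniq_leq_size.
      rewrite map_inj_in_uniq // => p q ps qs [eg es].
      have [[cp np] _] := hsD _ (s's _ ps); have [[cq nq] _] := hsD _ (s's _ qs).
      have [y _ ey] := hg _ (s's _ ps); have [y' _ ey'] := hg _ (s's _ qs).
      have e : p.1%:~R / p.2%:~R = q.1%:~R / q.2%:~R :> rat.
        by move: ey; rewrite eg ey' => -[->].
      have := coprime_ratio cp cq (quartic_snd_neq0 np) (quartic_snd_neq0 nq) e es.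
      by case: (p) (q) => ? ? [? ?].
    move=> _ /mapP[p ps ->]; apply: allpairs_f; last by case: (0 <= p.2).
    by rewrite mem_undup; apply/mapP; exists p.
rewrite -mulr_sumr ler_wpM2l //; apply: hB'; first exact: undup_uniq.
by move=> D; rewrite mem_undup => /mapP[p /sfp[_ ?] ->].
Qed.
End PairPoints.

(** * Comparison of S_E, R_E and Q_E *)

Section CompareRS.
Variables (R : realType) (a b c : int).

Definition R_index : set (nat * (int * int)) :=
  [set x | [/\ (0 < x.1)%N, Psi a b c x.2 & (x.1%:Z ^+ 2 %| quartic a b c x.2)%Z]].

Definition R_term (j k : R) (x : nat * (int * int)) : R :=
  x.1%:R `^ (2 * k) / (`|(quartic a b c x.2)%:~R| `^ k * height_pair R x.2 `^ j).

Definition S_term (j k : R) (p : int * int) : R :=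
  1 / (`|(sfpart a b c p)%:~R| `^ k * height_pair R p `^ j).

Lemma R_term_ge0 j k x : 0 <= R_term j k x.
Proof. by rewrite divr_ge0 ?mulr_ge0 ?powR_ge0. Qed.

Lemma S_term_ge0 j k p : 0 <= S_term j k p.
Proof. by rewrite divr_ge0 ?mulr_ge0 ?powR_ge0. Qed.

Lemma R_EE (j k : R) : R_E a b c j k = \esum_(x in R_index) (R_term j k x)%:E.
Proof.
rewrite /R_E esum_esum; last by move=> t p _ _; rewrite lee_fin (R_term_ge0 j k (t, p)).
congr (esum _ _); apply/seteqP; split=> -[t p] /=.
  by move=> [? [? ?]].
by move=> [? ? ?].
Qed.

Lemma sqroot_part p : Psi a b c p -> exists2 m : nat, (0 < m)%N &
  quartic a b c p = sfpart a b c p * m%:Z ^+ 2.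
Proof.
move=> [_ q0]; have [_ [m m0 em]] := squarefree_partP q0.
exists (absz m); first by rewrite absz_gt0.
by rewrite {1}em /sfpart abszE real_normK ?num_real.
Qed.

(** Source of both comparisons of S_E with R_E: t = m recovers the term of S_E, and summing over the
    divisors t of m costs at most the factor zeta(2), because k >= 1. *)
Lemma R_term_split j k t p (m : nat) : (0 < m)%N -> (0 < t)%N ->
  quartic a b c p = sfpart a b c p * m%:Z ^+ 2 ->
  R_term j k (t, p) = (m%:R / t%:R) `^ (- (2 * k)) * S_term j k p.
Proof.
move=> m0 t0 em; rewrite /R_term /S_term /=.
have mR : 0 < m%:R :> R by rewrite ltr0n.
have tR : 0 < t%:R :> R by rewrite ltr0n.
have -> : `|(quartic a b c p)%:~R| = `|(sfpart a b c p)%:~R| * m%:R ^+ 2 :> R.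
  rewrite {1}em (_ : _%:~R = (sfpart a b c p)%:~R * m%:R ^+ 2); last by ring.
  by rewrite normrM [X in _ * X]ger0_norm // exprn_ge0 // ltW.
rewrite powRM ?exprn_ge0 ?(ltW mR) // -(powR_mulrn 2 (ltW mR)) -powRrM powRN.
have -> : (m%:R / t%:R) `^ (2 * k) = m%:R `^ (2 * k) / t%:R `^ (2 * k).
  apply: (mulIf (lt0r_neq0 (powR_gt0 (2 * k) tR))).
  rewrite -powRM ?divr_ge0 ?(ltW mR) ?(ltW tR) //.
  by rewrite divfK ?gt_eqF // divfK // gt_eqF // powR_gt0.
by rewrite !invfM invrK mul1r; ring.
Qed.

Lemma S_E_le_R_E (j k : R) : (S_E a b c j k <= R_E a b c j k)%E.
Proof.
rewrite R_EE; apply: ge_ereal_sup => _ [A [finA AP] <-].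
rewrite fsbig_finite // sumEFin.
have AP' p : p \in fset_set A -> Psi a b c p by rewrite in_fset_set // => /set_mem/AP.
have [m hm] : exists m : int * int -> nat, forall p, p \in fset_set A ->
    (0 < m p)%N /\ quartic a b c p = sfpart a b c p * (m p)%:Z ^+ 2.
  have /choice[m hm] : forall p, exists m : nat, p \in fset_set A ->
      (0 < m)%N /\ quartic a b c p = sfpart a b c p * m%:Z ^+ 2.
    move=> p; have [/AP' /sqroot_part[m m0 em]|_] := boolP (p \in fset_set A).
      by exists m.
    by exists 0%N.
  by exists m.
apply: (@le_trans _ _ (\sum_(x <- [seq (m p, p) | p <- fset_set A]) R_term j k x)%:E).
  rewrite big_map lee_fin big_seq [leRHS]big_seq; apply: ler_sum => p /hm[m0 em].
  rewrite (R_term_split _ _ m0 m0 em) divff ?pnatr_eq0 -?lt0n //.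
  by rewrite powR1 [leRHS]mul1r; exact: lexx.
apply: fin_le_esum; first by rewrite map_inj_uniq ?fset_uniq // => p q [].
move=> _ /mapP[p pA ->]; have [m0 em] := hm _ pA; split=> //=; first exact: AP'.
by rewrite em dvdz_mull.
Qed.

Lemma R_E_finite (j k : R) : 1 <= k ->
  (S_E a b c j k < +oo)%E -> (R_E a b c j k < +oo)%E.
Proof.
move=> k1 hS.
have [M hM] := esum_lt_bounded (fun p _ => S_term_ge0 j k p) hS.
have [B B0 hB] := @power_sum_le R 2 (ltr1n _ 2).
suff h : (R_E a b c j k <= (B * M)%:E)%E by apply: le_lt_trans h (ltry _).
rewrite R_EE; apply: esum_le_fin => s us hs.
pose U := undup [seq x.2 | x <- s].
rewrite (@sum_fiber _ _ _ snd _ _ U) ?undup_uniq //; last first.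
  by move=> x xs; rewrite mem_undup map_f.
have UP p : p \in U -> Psi a b c p.
  by rewrite mem_undup => /mapP[x /hs[_ hx _] ->].
apply: (@le_trans _ _ (\sum_(p <- U) B * S_term j k p)); last first.
  by rewrite -mulr_sumr ler_wpM2l // hM // undup_uniq.
rewrite big_seq [leRHS]big_seq; apply: ler_sum => p pU.
have hp := UP _ pU; have [m m0 em] := sqroot_part hp.
have [ssf _] := squarefree_partP (proj2 hp); rewrite -/(sfpart a b c p) in ssf.
(* From t^2 | s m^2 with s squarefree: s (m / t)^2 is an integer, hence so is m / t. *)
have hdiv t : (t, p) \in s -> (0 < t)%N /\ (t %| m)%N.
  move=> /hs[/= t0 _ /dvdzP[q eq]]; split=> //.
  have tQ : t%:R != 0 :> rat by rewrite pnatr_eq0 -lt0n.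
  have e : q%:~R = (sfpart a b c p)%:~R * (m%:R / t%:R) ^+ 2 :> rat.
    apply: (mulIf (expf_neq0 2 tQ)).
    transitivity ((quartic a b c p)%:~R : rat); first by rewrite eq; ring.
    rewrite [in LHS]em; transitivity ((sfpart a b c p)%:~R * m%:R ^+ 2 : rat); first by ring.
    by field.
  have [w ew] := squarefree_square_quotient ssf e.
  have : m%:Z = w * t%:Z.
    by apply: (@intr_inj rat); rewrite intrM -ew -[(t%:Z)%:~R]/(t%:R : rat) divfK.
  move=> ew'; have : (t%:Z %| m%:Z)%Z by apply/dvdzP; exists w.
  by rewrite dvdzE !absz_nat.
rewrite -big_filter; set sp := [seq x <- s | x.2 == p].
have hsp x : x \in sp -> x \in s /\ x = (x.1, p).
  by rewrite mem_filter => /andP[/eqP <- ?]; split=> //; case: (x).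
apply: (@le_trans _ _ (\sum_(x <- sp) (m %/ x.1)%N%:R `^ (- 2) * S_term j k p)).
  rewrite big_seq [leRHS]big_seq; apply: ler_sum => x /hsp[xs ex].
  rewrite ex in xs *; have [t0 tm] := hdiv _ xs; rewrite (R_term_split _ _ m0 t0 em) /=.
  rewrite ler_wpM2r ?S_term_ge0 //.
  have -> : m%:R / x.1%:R = (m %/ x.1)%N%:R :> R.
    by rewrite -{1}(divnK tm) natrM mulfK // pnatr_eq0 -lt0n.
  have h1 : 1 <= (m %/ x.1)%N%:R :> R by rewrite ler1n divn_gt0 // dvdn_leq.
  by apply: ler_powR => //; lra.
rewrite -mulr_suml ler_wpM2r ?S_term_ge0 //.
rewrite -(big_map (fun x : nat * (int * int) => (m %/ x.1)%N) xpredT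
   (fun n => n%:R `^ (- 2))).
apply: hB.
  rewrite map_inj_in_uniq ?filter_uniq // => x y /hsp[xs ex] /hsp[ys ey] e.
  rewrite ex in xs; rewrite ey in ys; have [x0 xm] := hdiv _ xs.
  have [y0 ym] := hdiv _ ys; rewrite ex ey; congr (_, _).
  have q0 : (0 < m %/ x.1)%N by rewrite divn_gt0 // dvdn_leq.
  have e2 : (m %/ x.1 * x.1 = m %/ x.1 * y.1)%N by rewrite {2}e !divnK.
  by apply/eqP; rewrite -(eqn_pmul2l q0); apply/eqP.
move=> n /mapP[x /hsp[xs ex] ->]; rewrite ex in xs; have [x0 xm] := hdiv _ xs.
by rewrite divn_gt0 // dvdn_leq.
Qed.
End CompareRS.

(** * Lattices and their shortest vectors *)

Lemma latticeP (d d' : nat) (alpha : 'I_(d ^ 2)) (p : int * int) :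
  lattice d' alpha p <->
  (d%:Z ^+ 2 %| p.1 - alpha%:Z * p.2)%Z /\ (d'%:Z ^+ 2 %| p.2)%Z.
Proof.
rewrite /lattice /= -eqz_mod_dvd; split=> -[h1 h2]; split; try exact/eqP.
  by move/eqP: h2; rewrite eqz_mod_dvd subr0.
by apply/eqP; rewrite eqz_mod_dvd subr0.
Qed.

(** The lattice contains (d^2, 0), which is short enough if d <= d'. Otherwise it is a pigeonhole
    argument: there are more pairs (x, y) with 0 <= x <= d d' and 0 <= y <= d / d' than values of x
    - alpha d'^2 y modulo d^2. *)
Lemma short_vector (d d' : nat) (alpha : 'I_(d ^ 2)) : (0 < d)%N -> (0 < d')%N ->
  exists2 z : int * int, lattice d' alpha z /\ z != (0, 0) &
    `|z.1| <= (d * d')%N%:Z /\ `|z.2| <= (d * d')%N%:Z.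
Proof.
move=> d0 d'0; have [dd'|dd'] := leqP d d'.
  exists (d%:Z ^+ 2, 0); first split.
  - by apply/latticeP; rewrite /= mulr0 subr0 dvdzz dvdz0.
  - have dz : d%:Z != 0 by lia.
    by rewrite xpair_eqE negb_and expf_neq0.
  - by rewrite /= normr0 ger0_norm ?exprn_ge0 //; split; nia.
pose Y := (d %/ d')%N; pose X := (d * d')%N.
pose f (t : 'I_X.+1 * 'I_Y.+1) : int :=
  ((t.1%:Z - alpha%:Z * (d'%:Z ^+ 2 * t.2%:Z)) %% (d%:Z ^+ 2))%Z.
have D0 : 0 < d%:Z ^+ 2 by rewrite exprn_gt0.
have fP t : 0 <= f t /\ f t < d%:Z ^+ 2.
  by rewrite modz_ge0 ?gt_eqF // ltz_pmod.
have fb t : (absz (f t) < d ^ 2)%N.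
  by have [h1 h2] := fP t; rewrite -ltz_nat gez0_abs // (lt_le_trans h2) // -natrX natz.
pose g t : 'I_(d ^ 2) := Ordinal (fb t).
have : ~~ injectiveb g.
  apply/negP => /injectiveP/leq_card; rewrite card_prod !card_ord /X.
  have := ltn_ceil d d'0; rewrite -/Y; nia.
case/injectivePn => -[x y] [[x' y'] ne e].
have {}e : f (x, y) = f (x', y').
  have [h1 _] := fP (x, y); have [h2 _] := fP (x', y').
  by rewrite -(gez0_abs h1) -(gez0_abs h2); congr (Posz _); have := congr1 val e.
exists (x%:Z - x'%:Z, d'%:Z ^+ 2 * (y%:Z - y'%:Z)); first split.
- apply/latticeP; rewrite /= dvdz_mulr //; split=> //.
  move/eqP: e; rewrite /f eqz_mod_dvd /= => h.
  by rewrite (_ : _ - _ = x%:Z - alpha%:Z * (d'%:Z ^+ 2 * y%:Z)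
    - (x'%:Z - alpha%:Z * (d'%:Z ^+ 2 * y'%:Z))) //; ring.
- apply: contra ne; rewrite xpair_eqE mulf_eq0 expf_eq0 /=.
  have dz : d'%:Z != 0 by lia.
  rewrite (negbTE dz) !subr_eq0 !eqz_nat => /andP[/eqP ex /eqP ey].
  by apply/eqP; congr (_, _); apply: val_inj.
- have hx := ltn_ord x; have hx' := ltn_ord x'; have hy := ltn_ord y.
  have hy' := ltn_ord y'; rewrite !ltnS in hx hx' hy hy'.
  rewrite /= normrM ger0_norm ?exprn_ge0 //.
  have hY : (Y * d' <= d)%N by exact: leq_trunc_div.
  have h1 : `|x%:Z - x'%:Z| <= X%:Z by lia.
  have h2 : `|y%:Z - y'%:Z| <= Y%:Z by lia.
  split; first exact: h1.
  apply: le_trans (_ : d'%:Z ^+ 2 * Y%:Z <= _).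
    by rewrite ler_wpM2l ?exprn_ge0.
  by move: hY; clear; move: Y => Y; nia.
Qed.

Section ShortestVectors.
Variables (R : realType) (a b c : int).
Variable omega : forall d d' : nat, 'I_(d ^ 2) -> int * int.
Hypothesis homega : shortest_vector_choice R a b c omega.

Lemma maxnorm_le_enorm (p : int * int) : (maxnorm p)%:~R <= enorm R p.
Proof.
have h (x y : R) : `|x| <= Num.sqrt (x ^+ 2 + y ^+ 2).
  by rewrite -sqrtr_sqr ler_sqrt ?addr_ge0 ?sqr_ge0 // lerDl sqr_ge0.
rewrite /enorm /maxnorm; case: (leP `|p.1| `|p.2|) => _; rewrite intr_norm.
  by rewrite addrC h.
exact: h.
Qed.

Lemma enorm_le (p : int * int) (n : nat) : `|p.1| <= n%:Z -> `|p.2| <= n%:Z ->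
  enorm R p <= 2 * n%:R.
Proof.
move=> h1 h2.
have h (x : int) : `|x| <= n%:Z -> (x%:~R : R) ^+ 2 <= n%:R ^+ 2.
  move=> hx; rewrite -real_normK ?num_real // lerXn2r ?nnegrE //.
  by rewrite -intr_norm -[n%:R]/((n%:Z)%:~R) ler_int.
have n0 : 0 <= 2 * n%:R :> R by rewrite mulr_ge0.
rewrite -[leRHS]ger0_norm // -sqrtr_sqr ler_wsqrtr //.
have := h _ h1; have := h _ h2; have := sqr_ge0 (n%:R : R); rewrite exprMn.
move: (n%:R ^+ 2 : R) (p.1%:~R ^+ 2 : R) (p.2%:~R ^+ 2 : R) => x y z *; lra.
Qed.

Lemma omega_le (d d' : nat) (alpha : 'I_(d ^ 2)) :
  (0 < d)%N -> (0 < d')%N -> alpha \in Omega a b c d ->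
  enorm R (omega d' alpha) <= 2 * (d * d')%N%:R.
Proof.
move=> d0 d'0 hal; have [_ _ hmin] := homega d0 d'0 hal.
have [z [zL z0] [h1 h2]] := short_vector alpha d0 d'0.
by apply: le_trans (hmin z zL z0) _; exact: enorm_le.
Qed.

Lemma square_dvd_quartic (d d' : nat) (alpha : 'I_(d ^ 2)) p :
  alpha \in Omega a b c d -> lattice d' alpha p ->
  ((d * d')%N%:Z ^+ 2 %| quartic a b c p)%Z.
Proof.
rewrite inE => hal /latticeP[h1 h2].
have -> : (d * d')%N%:Z ^+ 2 = d'%:Z ^+ 2 * d%:Z ^+ 2 by rewrite PoszM; ring.
have -> : quartic a b c p = p.2 * (p.1 ^+ 3 + a * p.1 ^+ 2 * p.2
   + b * p.1 * p.2 ^+ 2 + c * p.2 ^+ 3) by case: p {h1 h2}.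
apply: dvdz_mul => //.
have /dvdzP[q eq] := h1; have /dvdzP[q' eq'] := hal.
have ev : (cubic a b c).[alpha%:Z] = alpha%:Z ^+ 3 + a * alpha%:Z ^+ 2 + b * alpha%:Z + c.
  by rewrite /cubic !hornerE.
have -> : p.1 = alpha%:Z * p.2 + q * d%:Z ^+ 2 by rewrite -eq; ring.
apply/dvdzP; exists (q' * p.2 ^+ 3 + q * (3 * (alpha%:Z * p.2) ^+ 2
  + 3 * (alpha%:Z * p.2) * (q * d%:Z ^+ 2) + (q * d%:Z ^+ 2) ^+ 2
  + a * p.2 * (2 * (alpha%:Z * p.2) + q * d%:Z ^+ 2) + b * p.2 ^+ 2)).
have -> : c = q' * d%:Z ^+ 2 - (alpha%:Z ^+ 3 + a * alpha%:Z ^+ 2 + b * alpha%:Z).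
  by rewrite -eq' ev; ring.
by ring.
Qed.

(* The lattice and the coprimality of the coordinates recover [d] as the part
   of [d d'] coprime to [v], and then [alpha] as [u / v] modulo [d ^ 2]. *)
Lemma lattice_index_inj (d1 d1' d2 d2' : nat) (al1 : 'I_(d1 ^ 2))
    (al2 : 'I_(d2 ^ 2)) p : coprimez p.1 p.2 ->
  (0 < d1)%N -> (0 < d2)%N -> (0 < d1')%N ->
  lattice d1' al1 p -> lattice d2' al2 p -> (d1 * d1' = d2 * d2')%N ->
  [/\ d1 = d2, d1' = d2' & al1 = al2 :> nat].
Proof.
move=> cp d10 d20 d1'0 /latticeP[h1 h1'] /latticeP[h2 h2'] e.
have cop d (al : 'I_(d ^ 2)) :
    (d%:Z ^+ 2 %| p.1 - al%:Z * p.2)%Z -> coprimez d%:Z p.2.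
  move=> h; set g := gcdz d%:Z p.2.
  have g1 : (g %| p.2)%Z by rewrite dvdz_gcdr.
  have g2 : (g %| p.1)%Z.
    apply: (@dvdz_cancel_add _ (- (al%:Z * p.2))).
      by rewrite -mulNr dvdz_mull.
    rewrite addrC; apply: dvdz_trans h; apply: dvdz_exp => //.
    by rewrite dvdz_gcdl.
  have : (g %| gcdz p.1 p.2)%Z by rewrite dvdz_gcd g1 g2.
  by rewrite (eqP cp) dvdz1 /g /coprimez => /eqP; rewrite /gcdz absz_nat => ->.
have c1 := cop _ _ h1; have c2 := cop _ _ h2.
have dv d (x : int) : (d%:Z ^+ 2 %| x)%Z -> (d%:Z %| x)%Z.
  by apply: dvdz_trans; apply: dvdz_exp.
have cc d d' : coprimez d%:Z p.2 -> (d'%:Z ^+ 2 %| p.2)%Z -> coprime d d'.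
  move=> cd /dv hd'; rewrite -[coprime d d']/(coprimez d%:Z d'%:Z).
  exact: coprimez_dvdr hd' cd.
have e1 : d1 = d2.
  apply/eqP; rewrite eqn_dvd; apply/andP; split.
    by rewrite -(Gauss_dvdl _ (cc _ _ c1 h2')) -e dvdn_mulr.
  by rewrite -(Gauss_dvdl _ (cc _ _ c2 h1')) e dvdn_mulr.
subst d2; have e2 : d1' = d2' by apply/eqP; rewrite -(eqn_pmul2l d10) e.
split=> //.
have : (d1%:Z ^+ 2 %| (al1%:Z - al2%:Z) * p.2)%Z.
  have -> : (al1%:Z - al2%:Z) * p.2 = (p.1 - al2%:Z * p.2) + - (p.1 - al1%:Z * p.2).
    by ring.
  by apply: dvdz_add => //; rewrite dvdzE abszN -dvdzE.
rewrite Gauss_dvdzl ?coprimezXl // -eqz_mod_dvd.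
have hmod (al : 'I_(d1 ^ 2)) : (al%:Z %% d1%:Z ^+ 2)%Z = al%:Z.
  have -> : d1%:Z ^+ 2 = (d1 ^ 2)%N%:Z by rewrite -!natz natrX.
  by rewrite modz_nat modn_small.
by rewrite !hmod => /eqP[].
Qed.
End ShortestVectors.

Lemma maxnorm_coords_ratio (p : int * int) y : coprimez p.1 p.2 -> p.2 != 0 ->
  maxnorm (coords (Some (p.1%:~R / p.2%:~R, y))) = maxnorm p.
Proof.
move=> cp v0; rewrite /maxnorm /= coprimeq_num // coprimeq_den // (negbTE v0).
by rewrite normrM normr_sg v0 mul1r normr_id.
Qed.

Section CompareQR.
Variables (R : realType) (a b c : int).
Variable omega : forall d d' : nat, 'I_(d ^ 2) -> int * int.
Hypothesis homega : shortest_vector_choice R a b c omega.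

Lemma enorm_gt0 p : p.2 != 0 -> 0 < enorm R p.
Proof.
move=> v0; rewrite sqrtr_gt0 ltr_wpDl ?sqr_ge0 //.
by rewrite exprn_even_gt0 //= intr_eq0.
Qed.

Lemma quartic_enorm_le : exists2 K : R, 0 < K & forall p,
  `|(quartic a b c p)%:~R| <= K * enorm R p ^+ 4.
Proof.
exists (`|c| + `|b| + `|a| + `|1|)%:~R; first by rewrite ltr0z normr1 ltr_wpDl // !addr_ge0.
move=> p; rewrite -intr_norm.
apply: le_trans (_ : ((`|c| + `|b| + `|a| + `|1|) * maxnorm p ^+ 4)%:~R <= _).
  by rewrite ler_int quartic_le.
rewrite intrM rmorphXn /= ler_wpM2l ?ler0z ?addr_ge0 //.
have m0 : 0 <= (maxnorm p)%:~R :> R by rewrite ler0z (le_trans (normr_ge0 _) (norm1_maxnorm p)).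
by rewrite lerXn2r ?nnegrE ?maxnorm_le_enorm // (le_trans m0) // maxnorm_le_enorm.
Qed.

Definition Q_term (j k : R) (d d' : nat) (al : 'I_(d ^ 2)) : R :=
  (d * d')%N%:R `^ (2 * k) / Num.max 1 (ln (d * d')%N%:R) `^ j
  * enorm R (omega d' al) `^ (- (4 * k)).

(** The comparison takes t = d d' and p = omega in R_E. From |omega| <= 2 d d' the height of omega
    is at most 2 max(1, log(d d')), and |F(omega)| is O(|omega|^4). *)
Lemma Q_term_le (j k : R) : 0 < j -> 1 <= k -> exists2 C : R, 0 <= C &
  forall (d d' : nat) (al : 'I_(d ^ 2)), (0 < d)%N -> (0 < d')%N ->
  al \in Omega a b c d -> Psi a b c (omega d' al) ->
  Q_term j k d' al <= C * R_term a b c j k ((d * d')%N, omega d' al).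
Proof.
move=> j0 k1; have k0 : 0 < k by lra.
have [K K0 hK] := quartic_enorm_le.
exists (K `^ k * 2 `^ j); first by rewrite mulr_ge0 ?powR_ge0.
move=> d d' al d0 d'0 hal hPsi; rewrite /Q_term /R_term /=.
have hle := omega_le homega d0 d'0 hal.
set p := omega d' al in hPsi hle *; set t := (d * d')%N in hle *.
have [cp q0] := hPsi; have v0 := quartic_snd_neq0 q0.
have t0 : (0 < t)%N by rewrite muln_gt0 d0.
have e0 := enorm_gt0 v0.
have F0 : 0 < `|(quartic a b c p)%:~R| :> R by rewrite normr_gt0 intr_eq0.
have L1 : 1 <= Num.max 1 (ln t%:R) :> R by rewrite le_max lexx.
have L0 : 0 < Num.max 1 (ln t%:R) :> R by apply: lt_le_trans L1.
have H1 : 1 <= height_pair R p by rewrite /height_pair /height le_max lexx.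
have H0 : 0 < height_pair R p by apply: lt_le_trans H1.
have hH : height_pair R p <= 2 * Num.max 1 (ln t%:R).
  rewrite (height_pairE R p 0) /height1 ge_max; apply/andP; split; first by lra.
  rewrite /nheight maxnorm_coords_ratio //.
  have m0 := maxnorm_coprime_gt0 cp.
  apply: (@le_trans _ _ (ln (2 * t%:R))).
    rewrite ler_ln ?posrE ?ltr0z ?mulr_gt0 ?ltr0n //.
    exact: le_trans (maxnorm_le_enorm R p) hle.
  rewrite lnM ?posrE ?ltr0n //.
  have h2 : ln 2 <= 1 :> R by rewrite -[leRHS](expRK 1) ler_ln ?posrE ?expR_gt0 //; have := expR_ge1Dx (1 : R); lra.
  have h3 : ln t%:R <= Num.max 1 (ln t%:R) :> R by rewrite le_max lexx orbT.
  apply: le_trans (lerD h2 h3) _.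
  by rewrite -[2]/(1 + 1) mulrDl !mul1r lerD2r.
rewrite (_ : K `^ k * 2 `^ j * _ = t%:R `^ (2 * k) *
   ((K `^ k / `|(quartic a b c p)%:~R| `^ k) * (2 `^ j / height_pair R p `^ j)));
  last by rewrite invfM; ring.
rewrite -mulrA ler_wpM2l ?powR_ge0 // mulrC.
apply: ler_pM; rewrite ?powR_ge0 ?invr_ge0 ?powR_ge0 //.
  rewrite ler_pdivlMr ?powR_gt0 // powRN ler_pdivrMl ?powR_gt0 //.
  rewrite mulrC (_ : enorm R p `^ (4 * k) = (enorm R p ^+ 4) `^ k); last first.
    by rewrite -(powR_mulrn 4 (ltW e0)) -powRrM.
  rewrite -powRM ?exprn_ge0 ?(ltW K0) ?(ltW e0) //.
  by rewrite ge0_ler_powR ?nnegrE ?(ltW k0) ?mulr_ge0 ?exprn_ge0 ?(ltW K0) ?(ltW e0).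
rewrite ler_pdivlMr ?powR_gt0 // ler_pdivrMl ?powR_gt0 // mulrC.
rewrite -powRM ?(ltW L0) //.
apply: ge0_ler_powR; rewrite ?nnegrE ?(ltW j0) ?mulr_ge0 ?(ltW H0) ?(ltW L0) //.
Qed.

Lemma Q_E_finite (j k : R) : 0 < j -> 1 <= k ->
  (R_E a b c j k < +oo)%E -> (Q_E a b c omega j k < +oo)%E.
Proof.
move=> j0 k1; rewrite R_EE => hR.
have [M hM] := esum_lt_bounded (fun x _ => R_term_ge0 a b c j k x) hR.
have [C C0 hC] := Q_term_le j0 k1.
suff h : (Q_E a b c omega j k <= (C * M)%:E)%E by apply: le_lt_trans h (ltry _).
apply: esum_le_fin => s us hs.
pose good (d d' : nat) (al : 'I_(d ^ 2)) :=
  (al \in Omega a b c d) && `[< Psi a b c (omega d' al) >].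
pose als (e : nat * nat) : seq 'I_(e.1 ^ 2) := [seq al <- enum 'I_(e.1 ^ 2) | good e.1 e.2 al].
pose L := [seq ((e.1 * e.2)%N, omega e.2 al) | e <- s, al <- als e].
have memals (e : nat * nat) (al : 'I_(e.1 ^ 2)) : al \in als e ->
    al \in Omega a b c e.1 /\ Psi a b c (omega e.2 al).
  by rewrite mem_filter => /andP[/andP[? /asboolP ?] _].
have uL : uniq L.
  apply: allpairs_uniq_dep => //=; first by move=> e _; rewrite filter_uniq ?enum_uniq.
  have hst (x : {e : nat * nat & 'I_(e.1 ^ 2)}) :
      x \in [seq Tagged (fun e : nat * nat => 'I_(e.1 ^ 2)) y | e <- s, y <- als e] ->
      tag x \in s /\ tagged x \in als (tag x).
    by case/allpairsPdep => e [y [es ye ->]].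
  move=> x y /hst[xs xa] /hst[ys ya].
  case: x xs xa => e al es /memals[hal hP]; case: y ys ya => e' al' es' /memals[hal' hP'].
  move=> /= [et ew]; have [e10 e20 _] := hs _ es; have [e10' e20' _] := hs _ es'.
  have [la _ _] := homega e10 e20 hal; have [la' _ _] := homega e10' e20' hal'.
  rewrite -ew in la'.
  have [e1 e2 ea] := lattice_index_inj (proj1 hP) e10 e10' e20 la la' et.
  have ee : e = e'.
    by rewrite (surjective_pairing e) (surjective_pairing e') /= e1 e2.
  by subst e'; congr (Tagged _ _); apply: val_inj.
have hL : \sum_(x <- L) R_term a b c j k x <= M.
  apply: hM => // x /allpairsPdep[e [al [es /memals[hal hP] ->]]].
  have [e10 e20 _] := hs _ es; split=> //=; first by rewrite muln_gt0 e10.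
  have [la _ _] := homega e10 e20 hal.
  exact: square_dvd_quartic hal la.
apply: le_trans (ler_wpM2l C0 hL); rewrite /L big_allpairs_dep mulr_sumr.
rewrite big_seq [leRHS]big_seq; apply: ler_sum => e es.
have [e10 e20 _] := hs _ es.
rewrite mulr_sumr mulr_sumr big_filter big_enum_cond /=.
apply: ler_sum => al /andP[hal /asboolP hP]; exact: hC.
Qed.
End CompareQR.

(** * Divergence of Q_E when a rank is large *)

Lemma double_coords (E : curve) (X : point E) : exists k : int,
  phi (coefa E) (coefb E) (coefc E) (coords (val X)) = k * (coords (val (X + X))).1 /\
  4 * quartic (coefa E) (coefb E) (coefc E) (coords (val X))
    = k * (coords (val (X + X))).2.
Proof.
have := proportional_int (coords_coprime _) (coords_coprime _) (kummerP X X).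
have [-> -> ->] := kummer_diag (coefa E) (coefb E) (coefc E) (coords (val X)).
by rewrite subrr /= !mulr0 !mulr1 mul1r add0r => -[k _ [_ ey ex]]; exists k.
Qed.

(** z is a root of the quadratic equation for the abscissae of V + U and V - U. With V - U fixed,
    this is a relation between the abscissae of U and V. *)
Lemma kummer_relation (E : curve) (U V : point E) x1 y1 x2 y2 z t :
  val U = Some (x1, y1) -> val V = Some (x2, y2) -> val (V - U) = Some (z, t) ->
  let a : rat := (coefa E)%:~R in let b : rat := (coefb E)%:~R in
  let c : rat := (coefc E)%:~R in
  z ^+ 2 * (x2 - x1) ^+ 2
  - 2 * z * ((x2 * x1 + b) * (x2 + x1) + 2 * a * (x2 * x1) + 2 * c)
  + ((x2 * x1 - b) ^+ 2 - 4 * c * (x2 + x1) - 4 * a * c) = 0.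
Proof.
move=> eU eV eW a b c.
have [k k0 [h0 h1 h2]] := kummerP V U.
rewrite eU eV eW /= in h0 h1 h2.
have n1 := numqE x1; have n2 := numqE x2; have nz := numqE z.
have d1 : (denq x1)%:~R != 0 :> rat by rewrite intr_eq0 denq_neq0.
have d2 : (denq x2)%:~R != 0 :> rat by rewrite intr_eq0 denq_neq0.
have dd0 : ((denq x1)%:~R * (denq x2)%:~R) ^+ 2 != 0 :> rat.
  by rewrite expf_neq0 // mulf_neq0.
apply: (mulfI dd0); rewrite mulr0.
move: (coords (val (V + U))) h0 h1 h2 => -[u v] /= h0 h1 h2.
transitivity (z ^+ 2 * (k * (v * denq z)%:~R)
  - z * (k * (u * denq z + numq z * v)%:~R) + k * (u * numq z)%:~R); last first.
  rewrite !(intrD, intrM) nz; ring.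
rewrite -h0 -h1 -h2 /kummer0 /kummer1 /kummer2 /=.
have e0 : (((numq x2 * denq x1 - numq x1 * denq x2) ^+ 2)%:~R : rat)
   = ((denq x1)%:~R * (denq x2)%:~R) ^+ 2 * (x2 - x1) ^+ 2.
  transitivity (((numq x2)%:~R * (denq x1)%:~R - (numq x1)%:~R * (denq x2)%:~R) ^+ 2 : rat).
    by ring.
  by rewrite n1 n2; ring.
rewrite e0.
transitivity (z ^+ 2 * (((denq x1)%:~R * (denq x2)%:~R) ^+ 2 * (x2 - x1) ^+ 2)
  - z * (2 * (((numq x2)%:~R * (numq x1)%:~R + b * ((denq x2)%:~R * (denq x1)%:~R))
     * ((numq x2)%:~R * (denq x1)%:~R + (numq x1)%:~R * (denq x2)%:~R)
     + 2 * a * ((numq x2)%:~R * (numq x1)%:~R) * ((denq x2)%:~R * (denq x1)%:~R)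
     + 2 * c * ((denq x2)%:~R * (denq x1)%:~R) ^+ 2))
  + (((numq x2)%:~R * (numq x1)%:~R - b * ((denq x2)%:~R * (denq x1)%:~R)) ^+ 2
     - 4 * c * ((denq x2)%:~R * (denq x1)%:~R)
        * ((numq x2)%:~R * (denq x1)%:~R + (numq x1)%:~R * (denq x2)%:~R)
     - 4 * a * c * ((denq x2)%:~R * (denq x1)%:~R) ^+ 2)).
  by rewrite n1 n2; ring.
by rewrite /a /b /c; ring.
Qed.

Definition bounded_abscissa (K : rat) (P : ec_point) : bool :=
  if P is Some (x, _) then `|x| <= K else false.

(* In terms of [u = 1 / x1] and [v = 1 / x2], all terms but the constant one
   of the relation between the abscissae tend to 0 with [u] and [v]. *)
Lemma kummer_relation_bounded (F : realFieldType) (a b c z : F) :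
  exists2 K : F, 0 < K & `|z| <= K /\ forall x1 x2 : F,
  z ^+ 2 * (x2 - x1) ^+ 2
  - 2 * z * ((x2 * x1 + b) * (x2 + x1) + 2 * a * (x2 * x1) + 2 * c)
  + ((x2 * x1 - b) ^+ 2 - 4 * c * (x2 + x1) - 4 * a * c) = 0 ->
  (`|x1| <= K) || (`|x2| <= K).
Proof.
pose C := 4 * z ^+ 2 + 4 * `|z| * (1 + `|b|) + 4 * `|z| * `|a| + 4 * `|z| * `|c|
  + 2 * `|b| + b ^+ 2 + 8 * `|c| + 4 * (`|a| * `|c|).
have C0 : 0 <= C.
  have z2 := sqr_ge0 z; have b2 := sqr_ge0 b; have zn := normr_ge0 z.
  have p1 := mulr_ge0 zn (normr_ge0 b); have p2 := mulr_ge0 zn (normr_ge0 a).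
  have p3 := mulr_ge0 zn (normr_ge0 c); have p4 := normr_ge0 b.
  have p5 := normr_ge0 c; have p6 := mulr_ge0 (normr_ge0 a) (normr_ge0 c).
  by rewrite /C; lra.
(* If |u| and |v| were at most 1 / K, the nonconstant terms would add up to at most C / K < 1. The
   summand |z| provides for the cases U = 0 and U + W = 0 of the next lemma, where the other point
   has abscissa z. *)
pose K := C + 1 + `|z|.
have K0 : 0 < K by rewrite /K ltr_wpDr // ltr_wpDl.
have zK : `|z| <= K by rewrite /K lerDr addr_ge0.
have CK : C + 1 <= K by rewrite /K lerDl.
exists K => //; split=> // x1 x2 rel.
clearbody K.
apply/negPn/negP; rewrite negb_or -!ltNge => /andP[l1 l2].
have x10 : x1 != 0 by rewrite -normr_gt0 (lt_trans K0).
have x20 : x2 != 0 by rewrite -normr_gt0 (lt_trans K0).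
pose e := K^-1; have e0 : 0 < e by rewrite invr_gt0.
have e1 : e <= 1 by rewrite invf_le1 // (le_trans _ CK) // lerDr.
pose u := x1^-1; pose v := x2^-1.
have hu : `|u| <= e by rewrite normfV lef_pV2 ?posrE ?normr_gt0 // ltW.
have hv : `|v| <= e by rewrite normfV lef_pV2 ?posrE ?normr_gt0 // ltW.
have {}rel : 1 = - (z ^+ 2 * (u - v) ^+ 2) + 2 * z * (1 + b * (u * v)) * (u + v)
   + 4 * z * a * (u * v) + 4 * z * c * (u * v * (u * v)) + 2 * b * (u * v)
   - b ^+ 2 * (u * v * (u * v)) + 4 * c * (u * v * (u + v)) + 4 * (a * c) * (u * v * (u * v)).
  have xx : (x1 * x2) ^+ 2 != 0 by rewrite expf_neq0 // mulf_neq0.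
  apply: (mulfI xx); rewrite -[LHS]subr0 -rel /u /v; field.
  by rewrite x10 x20.
have Ke : K * e = 1 by rewrite mulfV ?gt_eqF.
clearbody e u v.
clear x10 x20 l1 l2 zK.
have uv : `|u * v| <= e.
  by rewrite normrM -[leRHS]mulr1; apply: ler_pM => //; apply: le_trans hv e1.
have uv1 : `|u * v| <= 1 by apply: le_trans uv e1.
have uvuv : `|u * v * (u * v)| <= e.
  by rewrite normrM -[leRHS]mulr1; apply: ler_pM.
have upv : `|u + v| <= 2 * e by apply: le_trans (ler_normD _ _) _; lra.
have uvupv : `|u * v * (u + v)| <= 2 * e.
  by rewrite normrM -[leRHS]mul1r; apply: ler_pM.
have umv : `|(u - v) ^+ 2| <= 4 * e.
  have h : `|u - v| <= 2 * e by apply: le_trans (ler_normB _ _) _; lra.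
  rewrite expr2 normrM (_ : 4 * e = (2 * e) * 2); last by ring.
  by apply: ler_pM => //; lra.
have : 1 <= C * e.
  rewrite {1}rel.
  have hm (r s k : F) : `|s| <= k -> r * s <= `|r| * k.
    move=> h; apply: le_trans (ler_norm _) _; rewrite normrM.
    by apply: ler_wpM2l.
  have t1 : - (z ^+ 2 * (u - v) ^+ 2) <= 4 * z ^+ 2 * e.
    rewrite -mulNr; apply: le_trans (hm _ _ _ umv) _.
    by rewrite normrN ger0_norm ?sqr_ge0 //; lra.
  have t2 : 2 * z * (1 + b * (u * v)) * (u + v) <= 4 * `|z| * (1 + `|b|) * e.
    apply: le_trans (hm _ _ _ upv) _.
    rewrite normrM normrM (ger0_norm (ler0n F 2)) //.
    have hb : `|1 + b * (u * v)| <= 1 + `|b|.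
      apply: le_trans (ler_normD _ _) _; rewrite normr1 lerD2l normrM.
      by rewrite -[leRHS]mulr1; apply: ler_pM.
    rewrite (_ : 4 * `|z| * (1 + `|b|) * e = 2 * `|z| * (1 + `|b|) * (2 * e)); last by ring.
    apply: ler_wpM2r; first by lra.
    by apply: ler_wpM2l => //; rewrite mulr_ge0.
  have t3 : 4 * z * a * (u * v) <= 4 * `|z| * `|a| * e.
    by apply: le_trans (hm _ _ _ uv) _; rewrite !normrM (ger0_norm (ler0n F 4)).
  have t4 : 4 * z * c * (u * v * (u * v)) <= 4 * `|z| * `|c| * e.
    by apply: le_trans (hm _ _ _ uvuv) _; rewrite !normrM (ger0_norm (ler0n F 4)).
  have t5 : 2 * b * (u * v) <= 2 * `|b| * e.
    by apply: le_trans (hm _ _ _ uv) _; rewrite !normrM (ger0_norm (ler0n F 2)).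
  have t6 : - (b ^+ 2 * (u * v * (u * v))) <= b ^+ 2 * e.
    rewrite -mulNr; apply: le_trans (hm _ _ _ uvuv) _.
    by rewrite normrN ger0_norm ?sqr_ge0.
  have t7 : 4 * c * (u * v * (u + v)) <= 8 * `|c| * e.
    apply: le_trans (hm _ _ _ uvupv) _; rewrite normrM (ger0_norm (ler0n F 4)) //.
    by rewrite (_ : 8 * `|c| * e = 4 * `|c| * (2 * e)) //; ring.
  have t8 : 4 * (a * c) * (u * v * (u * v)) <= 4 * (`|a| * `|c|) * e.
    by apply: le_trans (hm _ _ _ uvuv) _; rewrite !normrM (ger0_norm (ler0n F 4)).
  by move: t1 t2 t3 t4 t5 t6 t7 t8; clear; rewrite /C; lra.
have : C * e < 1.
  by rewrite -Ke ltr_pM2r // (lt_le_trans _ CK) // ltrDl.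
by move=> h1 /(lt_le_trans h1); rewrite ltxx.
Qed.

(* Two points near infinity have a difference near infinity. *)
Lemma bounded_or_bounded (E : curve) (W : point E) : W != 0 ->
  exists2 K : rat, 0 < K & forall U : point E,
    bounded_abscissa K (val U) || bounded_abscissa K (val (U + W)).
Proof.
move=> W0.
case eW : (val W) => [[z t]|]; last first.
  have e : W = 0 by apply: val_inj.
  by move: W0; rewrite e eqxx.
have [K K0 [zK hK]] := kummer_relation_bounded (coefa E)%:~R (coefb E)%:~R
  (coefc E)%:~R z.
exists K => // U.
case eU : (val U) => [[x1 y1]|]; last first.
  have -> : U = 0 by apply: val_inj.
  by rewrite add0r eW /bounded_abscissa zK.
case eV : (val (U + W)) => [[x2 y2]|]; last first.
  have h : U + W = 0 by apply: val_inj.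
  have eU' : U = - W by apply/eqP; rewrite -addr_eq0 h.
  by move: eU; rewrite eU' val_pointN eW /= => -[<- _]; rewrite zK.
have eVU : val (U + W - U) = Some (z, t) by rewrite addrAC subrr add0r.
exact: hK (kummer_relation eU eV eVU).
Qed.

(* If [2 X] is not near infinity then [X] is not near any 2-torsion point. *)
Lemma bounded_double_quartic (E : curve) (K : rat) : 0 < K ->
  exists2 N : nat, (0 < N)%N & forall X : point E, bounded_abscissa K (val (X + X)) ->
  maxnorm (coords (val X)) ^+ 4
   <= N%:Z * `|quartic (coefa E) (coefb E) (coefc E) (coords (val X))|.
Proof.
move=> K0; set a := coefa E; set b := coefb E; set c := coefc E.
have [C C0 hC] := bezout_bound a b c.
have d0 : discr a b c != 0 by case: (E) @a @b @c {hC} => ? ? ? ? ? ? /=.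
pose N := (absz C * (Num.truncn K).+1 * 4)%N.
have N0 : (0 < N)%N by rewrite /N !muln_gt0 absz_gt0 gt_eqF.
exists N => // X hX.
have [k [ex ey]] := double_coords X; rewrite -/a -/b -/c in ex ey.
have cp := coords_coprime (val X).
have [_] := hC _ cp _ _ _ ex ey.
move: hX ex ey; case: (val (X + X)) => [[x y]|] //= hK ex ey h.
(* Since |x(2 X)| <= K, the denominator of x(2 X) controls its height, and k times this denominator
   is 4 F. *)
have hx : maxnorm (numq x, denq x) <= (Num.truncn K).+1%:Z * denq x.
  rewrite /maxnorm /= ge_max; apply/andP; split.
    rewrite -(ler_int rat) intr_norm numqE normrM intrM.
    rewrite (@ger0_norm _ (denq x)%:~R) ?ler0z ?denq_ge0 //.
    rewrite ler_wpM2r ?ler0z ?denq_ge0 //; apply: le_trans hK _.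
    by apply: ltW; exact: truncnS_gt.
  rewrite ger0_norm ?denq_ge0 //; have := denq_gt0 x; nia.
have D1 : 1 <= `|4 * discr a b c| by rewrite -gtz0_ge1 normr_gt0 mulf_neq0.
have H0 : 0 <= maxnorm (coords (val X)) ^+ 4.
  by rewrite exprn_ge0 // ltW // maxnorm_coprime_gt0.
have e4 : 4 * `|quartic a b c (coords (val X))| = `|k| * denq x.
  by rewrite -[4]/(`|4 : int|) -normrM ey normrM (@ger0_norm _ (denq x)) ?denq_ge0.
apply: le_trans (_ : `|4 * discr a b c| * maxnorm (coords (val X)) ^+ 4 <= _).
  by rewrite ler_peMl.
apply: le_trans h _.
rewrite /N !PoszM (gez0_abs (ltW C0)).
rewrite (_ : C * (Num.truncn K).+1%:Z * 4%:Z * _ =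
   C * (Num.truncn K).+1%:Z * (4 * `|quartic a b c (coords (val X))|)); last by ring.
rewrite e4 (_ : _ * (`|k| * denq x) = C * `|k| * ((Num.truncn K).+1%:Z * denq x)); last by ring.
by rewrite ler_wpM2l // mulr_ge0 // ltW.
Qed.

Lemma coprimez_dvd (m n p q : int) :
  (m %| n)%Z -> (p %| q)%Z -> coprimez n q -> coprimez m p.
Proof. by rewrite !dvdzE !coprimezE => hm hp h; apply: coprime_dvdl hm (coprime_dvdr hp h). Qed.

Lemma squarefreeM (s t : int) : squarefree s -> squarefree t -> coprimez s t ->
  squarefree (s * t).
Proof.
move=> hs ht cst d hd; have s0 := squarefree_neq0 hs; have t0 := squarefree_neq0 ht.
apply/eqP; apply: contraT => d1.
have d0 : (0 < d)%N.
  rewrite lt0n; apply: contraTneq hd => ->; rewrite expr0n /= dvd0z.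
  by rewrite mulf_neq0.
have pp : prime (pdiv d) by rewrite pdiv_prime // ltn_neqAle eq_sym d1.
set p := pdiv d in pp.
have hp : (p%:Z ^+ 2 %| s * t)%Z.
  by apply: dvdz_trans hd; apply: dvdz_exp2r; rewrite dvdzE !absz_nat pdiv_dvd.
have p1 : p != 1%N by apply: contraTneq pp => ->.
have [ps|ps] := boolP (p %| absz s)%N.
  have cpt : coprimez (p%:Z ^+ 2) t.
    by apply: coprimezXl; apply: coprimez_dvdl cst.
  by rewrite Gauss_dvdzl // in hp; move/eqP: p1; have := hs p hp.
have cps : coprimez (p%:Z ^+ 2) s.
  by apply: coprimezXl; rewrite coprimezE absz_nat prime_coprime.
by rewrite Gauss_dvdzr // in hp; move/eqP: p1; have := ht p hp.
Qed.

(** F = v g with v and g coprime. Writing v = s1 d'^2 and g = s2 d^2 with squarefree s1, s2 gives s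
    = s1 s2, and alpha is u / v modulo d^2. *)
Lemma lattice_of_pair (a b c : int) (p : int * int) :
  coprimez p.1 p.2 -> quartic a b c p != 0 ->
  exists s d d', exists al : 'I_(d ^ 2),
   [/\ squarefree s, quartic a b c p = s * ((d * d')%N%:Z) ^+ 2,
       (0 < d)%N /\ (0 < d')%N, coprime d d' &
       al \in Omega a b c d /\ lattice d' al p].
Proof.
case: p => u v /= cuv q0; pose g := u ^+ 3 + a * u ^+ 2 * v + b * u * v ^+ 2 + c * v ^+ 3.
rewrite -/g in q0 *; have [v0 g0] : v != 0 /\ g != 0.
  by apply/andP; rewrite -negb_or -mulf_eq0.
have cvg : coprimez v g.
  have -> : g = (a * u ^+ 2 + b * u * v + c * v ^+ 2) * v + u ^+ 3 by rewrite /g; ring.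
  rewrite /coprimez gcdzMDl -/(coprimez v (u ^+ 3)).
  by apply: coprimezXr; rewrite coprimez_sym.
have [s1 hs1 [m1 e1]] := squarefree_decomposition v0.
have [s2 hs2 [m2 e2]] := squarefree_decomposition g0.
have sq (m : int) : m ^+ 2 = (absz m)%:Z ^+ 2 by rewrite abszE real_normK ?num_real.
have m10 : (0 < absz m1)%N.
  by rewrite absz_gt0; apply: contra_neq v0 => m0; rewrite e1 m0 expr0n mulr0.
have m20 : (0 < absz m2)%N.
  by rewrite absz_gt0; apply: contra_neq g0 => m0; rewrite e2 m0 expr0n mulr0.
set d := absz m2 in m20; set d' := absz m1 in m10.
have dv : (d'%:Z ^+ 2 %| v)%Z by rewrite -sq e1 dvdz_mull.
have dg : (d%:Z ^+ 2 %| g)%Z by rewrite -sq e2 dvdz_mull.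
have cvd : coprimez v (d%:Z ^+ 2) by apply: coprimez_dvdr cvg.
have [[x y] /= exy] := coprimezP _ _ cvd.
pose r := ((u * x) %% d%:Z ^+ 2)%Z.
have D0 : 0 < d%:Z ^+ 2 by rewrite exprn_gt0.
have r0 : 0 <= r by rewrite modz_ge0 ?gt_eqF.
have rd : (absz r < d ^ 2)%N.
  by rewrite -ltz_nat gez0_abs // (lt_le_trans (ltz_pmod _ D0)) // -!natz natrX.
pose al : 'I_(d ^ 2) := Ordinal rd.
have alr : al%:Z = r by rewrite /= gez0_abs.
have hu : (d%:Z ^+ 2 %| u - al%:Z * v)%Z.
  rewrite alr /r; have := divz_eq (u * x) (d%:Z ^+ 2).
  set q := (_ %/ _)%Z => e.
  have -> : (u * x %% d%:Z ^+ 2)%Z = u * x - q * d%:Z ^+ 2 by rewrite [X in _ = X - _]e; ring.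
  have -> : u - (u * x - q * d%:Z ^+ 2) * v = u * (x * v + y * d%:Z ^+ 2)
     - (u * x - q * d%:Z ^+ 2) * v by rewrite exy mulr1.
  by apply/dvdzP; exists (u * y + q * v); ring.
exists (s1 * s2), d, d', al; split.
- apply: squarefreeM => //; apply: coprimez_dvd cvg.
    by rewrite e1 dvdz_mulr.
  by rewrite e2 dvdz_mulr.
- have -> : v * g = (s1 * m1 ^+ 2) * (s2 * m2 ^+ 2) by rewrite -e1 -e2.
  rewrite (sq m1) (sq m2) -/d -/d' PoszM; move: d%:Z d'%:Z => x1 x2.
  by rewrite exprMn mulrACA [x2 ^+ 2 * _]mulrC.
- by [].
- rewrite coprime_sym -[coprime d' d]/(coprimez d'%:Z d%:Z).
  by apply: coprimez_dvd cvg; [apply: dvdz_trans dv|apply: dvdz_trans dg]; apply: dvdz_exp.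
- split; last by apply/latticeP.
  rewrite inE /cubic !hornerE; set A := al%:Z in hu *.
  have : (d%:Z ^+ 2 %| (A ^+ 3 + a * A ^+ 2 + b * A + c) * v ^+ 3)%Z.
    have -> : (A ^+ 3 + a * A ^+ 2 + b * A + c) * v ^+ 3 = g + (u - A * v) *
      - (u ^+ 2 + u * (A * v) + (A * v) ^+ 2 + a * v * (u + A * v) + b * v ^+ 2).
      by rewrite /g; ring.
    by apply: dvdz_add => //; apply: dvdz_mulr.
  have cdv : coprimez (d%:Z ^+ 2) (v ^+ 3) by rewrite coprimez_sym; apply: coprimezXl.
  by rewrite Gauss_dvdzl // [a * A ^+ 2]mulrA.
Qed.

(** * Pairs that are shortest vectors, and their terms in Q_E *)

Section ShortPairs.
Variables (R : realType) (a b c : int).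
Variable omega : forall d d' : nat, 'I_(d ^ 2) -> int * int.
Hypothesis homega : shortest_vector_choice R a b c omega.

(** The determinant of two lattice vectors is divisible by the index (d d')^2. For p and a shortest
    vector its absolute value is at most |p|^2 < (d d')^2, so it vanishes. Hence omega = n p because
    p is primitive, and n = 1 or n = -1 by minimality. *)
Lemma primitive_shortest (d d' : nat) (al : 'I_(d ^ 2)) p :
  coprimez p.1 p.2 -> p.2 != 0 ->
  (0 < d)%N -> (0 < d')%N -> coprime d d' -> al \in Omega a b c d ->
  lattice d' al p -> p.1 ^+ 2 + p.2 ^+ 2 < (d * d')%N%:Z ^+ 2 ->
  omega d' al = p \/ omega d' al = (- p.1, - p.2).
Proof.
move=> cp v0 d0 d'0 cdd hal hl hlt.
have [wl w0 wmin] := homega d0 d'0 hal.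
have p0 : p != (0, 0) by apply: contra_neq v0 => ->.
have := wmin p hl p0; case: (omega d' al) wl w0 => x y /latticeP[/= h1 h2] w0.
rewrite /enorm /= ler_sqrt; last by rewrite addr_ge0 ?sqr_ge0.
have -> : x%:~R ^+ 2 + y%:~R ^+ 2 = (x ^+ 2 + y ^+ 2)%:~R :> R by ring.
have -> : p.1%:~R ^+ 2 + p.2%:~R ^+ 2 = (p.1 ^+ 2 + p.2 ^+ 2)%:~R :> R by ring.
rewrite ler_int => hle.
case/latticeP: hl => h1' h2'.
move: p cp v0 hlt hle h1' h2' {p0 wmin} => [u v] /= cp v0 hlt hle h1' h2'.
have hdet : (((d * d')%N%:Z) ^+ 2 %| u * y - v * x)%Z.
  rewrite PoszM exprMn Gauss_dvdz; last first.
    by apply: coprimezXl; apply: coprimezXr.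
  apply/andP; split.
    have -> : u * y - v * x = (u - al%:Z * v) * y + (x - al%:Z * y) * - v by ring.
    by apply: dvdz_add; apply: dvdz_mulr.
  apply: dvdz_add; first exact: dvdz_mull.
  by rewrite -mulNr mulrC dvdz_mull // dvdzE abszN.
have det0 : u * y = v * x.
  apply/eqP; rewrite -subr_eq0; apply: contraT => n0.
  have h : ((d * d')%N%:Z) ^+ 2 <= `|u * y - v * x|.
    have : (absz (((d * d')%N%:Z) ^+ 2)%R <= absz (u * y - v * x)%R)%N.
      by rewrite dvdn_leq ?absz_gt0 // -dvdzE.
    by rewrite -lez_nat !abszE ger0_norm // exprn_ge0.
  have hs : `|u * y - v * x| ^+ 2 <= (u ^+ 2 + v ^+ 2) ^+ 2.
    rewrite real_normK ?num_real //.
    apply: le_trans (_ : (u ^+ 2 + v ^+ 2) * (x ^+ 2 + y ^+ 2) <= _).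
      rewrite -subr_ge0 (_ : _ - _ = (u * x + v * y) ^+ 2) ?sqr_ge0 //; ring.
    by rewrite [leRHS]expr2 ler_wpM2l // addr_ge0 ?sqr_ge0.
  have h3 : `|u * y - v * x| <= u ^+ 2 + v ^+ 2.
    by rewrite -(@ler_pXn2r _ 2) // nnegrE // addr_ge0 ?sqr_ge0.
  by have := le_lt_trans (le_trans h h3) hlt; rewrite ltxx.
have /dvdzP[n en] : (v %| y)%Z.
  by rewrite -(@Gauss_dvdzr _ u) ?det0 ?dvdz_mulr // coprimez_sym.
have ex : x = n * u.
  by apply: (mulfI v0); rewrite -det0 en; ring.
have n1 : n ^+ 2 = 1.
  have n0 : n != 0 by apply: contra_neq w0 => n0; rewrite ex en n0 !mul0r.
  have N0 : 0 < u ^+ 2 + v ^+ 2 by rewrite ltr_wpDl ?sqr_ge0 // exprn_even_gt0.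
  have : n ^+ 2 * (u ^+ 2 + v ^+ 2) <= 1 * (u ^+ 2 + v ^+ 2).
    by rewrite mul1r; apply: le_trans hle; rewrite ex en le_eqVlt; apply/orP; left; apply/eqP; ring.
  rewrite ler_pM2r // => hn; apply/eqP; rewrite eq_le hn /= -gtz0_ge1.
  by rewrite exprn_even_gt0.
have : (n == 1) || (n == - 1) by rewrite -sqrf_eq1 n1.
by case/orP => /eqP en1; [left|right]; rewrite ex en en1 ?mul1r ?mulN1r.
Qed.
End ShortPairs.

(** The last condition keeps (u : v) away from the zeros of F. The sign of v selects one of two
    opposite pairs, since [omega] may return either. *)
Definition admissible (a b c D : int) (N : nat) (p : int * int) : Prop :=
  [/\ coprimez p.1 p.2, 0 < p.2, quartic a b c p != 0,
      exists w : rat, (quartic a b c p)%:~R = D%:~R * w ^+ 2 &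
      maxnorm p ^+ 4 <= N%:Z * `|quartic a b c p|].

Definition pairheight (R : realType) (p : int * int) : R :=
  Num.max 1 (ln (maxnorm p)%:~R).

Lemma quartic_opp (a b c : int) p : quartic a b c (- p.1, - p.2) = quartic a b c p.
Proof. by case: p => u v /=; ring. Qed.

Lemma enorm_opp (R : realType) p : enorm R (- p.1, - p.2) = enorm R p.
Proof. by rewrite /enorm /= !mulrNz !sqrrN. Qed.

Section QLower.
Variables (R : realType) (a b c : int).
Variable omega : forall d d' : nat, 'I_(d ^ 2) -> int * int.
Hypothesis homega : shortest_vector_choice R a b c omega.

Lemma admissible_code (D : int) (N : nat) p : D != 0 -> admissible a b c D N p ->
  2 * N%:Z * `|D| < maxnorm p ->
  exists d d', exists al : 'I_(d ^ 2),
   [/\ (0 < d)%N /\ (0 < d')%N, coprime d d', al \in Omega a b c d,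
       omega d' al = p \/ omega d' al = (- p.1, - p.2) &
       maxnorm p ^+ 4 <= N%:Z * `|D| * (d * d')%N%:Z ^+ 2 /\
       (d * d')%N%:Z ^+ 2 <= `|quartic a b c p|].
Proof.
move=> D0 [cp v0 q0 [w ew] hN] hH.
have [s [d [d' [al [hs eq [d0 d'0] cdd [hal hl]]]]]] := lattice_of_pair cp q0.
exists d, d', al; set t := (d * d')%N in eq *.
have t0 : (0 < t)%N by rewrite muln_gt0 d0.
have tq0 : t%:Z%:~R != 0 :> rat by rewrite intr_eq0 -lt0n.
have s0 := squarefree_neq0 hs.
(* D and s differ by the square of a rational number, which is an integer because s is squarefree; D
   itself need not be squarefree. *)
have sD : `|s| <= `|D|.
  have w0 : w != 0.
    by apply: contra_neq q0 => w0; apply/eqP; rewrite -(intr_eq0 rat) ew w0 expr0n mulr0.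
  have e : D%:~R = s%:~R * (t%:Z%:~R / w) ^+ 2 :> rat.
    have : D%:~R * w ^+ 2 = s%:~R * t%:Z%:~R ^+ 2 by rewrite -ew eq rmorphM rmorphXn.
    rewrite expr_div_n => e; rewrite mulrA -e mulfK // expf_neq0 //.
  have [m em] := squarefree_square_quotient hs e.
  have e2 : D = s * m ^+ 2.
    by apply/eqP; rewrite -(eqr_int rat) e em rmorphM rmorphXn.
  have m0 : m != 0 by apply: contra_neq D0 => m0; rewrite e2 m0 expr0n mulr0.
  rewrite e2 normrM ler_peMr // normrX -gtz0_ge1.
  by rewrite exprn_gt0 // normr_gt0.
have tF : t%:Z ^+ 2 <= `|quartic a b c p|.
  by rewrite eq normrM normrX ler_peMl ?exprn_ge0 // -gtz0_ge1 normr_gt0.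
have hHt : maxnorm p ^+ 4 <= N%:Z * `|D| * t%:Z ^+ 2.
  apply: le_trans hN _; rewrite -mulrA ler_wpM2l // eq normrM normrX.
  by rewrite (@ger0_norm _ t%:Z) // ler_wpM2r ?exprn_ge0.
split=> //; apply: (primitive_shortest homega) => //; first by rewrite gt_eqF.
have H0 : 0 < maxnorm p by apply: maxnorm_coprime_gt0.
have h2 : p.1 ^+ 2 + p.2 ^+ 2 <= 2 * maxnorm p ^+ 2.
  have sq (x : int) : `|x| <= maxnorm p -> x ^+ 2 <= maxnorm p ^+ 2.
    by move=> h; rewrite -real_normK ?num_real // lerXn2r ?nnegrE ?(ltW H0).
  by rewrite mulr_natl mulr2n lerD // sq ?norm1_maxnorm ?norm2_maxnorm.
apply: le_lt_trans h2 _.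
(* With H = [maxnorm p], t^2 <= 2 H^2 would give H^4 <= N |D| t^2 <= 2 N |D| H^2, against H > 2 N
   |D|. *)
rewrite ltNge; apply/negP => h.
have : maxnorm p ^+ 2 * maxnorm p ^+ 2 <= (2 * N%:Z * `|D|) * maxnorm p ^+ 2.
  rewrite -exprD; apply: le_trans hHt _.
  rewrite (_ : 2 * _ * _ * _ = N%:Z * `|D| * (2 * maxnorm p ^+ 2)); last by ring.
  by rewrite ler_wpM2l // mulr_ge0.
rewrite ler_pM2r ?exprn_gt0 // => h3.
have : maxnorm p <= maxnorm p ^+ 2 by rewrite ler_eXnr // -gtz0_ge1.
by move=> h4; have := lt_le_trans hH (le_trans h4 h3); rewrite ltxx.
Qed.

(** Since |p|^4 <= 4 N |D| t^2 for t = d d', the factors with exponent k leave at least [A ^ -k];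
    and t <= |F| <= K H^4, with H the maximum norm, bounds log t by a multiple of the height. *)
Lemma Q_term_ge (D : int) (N : nat) (j k : R) : D != 0 -> (0 < N)%N -> 0 < j -> 1 <= k ->
  exists2 C : R, 0 < C & forall p (d d' : nat) (al : 'I_(d ^ 2)),
    (0 < d)%N -> (0 < d')%N -> admissible a b c D N p ->
    omega d' al = p \/ omega d' al = (- p.1, - p.2) ->
    maxnorm p ^+ 4 <= N%:Z * `|D| * (d * d')%N%:Z ^+ 2 ->
    (d * d')%N%:Z ^+ 2 <= `|quartic a b c p| ->
  C * pairheight R p `^ (- j) <= Q_term omega j k d' al.
Proof.
move=> D0 N0 j0 k1; have k0 : 0 < k by lra.
pose A : R := (4 * (N%:Z * `|D|))%:~R.
pose K : R := (`|c| + `|b| + `|a| + `|1|)%:~R.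
have K1 : 1 <= K by rewrite ler1z normr1 lerDr !addr_ge0.
have lK : 0 <= ln K by rewrite ln_ge0.
have A0 : 0 < A by rewrite ltr0z mulr_gt0 // mulr_gt0 // normr_gt0.
exists (A `^ (- k) * (ln K + 4) `^ (- j)).
  by rewrite mulr_gt0 ?powR_gt0 // ltr_wpDl.
move=> p d d' al d0 d'0 [cp v0 q0 _ _] ho h4 ht; rewrite /Q_term.
set t := (d * d')%N in h4 ht *.
have -> : enorm R (omega d' al) = enorm R p by case: ho => ->; rewrite ?enorm_opp.
have t0 : (0 < t)%N by rewrite muln_gt0 d0.
have tR : 0 < t%:R :> R by rewrite ltr0n.
have m0 := maxnorm_coprime_gt0 cp.
have mR : 0 < (maxnorm p)%:~R :> R by rewrite ltr0z.
have m1 : 1 <= maxnorm p by rewrite -gtz0_ge1.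
have h1 : 1 <= pairheight R p by rewrite le_max lexx.
have lm : 0 <= ln (maxnorm p)%:~R :> R by rewrite ln_ge0 // ler1z.
have lt : ln t%:R <= ln K + 4 * ln (maxnorm p)%:~R :> R.
  have hh : (t%:R : R) <= K * (maxnorm p)%:~R ^+ 4.
    apply: (@le_trans _ _ (t%:Z ^+ 2)%:~R).
      rewrite rmorphXn /= -[leLHS]expr1 ler_weXn2l // ler1n //.
    apply: le_trans (_ : (`|quartic a b c p|)%:~R <= _); first by rewrite ler_int.
    by rewrite /K -rmorphXn -intrM ler_int quartic_le.
  have K0 : 0 < K by lra.
  rewrite mulr_natl -(@lnXn _ 4) // -lnM ?posrE ?exprn_gt0 //.
  by rewrite ler_ln ?posrE ?mulr_gt0 ?exprn_gt0.
have hL : Num.max 1 (ln t%:R) <= (ln K + 4) * pairheight R p :> R.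
  have h2 : ln (maxnorm p)%:~R <= pairheight R p by rewrite le_max lexx orbT.
  rewrite ge_max; apply/andP; split.
    by move: (pairheight R p) (ln K) h1 lK => x y *; nra.
  apply: le_trans lt _.
  by move: (pairheight R p) (ln K) (ln _) h1 lK lm h2 => x y z *; nra.
have e0 : 0 < enorm R p by rewrite enorm_gt0 // gt_eqF.
have L0 : 0 < Num.max 1 (ln t%:R) :> R by rewrite lt_max ltr01.
have g1 : A `^ (- k) <= t%:R `^ (2 * k) * enorm R p `^ (- (4 * k)).
  have -> : enorm R p `^ (- (4 * k)) = (enorm R p ^+ 4) `^ (- k).
    by rewrite -(powR_mulrn 4 (ltW e0)) -powRrM mulrN.
  have -> : t%:R `^ (2 * k) = (t%:R ^+ 2) `^ k :> R.
    by rewrite -(powR_mulrn 2 (ltW tR)) -powRrM.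
  have T0 : 0 < t%:R ^+ 2 :> R by rewrite exprn_gt0.
  have Tk : (t%:R ^+ 2) `^ k != 0 :> R by rewrite gt_eqF // powR_gt0.
  rewrite -[leLHS](mulVKf Tk) -powRN.
  rewrite ler_wpM2l ?powR_ge0 // -powRM ?(ltW T0) ?(ltW A0) //.
  apply: ler_powRN; rewrite ?(ltW k0) ?exprn_gt0 //.
  rewrite (_ : enorm R p ^+ 4 = ((p.1 ^+ 2 + p.2 ^+ 2) ^+ 2)%:~R); last first.
    rewrite -[4%N]/(2 * 2)%N exprM sqr_sqrtr ?addr_ge0 ?sqr_ge0 //; ring.
  have -> : t%:R ^+ 2 * A = (t%:Z ^+ 2 * (4 * (N%:Z * `|D|)))%:~R.
    by rewrite intrM rmorphXn.
  rewrite ler_int.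
  have -> : t%:Z ^+ 2 * (4 * (N%:Z * `|D|)) = 4 * (N%:Z * `|D| * t%:Z ^+ 2) by ring.
  apply: le_trans (_ : 4 * maxnorm p ^+ 4 <= _); last by rewrite ler_wpM2l.
  have sq (x : int) : `|x| <= maxnorm p -> x ^+ 2 <= maxnorm p ^+ 2.
    by move=> h; rewrite -real_normK ?num_real // lerXn2r ?nnegrE ?(ltW m0).
  have h2 : p.1 ^+ 2 + p.2 ^+ 2 <= 2 * maxnorm p ^+ 2.
    by rewrite mulr_natl mulr2n lerD // sq ?norm1_maxnorm ?norm2_maxnorm.
  have -> : 4 * maxnorm p ^+ 4 = (2 * maxnorm p ^+ 2) ^+ 2 by ring.
  have h3 : 0 <= p.1 ^+ 2 + p.2 ^+ 2 by rewrite addr_ge0 ?sqr_ge0.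
  have h5 : 0 <= 2 * maxnorm p ^+ 2 by rewrite mulr_ge0 ?sqr_ge0.
  by rewrite lerXn2r.
have g2 : (ln K + 4) `^ (- j) * pairheight R p `^ (- j) <= Num.max 1 (ln t%:R) `^ (- j).
  rewrite -powRM; [|lra|lra]; apply: ler_powRN; rewrite ?(ltW j0) //.
rewrite -mulrA [leRHS]mulrAC -[(Num.max _ _ `^ j)^-1]powRN.
apply: ler_pM g1 g2; first exact: powR_ge0.
by rewrite mulr_ge0 ?powR_ge0.
Qed.

Lemma admissible_sum_bounded (D : int) (N : nat) (j k : R) :
  D != 0 -> (0 < N)%N -> 0 < j -> 1 <= k -> (Q_E a b c omega j k < +oo)%E ->
  exists B : R, forall s : seq (int * int), uniq s ->
    (forall p, p \in s -> admissible a b c D N p /\ 2 * N%:Z * `|D| < maxnorm p) ->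
    \sum_(p <- s) pairheight R p `^ (- j) <= B.
Proof.
move=> D0 N0 j0 k1 hQ; have [C C0 hC] := Q_term_ge D0 N0 j0 k1.
have Qt0 d d' (al : 'I_(d ^ 2)) : 0 <= Q_term omega j k d' al.
  by rewrite /Q_term !mulr_ge0 ?invr_ge0 ?powR_ge0.
have [|B hB] := esum_lt_bounded _ hQ.
  by move=> e _; rewrite mulr_ge0 ?divr_ge0 ?powR_ge0 // sumr_ge0 // => al _; rewrite powR_ge0.
exists (C^-1 * B) => s us hs.
pose T := {e : nat * nat & 'I_(e.1 ^ 2)}.
pose code_of (p : int * int) (x : T) := [/\ (0 < (tag x).1)%N /\ (0 < (tag x).2)%N,
  coprime (tag x).1 (tag x).2, tagged x \in Omega a b c (tag x).1,
  omega (tag x).2 (tagged x) = p \/ omega (tag x).2 (tagged x) = (- p.1, - p.2) &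
  C * pairheight R p `^ (- j) <= Q_term omega j k (tag x).2 (tagged x)].
have [code hcode] : exists code : int * int -> T, forall p, p \in s -> code_of p (code p).
  have x0 : T by exists (1%N, 1%N); exact: (Ordinal (ltnSn 0)).
  pose code p := xget x0 [set x : T | code_of p x].
  exists code => p /hs[hp hH]; have [d [d' [al [[d0 d'0] cdd hal ho [h4 ht]]]]] :=
    admissible_code D0 hp hH.
  rewrite /code; case: xgetP => [x _ //|/(_ (existT _ (d, d') al))]; case.
  by split=> //=; apply: hC.
(* The code determines p up to sign, and the positive second coordinate fixes the sign. *)
have ucode : uniq [seq code p | p <- s].
  rewrite map_inj_in_uniq // => p q ps qs e.
  have [_ _ _ hp _] := hcode _ ps; have [_ _ _ hq _] := hcode _ qs.
  rewrite -e in hq.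
  have [[_ p0 _ _ _] _] := hs _ ps; have [[_ q0 _ _ _] _] := hs _ qs.
  case: p q p0 q0 hp hq {ps qs e} => [u v] [u' v'] /= v0 v'0 [->|->] [[]|[]] => *;
    congr pair; lia.
rewrite ler_pdivlMl // mulr_sumr.
pose G (x : T) := Q_term omega j k (tag x).2 (tagged x).
apply: le_trans (_ : \sum_(x <- [seq code p | p <- s]) G x <= _).
  rewrite big_map big_seq [leRHS]big_seq; apply: ler_sum => p ps.
  by have [] := hcode _ ps.
have mcode x : x \in [seq code p | p <- s] -> [/\ (0 < (tag x).1)%N /\ (0 < (tag x).2)%N,
    coprime (tag x).1 (tag x).2, tagged x \in Omega a b c (tag x).1 &
    Psi a b c (omega (tag x).2 (tagged x))].
  case/mapP => p ps ->; have [h1 h2 h3 h4 _] := hcode _ ps; split=> //.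
  have [[cp _ q0 _ _] _] := hs _ ps; case: h4 => ->; split=> //.
    by rewrite /= /coprimez gcdzN gcdNz.
  by rewrite quartic_opp.
move: [seq code p | p <- s] ucode mcode => l ul hl.
have hU x : x \in l -> tag x \in undup [seq tag x | x <- l].
  by move=> xl; rewrite mem_undup map_f.
rewrite (sum_fiber G (undup_uniq _) hU).
apply: le_trans (hB (undup [seq tag x | x <- l]) (undup_uniq _) _); last first.
  by move=> e; rewrite mem_undup => /mapP[x /hl[[? ?] ? _ _] ->].
rewrite big_seq [leRHS]big_seq; apply: ler_sum => e _.
pose tg (al : 'I_(e.1 ^ 2)) : T := Tagged (fun e : nat * nat => 'I_(e.1 ^ 2)) al.
have pe : perm_eq [seq x <- l | tag x == e]
    [seq tg al | al <- enum 'I_(e.1 ^ 2) & tg al \in l].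
  apply: uniq_perm; rewrite ?filter_uniq //.
    rewrite map_inj_uniq => [|x y /eqP]; first by apply: filter_uniq; apply: enum_uniq.
    by rewrite -tag_eqE /tag_eq eqxx /= tagged_asE => /eqP.
  move=> x; rewrite mem_filter; apply/andP/mapP => [[/eqP ex xl]|[al]].
    case: x ex xl => e' al /= ee; subst e'; exists al => //.
    by rewrite mem_filter mem_enum andbT.
  by rewrite mem_filter => /andP[h _] ->.
rewrite -big_filter (perm_big _ pe) big_map big_filter big_enum_cond /= mulr_sumr.
rewrite big_mkcond [leRHS]big_mkcond; apply: ler_sum => al _.
case: ifP => [/hl[_ _ /= h1 h2]|_].
  by rewrite h1 /= asboolT.
by case: ifP => // _; apply: Qt0.
Qed.
End QLower.

(** * Many admissible pairs on a twist of large rank *)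

Section ManyPoints.
Variables (R : realType) (a b c : int).
Hypothesis hd : discr a b c != 0.
Variables (D : int) (hD : D != 0).
Let E := twistE hd hD.

Lemma admissible_coords (N : nat) (X : point E) :
  maxnorm (coords (val X)) ^+ 4 <= N%:Z * `|quartic a b c (coords (val X))| ->
  admissible a b c D N (coords (val X)).
Proof.
move=> hN; have m1 := maxnorm_coprime_gt0 (coords_coprime (val X)).
have q0 : quartic a b c (coords (val X)) != 0.
  by apply: contraTneq hN => ->; rewrite normr0 mulr0 -ltNge exprn_gt0.
split => //; first exact: coords_coprime.
  by case: (val X) q0 => [[x y] _|/=]; rewrite ?denq_gt0 // mul0r eqxx.
case e : (val X) q0 (valP X) => [[x y]|] /=; last by rewrite mul0r eqxx.
move=> _ on; exists (y * (denq x)%:~R ^+ 2); exact: (@quartic_coords E).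
Qed.

Lemma many_good_points (n : nat) (P : 'I_n -> point E) : independent P -> (0 < n)%N ->
  exists2 N, (0 < N)%N & exists2 A : R, 0 < A & forall M : nat, (0 < M)%N ->
  exists s : seq (int * int), [/\ uniq s, (M ^ n <= 4 * size s)%N &
    forall p, p \in s -> admissible a b c D N p /\ pairheight R p <= A * M%:R ^+ 2].
Proof.
move=> indP n0; pose i0 := Ordinal n0.
(* With W = 2 (P i0), one of 2 X and 2 X + W = 2 (X + P i0) has a bounded abscissa, so that X or X +
   P i0 gives an admissible pair. *)
have W0 : P i0 + P i0 != 0.
  apply/eqP => W0; pose m (i : 'I_n) : int := if i == i0 then 2 else 0.
  have := indP m; rewrite (bigD1 i0) //= big1 ?addr0 => [|i /negbTE h]; last first.
    by rewrite /m h mulr0z.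
  by rewrite /m eqxx => /(_ W0 i0); rewrite eqxx.
have [K K0 hK] := bounded_or_bounded W0.
have [N N0 hN] := bounded_double_quartic E K0.
exists N => //; have [C hC] := nheight_parallelogram R hd.
pose h (X : point E) := nheight R (val X).
have h_ge0 X : 0 <= h X by apply: nheight_ge0.
have h00 : h 0 = 0 by apply: nheight0.
have hpar : forall X Y : point E, `|h (X + Y) + h (X - Y) - (2 * h X + 2 * h Y)| <= C.
  exact: hC.
pose q := canonical_height h C.
have q_ge0 X : 0 <= q X by apply: (canonical_height_ge0 h_ge0 h00 hpar).
have q_par := canonical_parallelogram h00 hpar.
have q_near := canonical_height_near h00 hpar.
pose B := 2 ^+ n * \sum_(i < n) q (P i).
have B0 : 0 <= B by rewrite mulr_ge0 ?exprn_ge0 // sumr_ge0.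
pose A := 1 + `|C| + 2 * B + 2 * q (P i0).
have C0 : 0 <= `|C| by [].
have A0 : 0 < A by have := q_ge0 (P i0); rewrite /A; lra.
exists A => // M M0.
have M1 : 1 <= M%:R ^+ 2 :> R by rewrite exprn_ege1 // ler1n.
pose X (m : {ffun 'I_n -> 'I_M}) : point E := \sum_(i < n) P i *+ m i.
have Xinj : injective X.
  move=> m m' e; apply/ffunP => i; apply: val_inj.
  have := indP (fun i => (m i)%:Z - (m' i)%:Z); rewrite (_ : \sum_(i < n) _ = 0).
    by move/(_ erefl i) => /eqP; rewrite subr_eq0 => /eqP[].
  transitivity (X m - X m'); last by rewrite e subrr.
  rewrite /X -sumrB; apply: eq_bigr => l _.
  by rewrite mulrzBr !pmulrn.
have qX m : q (X m) <= B * M%:R ^+ 2.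
  apply: le_trans (quad_sum_le q_par q_ge0 _) _.
  rewrite -mulrA ler_wpM2l ?exprn_ge0 // mulr_suml; apply: ler_sum => i _.
  rewrite (quadMn q_par) mulrC ler_wpM2l // lerXn2r ?nnegrE // ler_nat ltnW //.
pose good (Y : point E) := maxnorm (coords (val Y)) ^+ 4
  <= N%:Z * `|quartic a b c (coords (val Y))|.
pose g Y := if good Y then Y else Y + P i0.
have g_good Y : good (g Y).
  rewrite /g; case: ifP => // /negP nY; apply: (hN).
  have := hK (Y + Y); case/orP => [/hN //|].
  by rewrite addrACA.
have hg m : h (g (X m)) <= A * M%:R ^+ 2.
  have h1 (Y : point E) : h Y <= q Y + `|C|.
    have := q_near Y; have := ler_norm C; rewrite -/(q Y) ler_distl => hc /andP[+ _].
    by move: hc C0; clear; move: (q Y) (h Y) `|C| => x y z *; lra.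
  have h2 : q (g (X m)) <= 2 * q (X m) + 2 * q (P i0).
    rewrite /g; case: ifP => _; last exact: quadD_le.
    have := q_ge0 (X m); have := q_ge0 (P i0); clear.
    by move: (q (X m)) (q (P i0)) => x y *; lra.
  apply: le_trans (h1 _) _.
  have e1 := ler_wpM2l C0 M1; have e2 := ler_wpM2l (q_ge0 (P i0)) M1.
  have e3 := qX m; move: h2 e1 e2 e3 M1; rewrite /A.
  clearbody B; clear B0; move: (q (g (X m))) (q (X m)) (q (P i0)) `|C| (M%:R ^+ 2) => x y z t v.
  by move=> *; lra.
pose f (m : {ffun 'I_n -> 'I_M}) :=
  (coords (val (g (X m))), (ysign (val (g (X m))), good (X m))).
have finj : injective f.
  move=> m m' [e1 e2 e3]; apply: Xinj; have := point_coords_inj e1 e2.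
  by rewrite /g e3; case: ifP => // _ /addIr.
pose L := undup [seq coords (val (g (X m))) | m : {ffun 'I_n -> 'I_M}].
exists L; split; first exact: undup_uniq.
- have -> : (M ^ n)%N = size [seq f m | m : {ffun 'I_n -> 'I_M}].
    by rewrite size_map -cardE card_ffun !card_ord.
  (* The factor 4: a pair forgets the sign of the ordinate and whether X was translated. *)
  pose S := [:: (true, true); (true, false); (false, true); (false, false)].
  have -> : (4 * size L)%N = size [seq (x, y) | x <- L, y <- S].
    by rewrite size_allpairs mulnC.
  apply: uniq_leq_size; first by rewrite map_inj_uniq ?enum_uniq.
  move=> x /mapP[m _ ->]; apply: allpairs_f.
    by rewrite mem_undup; apply: map_f; rewrite mem_enum.
  by case: (ysign _) (good _) => [] [].
- move=> p; rewrite mem_undup => /mapP[m _ ->]; split.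
    exact/admissible_coords/g_good.
  rewrite ge_max; apply/andP; split; last exact: hg.
  have A1 : 1 <= A.
    rewrite /A -!addrA lerDl; apply: addr_ge0 => //; apply: addr_ge0; exact: mulr_ge0.
  by rewrite -[leLHS]mulr1 ler_pM.
Qed.

Lemma admissible_sum_unbounded (n : nat) (P : 'I_n -> point E) (j : R) :
  independent P -> 0 < j -> 2 * j <= n%:R ->
  exists2 N, (0 < N)%N & forall (H : int) (B : R), exists s : seq (int * int),
    [/\ uniq s, forall p, p \in s -> admissible a b c D N p /\ H < maxnorm p &
        B < \sum_(p <- s) pairheight R p `^ (- j)].
Proof.
move=> indP j0 jn; have n0 : (0 < n)%N by rewrite -(ltr0n R); lra.
have [N N0 [A A0 hA]] := many_good_points indP n0.
exists N => // H B; pose eps := A `^ (- j) / 8.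
have eps0 : 0 < eps by rewrite divr_gt0 ?powR_gt0.
have [J hJ] := maxnorm_box (absz H).
have step (T : seq (int * int)) : exists s : seq (int * int),
    [/\ uniq s, forall p, p \in s -> admissible a b c D N p /\ p \notin T &
        eps <= \sum_(p <- s) pairheight R p `^ (- j)].
  (* At least M^n / 4 pairs are available and at most M / 8 <= M^n / 8 of them lie in T. The other
     M^n / 8 contribute at least (A M^2)^-j each, in total at least [eps] because n >= 2 j. *)
  pose M := (8 * (size T).+1)%N; have M0 : (0 < M)%N by [].
  have [L [uL sL hL]] := hA M M0.
  exists [seq p <- L | p \notin T]; split; first exact: filter_uniq.
    by move=> p; rewrite mem_filter => /andP[-> /hL[]].
  have sT : (size [seq p <- L | p \in T] <= size T)%N.
    apply: uniq_leq_size; first exact: filter_uniq.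
    by move=> p; rewrite mem_filter => /andP[].
  have sE : (size [seq p <- L | p \notin T] + size [seq p <- L | p \in T] = size L)%N.
    by rewrite !size_filter addnC; apply: count_predC.
  have MM : (M <= M ^ n)%N by rewrite -{1}(expn1 M) leq_pexp2l.
  have sM : (M ^ n <= 8 * size [seq p <- L | p \notin T])%N by move: MM sL sT sE; rewrite {1}/M; move: (M ^ n)%N (size L) (size T) => x y z; clear; lia.
  have MR : 1 <= M%:R :> R by rewrite ler1n.
  apply: le_trans (_ : \sum_(p <- [seq p <- L | p \notin T]) (A * M%:R ^+ 2) `^ (- j) <= _).
    rewrite big_const_seq count_predT iter_addr_0 -[leRHS]mulr_natr.
    rewrite powRM ?exprn_ge0 ?(ltW A0) // /eps -!mulrA ler_wpM2l ?powR_ge0 //.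
    rewrite -[leLHS]mulr1 ler_pdivrMl //.
    have -> : M%:R ^+ 2 = M%:R `^ 2 :> R by rewrite powR_mulrn.
    rewrite -powRrM mulrN.
    have h1 : M%:R `^ (2 * j) <= 8 * (size [seq p <- L | p \notin T])%:R :> R.
      apply: le_trans (_ : M%:R `^ n%:R <= _); first exact: ler_powR.
      by rewrite powR_mulrn // -natrX -natrM ler_nat.
    have p0 : 0 < M%:R `^ (2 * j) :> R by rewrite powR_gt0 // ltr0n.
    by rewrite mulrCA powRN mulrC ler_pdivlMr // mul1r.
  rewrite big_seq [leRHS]big_seq; apply: ler_sum => p.
  rewrite mem_filter => /andP[_ /hL[_ hp]].
  apply: ler_powRN => //; first exact: ltW.
  by apply: lt_le_trans ltr01 _; rewrite le_max lexx.
have iter_step (k : nat) : exists s : seq (int * int),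
    [/\ uniq s, forall p, p \in s -> admissible a b c D N p /\ p \notin J &
        k%:R * eps <= \sum_(p <- s) pairheight R p `^ (- j)].
  elim: k => [|k [s [us hs les]]]; first by exists [::]; rewrite mul0r big_nil; split.
  have [s' [us' hs' les']] := step (J ++ s).
  exists (s' ++ s); split; last by rewrite big_cat -addn1 natrD mulrDl mul1r addrC lerD.
    rewrite cat_uniq us us' andbT /=; apply/hasPn => p ps; apply/negP => /hs'[_].
    by rewrite mem_cat ps orbT.
  move=> p; rewrite mem_cat => /orP[/hs'[hp]|/hs //].
  by rewrite mem_cat negb_or => /andP[].
have [s [us hs les]] := iter_step (Num.truncn (B / eps)).+1.
exists s; split => //.
  move=> p /hs[hp pJ]; split=> //; rewrite ltNge; apply: contra pJ => hle; apply: hJ.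
  by apply: le_trans hle _; lia.
by apply: lt_le_trans les; rewrite -ltr_pdivrMr // truncnS_gt.
Qed.
End ManyPoints.

Lemma Q_E_infinite (R : realType) (a b c : int) (hd : discr a b c != 0)
    (omega : forall d d' : nat, 'I_(d ^ 2) -> int * int) (D : int) (hD : D != 0)
    (n : nat) (P : 'I_n -> point (twistE hd hD)) (j k : R) :
  shortest_vector_choice R a b c omega -> independent P -> 0 < j -> 2 * j <= n%:R ->
  1 <= k -> ~ (Q_E a b c omega j k < +oo)%E.
Proof.
move=> homega indP j0 jn k1 hQ.
have [N N0 hN] := admissible_sum_unbounded indP j0 jn.
have [B hB] := admissible_sum_bounded homega hD N0 j0 k1 hQ.
have [s [us hs hlt]] := hN (2 * N%:Z * `|D|) B.
by have := lt_le_trans hlt (hB s us hs); rewrite ltxx.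
Qed.

(** * Twists of rank two *)

Definition qnorm (x : rat) : int := maxnorm (numq x, denq x).

Lemma qnorm_gt0 x : 0 < qnorm x.
Proof. exact: (maxnorm_coprime_gt0 (coords_coprime (Some (x, x)))). Qed.

Lemma qnorm_scale (N M : int) : M != 0 -> exists2 k : int, k != 0 &
  N = k * numq (N%:~R / M%:~R) /\ M = k * denq (N%:~R / M%:~R).
Proof.
move=> M0; set x : rat := _ / _.
have MQ : M%:~R != 0 :> rat by rewrite intr_eq0.
have dQ : (denq x)%:~R != 0 :> rat by rewrite intr_eq0 denq_neq0.
have e : numq x * M = N * denq x.
  apply/eqP; rewrite -(eqr_int rat) !rmorphM /=.
  by rewrite numqE mulrAC /x divfK.
have cop : coprimez (denq x) (numq x) by rewrite coprimez_sym; apply: coprime_num_den.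
have /dvdzP[k ek] : (denq x %| M)%Z by rewrite -(Gauss_dvdzr _ cop) e dvdz_mull.
exists k; first by apply: contra_neq M0 => k0; rewrite ek k0 mul0r.
split=> //; apply: (mulIf (denq_neq0 x)); rewrite -e ek; ring.
Qed.

Lemma qnorm_le (N M : int) : M != 0 ->
  qnorm (N%:~R / M%:~R) <= Num.max `|N| `|M|.
Proof.
move=> M0; have [k k0 [eN eM]] := qnorm_scale N M0.
have k1 : 1 <= `|k| by rewrite -gtz0_ge1 normr_gt0.
move: (_ / _ : rat) eN eM => x -> ->.
by rewrite /qnorm /maxnorm /= ge_max !le_max !normrM !ler_peMl ?orbT.
Qed.

(** The factor cancelled in N / M divides gcd(N, M), hence K. *)
Lemma qnorm_ge (N M K : int) : M != 0 -> K != 0 -> (gcdz N M %| K)%Z ->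
  `|N| <= `|K| * qnorm (N%:~R / M%:~R).
Proof.
move=> M0 K0 hg; have [k k0 [eN eM]] := qnorm_scale N M0.
have kK : (k %| K)%Z.
  by apply: dvdz_trans hg; rewrite dvdz_gcd {1}eN eM !dvdz_mulr.
have hk : `|k| <= `|K|.
  by rewrite -!abszE lez_nat dvdn_leq ?absz_gt0 // -dvdzE.
move: (_ / _ : rat) eN => x ->.
by rewrite normrM ler_pM // (norm1_maxnorm (_, _)).
Qed.

(** Liouville's argument: a nonzero integral linear form in numerator and denominator of x is at
    least 1 in absolute value, so that a small quotient of two such forms forces a large height. *)
Lemma qnorm_ge_approx (al be ga de : int) (x eps : rat) :
  al%:~R * x + be%:~R != 0 ->
  `|al%:~R * x + be%:~R| <= eps * `|ga%:~R * x + de%:~R| ->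
  1 <= eps * ((`|ga| + `|de|) * qnorm x)%:~R.
Proof.
move=> h0 h; have d0 : 0 < (denq x)%:~R :> rat by rewrite ltr0z denq_gt0.
have e (a b : int) : (a%:~R * x + b%:~R) * (denq x)%:~R = (a * numq x + b * denq x)%:~R.
  by rewrite rmorphD !rmorphM /= mulrDl -mulrA -{1}(divq_num_den x) divfK ?gt_eqF.
have eps0 : 0 <= eps.
  have hp : 0 < eps * `|ga%:~R * x + de%:~R| by apply: lt_le_trans h; rewrite normr_gt0.
  by rewrite leNgt; apply: contraTN hp => e0; rewrite -leNgt mulr_le0_ge0 // ltW.
have h1 : 1 <= `|al * numq x + be * denq x|.
  by rewrite -gtz0_ge1 normr_gt0 -(intr_eq0 rat) -e mulf_neq0 // gt_eqF.
have h2 : `|ga * numq x + de * denq x| <= (`|ga| + `|de|) * qnorm x.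
  apply: le_trans (ler_normD _ _) _; rewrite !normrM mulrDl lerD // ler_wpM2l //.
    exact: (norm1_maxnorm (_, _)).
  exact: (norm2_maxnorm (_, _)).
apply: le_trans (_ : `|al * numq x + be * denq x|%:~R <= _); first by rewrite ler1z.
apply: le_trans (_ : eps * `|ga * numq x + de * denq x|%:~R <= _); last first.
  by rewrite ler_wpM2l // ler_int.
rewrite !intr_norm -!e !normrM mulrA ler_wpM2r //.
Qed.

(** The substitution w = 3 x + a, which makes the cubic depressed, changes heights by bounded
    factors only. *)
Lemma qnorm_affine (a : int) (x : rat) :
  qnorm (3 * x + a%:~R) <= (3 + `|a|) * qnorm x /\
  qnorm x <= (3 + `|a|) * qnorm (3 * x + a%:~R).
Proof.
have n1 x' := norm1_maxnorm (numq x', denq x'); have n2 x' := norm2_maxnorm (numq x', denq x').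
split.
  have e : 3 * x + a%:~R = (3 * numq x + a * denq x)%:~R / (denq x)%:~R.
    have d0 : (denq x)%:~R != 0 :> rat by rewrite intr_eq0 denq_neq0.
    rewrite -[x in LHS]divq_num_den; move: (numq x) (denq x) d0 => u v v0.
    by field.
  rewrite {1}e; apply: le_trans (qnorm_le _ (denq_neq0 _)) _.
  have := n1 x; have := n2 x; rewrite /= -/(qnorm x) => h2 h1.
  have a0 := normr_ge0 a; have q0 := qnorm_gt0 x.
  rewrite ge_max [(3 + _) * _]mulrDl; apply/andP; split.
    apply: le_trans (ler_normD _ _) _; rewrite !normrM lerD // ler_wpM2l //.
  have : 0 <= `|a| * qnorm x by rewrite mulr_ge0 // ltW.
  by move: h2 q0; move: (qnorm x) `|denq x| (`|a| * qnorm x); clear; lia.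
set z := 3 * x + a%:~R.
have e : x = (numq z - a * denq z)%:~R / (3 * denq z)%:~R.
  have -> : x = (z - a%:~R) / 3 by rewrite /z addrK mulrAC divff ?mul1r.
  have d0 : (denq z)%:~R != 0 :> rat by rewrite intr_eq0 denq_neq0.
  rewrite -[z in LHS]divq_num_den; move: (numq z) (denq z) d0 => u v v0.
  by field.
rewrite {1}e; apply: le_trans (qnorm_le _ _) _; first by rewrite mulf_neq0 ?denq_neq0.
have := n1 z; have := n2 z; rewrite /= -/(qnorm z) => h2 h1.
have a0 := normr_ge0 a; have q0 := qnorm_gt0 z.
rewrite ge_max [(3 + _) * _]mulrDl; apply/andP; split.
  apply: le_trans (ler_normB _ _) _; rewrite normrM.
  have : `|a| * `|denq z| <= `|a| * qnorm z by rewrite ler_wpM2l.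
  by move: h1 q0; move: (qnorm z) `|numq z| (`|a| * `|denq z|) (`|a| * qnorm z); clear; lia.
rewrite normrM; have : 0 <= `|a| * qnorm z by rewrite mulr_ge0 // ltW.
by move: h2 q0; move: (qnorm z) `|denq z| (`|a| * qnorm z); clear; lia.
Qed.

(* [x] and [y] stand for the canonical heights of two points [P] and [Q] divided
   by a large [L], and 99 / 100 for the lower bound of those of [P + Q] and
   [P - Q]; the inequality makes the Gram determinant of [P], [Q] positive. *)
Definition gram_range (R : realFieldType) (l1 u1 l2 u2 : nat) : Prop := forall x y : R,
  l1%:R - 1 / 100 <= x <= u1%:R + 1 / 100 -> l2%:R - 1 / 100 <= y <= u2%:R + 1 / 100 ->
  (x + y - 99 / 100) ^+ 2 < 4 * x * y.

Definition depressed (A B z : rat) : rat := z ^+ 3 + A * z + B.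

(** The relation of [kummer_relation] for the depressed cubic z^3 + A z + B. *)
Definition sum_relation (A B z1 z2 z : rat) : Prop :=
  z ^+ 2 * (z2 - z1) ^+ 2 - 2 * z * ((z2 * z1 + A) * (z2 + z1) + 2 * B)
  + ((z2 * z1 - A) ^+ 2 - 4 * B * (z2 + z1)) = 0.

Lemma ratio_near (F : realFieldType) (L C1 C q h lo hi : F) :
  100 * (`|C1| + C) + 1 <= L -> 0 <= C -> `|q - h| <= C ->
  lo * L - C1 <= h <= hi * L + C1 -> lo - 1 / 100 <= q / L <= hi + 1 / 100.
Proof.
have C10 := normr_ge0 C1; have := ler_norm C1; move: `|C1| C10 => x x0 hx hL C0.
have L0 : 0 < L by lra.
rewrite ler_distl ler_pdivlMr // ler_pdivrMr //.
by move=> /andP[? ?] /andP[? ?]; apply/andP; split; lra.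
Qed.

Lemma ratio_lower (F : realFieldType) (L C1 C q h : F) :
  100 * (`|C1| + C) + 1 <= L -> 0 <= C -> `|q - h| <= C ->
  L - C1 <= h -> 99 / 100 <= q / L.
Proof.
have C10 := normr_ge0 C1; have := ler_norm C1; move: `|C1| C10 => x x0 hx hL C0.
have L0 : 0 < L by lra.
by rewrite ler_distl ler_pdivlMr // => /andP[? ?] ?; lra.
Qed.

(** Since s + t = 2 p + 2 q and both s and t are at least 99 L / 100, the absolute value of s - p -
    q = (s - t) / 2 is at most p + q - 99 L / 100. *)
Lemma gram_scale (F : realFieldType) (L p q s t : F) : 0 < L ->
  s + t = 2 * p + 2 * q -> 99 / 100 <= s / L -> 99 / 100 <= t / L ->
  (p / L + q / L - 99 / 100) ^+ 2 < 4 * (p / L) * (q / L) ->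
  (s - p - q) ^+ 2 < 4 * p * q.
Proof.
move=> L0; have e (x : F) : x = (x / L) * L by rewrite divfK // gt_eqF.
rewrite (e p) (e q) (e s) (e t) !mulfK ?gt_eqF //.
move: (p / L) (q / L) (s / L) (t / L) => x y u v est hs ht hxy.
have est' : u + v = 2 * x + 2 * y.
  by apply: (mulIf (lt0r_neq0 L0)); rewrite mulrDl est; ring.
have -> : u * L - x * L - y * L = (u - x - y) * L by ring.
have -> : 4 * (x * L) * (y * L) = (4 * x * y) * L ^+ 2 by ring.
rewrite exprMn ltr_pM2r ?exprn_gt0 //; apply: le_lt_trans hxy.
rewrite -subr_ge0 (_ : _ - _ = (2 * x + 2 * y - u - 99 / 100) * (u - 99 / 100)).
  by apply: mulr_ge0; lra.
by ring.
Qed.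

Section RankTwo.
Variables (R : realType) (a b c : int).
Hypothesis hd : discr a b c != 0.
Variables l1 u1 l2 u2 : nat.
Hypothesis range : gram_range R l1 u1 l2 u2.

Lemma independent_pair (C1 : R) : exists K : R, forall L, K <= L ->
  forall D (hD : D != 0) (P Q : point (twistE hd hD)),
  l1%:R * L - C1 <= nheight R (val P) <= u1%:R * L + C1 ->
  l2%:R * L - C1 <= nheight R (val Q) <= u2%:R * L + C1 ->
  L - C1 <= nheight R (val (P + Q)) -> L - C1 <= nheight R (val (P - Q)) ->
  forall m n, P *~ m + Q *~ n = 0 -> m = 0 /\ n = 0.
Proof.
have [C hC] := nheight_parallelogram R hd.
exists (100 * (`|C1| + `|C|) + 1) => L hL D hD P Q hP hQ hPQ hPQ'.
pose h (X : point (twistE hd hD)) := nheight R (val X).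
have h00 : h 0 = 0 by apply: nheight0.
have hpar : forall X Y, `|h (X + Y) + h (X - Y) - (2 * h X + 2 * h Y)| <= C.
  exact: hC.
pose q := canonical_height h C.
have q_par := canonical_parallelogram h00 hpar.
have C0 := normr_ge0 C.
have q_near X : `|q X - h X| <= `|C|.
  apply: le_trans (canonical_height_near h00 hpar X) _.
  rewrite ler_pdivrMr //; apply: le_trans (ler_norm C) _.
  by apply: ler_peMr => //; rewrite ler1n.
have L0 : 0 < L by apply: lt_le_trans hL; rewrite ltr_wpDl // mulr_ge0 // addr_ge0.
have near X lo hi : lo * L - C1 <= h X <= hi * L + C1 ->
    lo - 1 / 100 <= q X / L <= hi + 1 / 100.
  exact: ratio_near hL C0 (q_near X).
have lower X : L - C1 <= h X -> 99 / 100 <= q X / L by apply: ratio_lower hL C0 (q_near X).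
apply: (gram_independent q_par).
exact: (gram_scale L0 (q_par P Q) (lower _ hPQ) (lower _ hPQ')
  (range (near _ _ _ hP) (near _ _ _ hQ))).
Qed.

Let A : rat := (9 * b - 3 * a ^+ 2)%:~R.
Let B : rat := (27 * c - 9 * a * b + 2 * a ^+ 3)%:~R.

Variables z1 z2 r : nat -> rat.

(** The twist is f(x1) up to a square, so that x1 lifts to a point; f(x2) = r^2 f(x1) lifts x2 to
    the same twist. With L = log n, the exponents of n are the bounds of the two heights in units of
    L. *)
Lemma rank_two_family (K N : nat) :
  (forall n, (N <= n)%N -> [/\ depressed A B (z1 n) != 0,
     depressed A B (z2 n) = r n ^+ 2 * depressed A B (z1 n) & z1 n != z2 n]) ->
  (forall n, (N <= n)%N -> [/\ n%:Z ^+ l1 <= K%:Z * qnorm (z1 n),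
     qnorm (z1 n) <= K%:Z * n%:Z ^+ u1, n%:Z ^+ l2 <= K%:Z * qnorm (z2 n) &
     qnorm (z2 n) <= K%:Z * n%:Z ^+ u2]) ->
  (forall n z, (N <= n)%N -> sum_relation A B (z1 n) (z2 n) z -> n%:Z <= K%:Z * qnorm z) ->
  exists (D : int) (hD : D != 0) (P : 'I_2 -> point (twistE hd hD)), independent P.
Proof.
move=> hz hb hs.
pose C1 : R := ln (K%:R) + ln (3 + `|a|)%:~R.
have [K' hK'] := independent_pair C1.
pose n := maxn (maxn N 1) (Num.truncn (expR K')).+1.
have nN : (N <= n)%N by rewrite !leq_max leqnn.
have n1 : (0 < n)%N by rewrite !leq_max leqnn orbT.
have hL : K' <= ln n%:R.
  rewrite -[leLHS]expRK ler_ln ?posrE ?expR_gt0 ?ltr0n //.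
  apply: ltW; apply: lt_le_trans (truncnS_gt _) _.
  by rewrite ler_nat leq_max leqnn orbT.
have {}hK' := hK' _ hL.
have [g0 eg z12] := hz _ nN; have [b1 b2 b3 b4] := hb _ nN; have {}hs := hs _ ^~ nN.
clear hz hb; move: (z1 n) (z2 n) (r n) g0 eg z12 b1 b2 b3 b4 hs => w1 w2 s g0 eg z12 b1 b2 b3 b4 hs.
have K0 : (0 < K)%N.
  rewrite lt0n; apply: contraTneq b1 => ->; rewrite mul0r -ltNge exprn_gt0 //.
have a3 : 0 < 3 + `|a| :> int by rewrite ltr_wpDr.
have K0R : 0 < K%:R :> R by rewrite ltr0n.
have a3R : 0 < (3 + `|a|)%:~R :> R by rewrite ltr0z.
have nR : 0 < n%:R :> R by rewrite ltr0n.
have lnK : 0 <= ln K%:R :> R by rewrite ln_ge0 // ler1n.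
have lna : 0 <= ln (3 + `|a|)%:~R :> R.
  by rewrite ln_ge0 // ler1z -gtz0_ge1.
have hup (x : rat) (y : rat) (w : rat) u : w = 3 * x + a%:~R -> qnorm w <= K%:Z * n%:Z ^+ u ->
    nheight R (Some (x, y)) <= u%:R * ln n%:R + C1.
  move=> ew h; have [_] := qnorm_affine a x; rewrite -ew => h2.
  have {}h2 := le_trans h2 (ler_wpM2l (ltW a3) h).
  rewrite /C1 mulr_natl -lnXn // addrC -addrA addrCA addrC -addrA -!lnM ?posrE ?mulr_gt0 ?exprn_gt0 //.
  rewrite ler_ln ?posrE ?mulr_gt0 ?exprn_gt0 ?maxnorm_coords_gt0 //.
  rewrite (_ : _ * _ = ((3 + `|a|) * (K%:Z * n%:Z ^+ u))%:~R) ?ler_int //.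
  by rewrite !intrM rmorphXn /=; ring.
have hlow (x : rat) (y : rat) (w : rat) u : w = 3 * x + a%:~R -> n%:Z ^+ u <= K%:Z * qnorm w ->
    u%:R * ln n%:R - C1 <= nheight R (Some (x, y)).
  move=> ew h; have [+ _] := qnorm_affine a x; rewrite -ew => h2.
  have K00 : 0 <= K%:Z by [].
  have {}h2 := le_trans h (ler_wpM2l K00 h2).
  rewrite /C1 lerBlDr mulr_natl -lnXn // -!lnM ?posrE ?mulr_gt0 ?maxnorm_coords_gt0 //.
  rewrite ler_ln ?posrE ?mulr_gt0 ?exprn_gt0 ?maxnorm_coords_gt0 //.
  rewrite (_ : _ * _ = (K%:Z * ((3 + `|a|) * qnorm x))%:~R); last first.
    by rewrite !intrM; rewrite /nheight /=; ring.
  rewrite (_ : n%:R ^+ u = (n%:Z ^+ u)%:~R) ?ler_int //; first by rewrite rmorphXn.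
pose x1 := (w1 - a%:~R) / 3; pose x2 := (w2 - a%:~R) / 3.
have ew1 : w1 = 3 * x1 + a%:~R by rewrite mulrCA divff // mulr1 subrK.
have ew2 : w2 = 3 * x2 + a%:~R by rewrite mulrCA divff // mulr1 subrK.
pose f (x : rat) := x ^+ 3 + a%:~R * x ^+ 2 + b%:~R * x + c%:~R.
have ef (x w : rat) : w = 3 * x + a%:~R -> 27 * f x = depressed A B w.
  by move=> ->; rewrite /f /depressed /A /B; ring.
have f0 : f x1 != 0.
  by apply: contra_neq g0 => f0; rewrite -(ef _ _ ew1) f0 mulr0.
have ef2 : f x2 = s ^+ 2 * f x1.
  have h27 : (27 : rat) != 0 by [].
  by apply: (mulfI h27); rewrite mulrCA (ef _ _ ew1) (ef _ _ ew2).
pose D := numq (f x1) * denq (f x1).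
have D0 : D != 0 by rewrite mulf_neq0 ?numq_eq0 ?denq_neq0.
pose y1 : rat := ((denq (f x1))%:~R)^-1; pose y2 := s * y1.
have eD : D%:~R * y1 ^+ 2 = f x1.
  have d0 : (denq (f x1))%:~R != 0 :> rat by rewrite intr_eq0 denq_neq0.
  rewrite -[RHS]divq_num_den /D /y1; move: (numq _) (denq _) d0 => u v v0.
  by field.
have onP : onE (twistE hd D0) (Some (x1, y1)).
  by apply/ec_onP; rewrite /= cubicE eD.
have onQ : onE (twistE hd D0) (Some (x2, y2)).
  by apply/ec_onP; rewrite /= cubicE -/(f x2) ef2 -eD /y2; ring.
exists D, D0; pose P : point (twistE hd D0) := exist (fun P => onE (twistE hd D0) P) _ onP.
pose Q : point (twistE hd D0) := exist (fun P => onE (twistE hd D0) P) _ onQ.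
exists (fun i => if i == ord0 then P else Q) => m.
rewrite big_ord_recl big_ord1 /= => hm.
have x12 : x1 != x2.
  by apply: contra_neq z12 => e; rewrite ew1 ew2 e.
have hdiff (U V : point (twistE hd D0)) yU yV : val U = Some (x1, yU) ->
    val V = Some (x2, yV) -> ln n%:R - C1 <= nheight R (val (V - U)).
  move=> eU eV; case eW : (val (V - U)) => [[z t]|]; last first.
    have e0 : V - U = 0 by apply: val_inj.
    have : val V = val U by rewrite (subr0_eq e0).
    by rewrite eU eV => -[e _]; rewrite e eqxx in x12.
  have := kummer_relation eU eV eW; cbv zeta => rel.
  have := @hlow z t (3 * z + a%:~R) 1 erefl; rewrite mul1r; apply; rewrite expr1; apply: hs.
  (* The relation is homogeneous of weight 4, whence the factor 81 = 3^4 of the substitution w = 3 x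
     + a. *)
  rewrite /sum_relation ew1 ew2 -[RHS](mulr0 81) -rel /= /A /B.
  by clear; ring.
have hPQ : forall m n, P *~ m + Q *~ n = 0 -> m = 0 /\ n = 0.
  apply: hK'.
  - by apply/andP; split; [apply: hlow ew1 b1|apply: hup ew1 b2].
  - by apply/andP; split; [apply: hlow ew2 b3|apply: hup ew2 b4].
  - have -> : P + Q = Q - (- P) by rewrite opprK addrC.
    by apply: (hdiff (- P) Q (- y1) y2) => //; rewrite val_pointN.
  - by rewrite -(opprB Q P) val_pointN nheight_opp; apply: hdiff.
have [m0 m1] := hPQ _ _ hm.
by move=> i; case: (unliftP ord0 i) => [j ->|-> //]; rewrite (ord1 j).
Qed.
End RankTwo.

(** * Asymptotics of rational sequences *)

Definition ultimately (P : nat -> Prop) : Prop := exists N, forall n, (N <= n)%N -> P n.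

Lemma ultimately_and (P Q : nat -> Prop) :
  ultimately P -> ultimately Q -> ultimately (fun n => P n /\ Q n).
Proof.
move=> [N hN] [M hM]; exists (maxn N M) => n; rewrite geq_max => /andP[h1 h2].
by split; [apply: hN|apply: hM].
Qed.

Lemma ultimately_imp (P Q : nat -> Prop) :
  (forall n, P n -> Q n) -> ultimately P -> ultimately Q.
Proof. by move=> h [N hN]; exists N => n /hN/h. Qed.

Lemma ultimately_ge (m : nat) : ultimately (fun n => (m <= n)%N).
Proof. by exists m. Qed.

(** f(n) = l + O(1 / n), with the constant and the limit in the rational numbers. *)
Definition near (l : rat) (f : nat -> rat) : Prop :=
  exists K : rat, ultimately (fun n => `|f n - l| * n%:R <= K).

Lemma near_eq l f g : ultimately (fun n => f n = g n) -> near l f -> near l g.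
Proof.
move=> h [K hK]; exists K; apply: ultimately_imp (ultimately_and h hK).
by move=> n [<-].
Qed.

Lemma near_lim l l' f : l = l' -> near l f -> near l' f.
Proof. by move=> ->. Qed.

Lemma near_const l : near l (fun=> l).
Proof. by exists 0; exists 0%N => n _; rewrite subrr normr0 mul0r. Qed.

Lemma near_inv : near 0 (fun n => n%:R^-1).
Proof.
exists 1; exists 1%N => n n0; rewrite subr0 ger0_norm ?invr_ge0 // mulVf //.
by rewrite pnatr_eq0 -lt0n.
Qed.

Lemma near_bounded l f : near l f -> exists2 M : rat, 0 < M & ultimately (fun n => `|f n| <= M).
Proof.
move=> [K hK]; exists (`|K| + `|l| + 1); first by rewrite ltr_wpDl // addr_ge0.
apply: ultimately_imp (ultimately_and hK (ultimately_ge 1)) => n [h n1].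
have h2 : `|f n - l| <= `|K|.
  apply: le_trans (le_trans h (ler_norm K)).
  by rewrite ler_peMr // ler1n.
have := ler_normD (f n - l) l; rewrite subrK => h3.
by move: h2 h3; move: `|K| `|l| `|f n| `|f n - l| => x y z t *; lra.
Qed.

Lemma nearD l m f g : near l f -> near m g -> near (l + m) (fun n => f n + g n).
Proof.
move=> [K hK] [M hM]; exists (K + M); apply: ultimately_imp (ultimately_and hK hM) => n [h1 h2].
apply: le_trans (lerD h1 h2); rewrite -mulrDl ler_wpM2r //.
by rewrite opprD addrACA ler_normD.
Qed.

Lemma nearN l f : near l f -> near (- l) (fun n => - f n).
Proof.
by move=> [K hK]; exists K; apply: ultimately_imp hK => n; rewrite -opprD normrN.
Qed.

Lemma nearM l m f g : near l f -> near m g -> near (l * m) (fun n => f n * g n).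
Proof.
move=> hf [M hM]; have [B B0 hB] := near_bounded hf; case: hf => K hK.
exists (B * `|M| + `|m| * `|K|).
apply: ultimately_imp (ultimately_and hB (ultimately_and hK hM)) => n [h0 [h1 h2]].
have -> : f n * g n - l * m = f n * (g n - m) + m * (f n - l) by ring.
apply: le_trans (ler_wpM2r (ler0n _ _) (ler_normD _ _)) _.
rewrite mulrDl !normrM -!mulrA lerD //.
  by apply: ler_pM => //; rewrite ?mulr_ge0 // (le_trans h2) // ler_norm.
by rewrite ler_wpM2l // (le_trans h1) // ler_norm.
Qed.

Lemma nearX l f k : near l f -> near (l ^+ k) (fun n => f n ^+ k).
Proof.
move=> h; elim: k => [|k ih]; first exact: (near_const 1).
rewrite exprS; apply: near_eq (nearM h ih); exists 0%N => n _.
by rewrite exprS.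
Qed.

Lemma near_lower l f : l != 0 -> near l f -> ultimately (fun n => `|l| / 2 <= `|f n|).
Proof.
move=> l0 [K hK]; have l0' : 0 < `|l| by rewrite normr_gt0.
apply: ultimately_imp (ultimately_and hK (ultimately_ge (Num.truncn (2 * `|K| / `|l|)).+1)).
move=> n [h1 h2].
have h3 : 2 * `|K| / `|l| <= n%:R.
  by apply: ltW; apply: lt_le_trans (truncnS_gt _) _; rewrite ler_nat.
rewrite ler_pdivrMr // in h3.
have h4 : `|f n - l| * n%:R <= (`|l| / 2) * n%:R.
  apply: le_trans (le_trans h1 (ler_norm K)) _.
  by move: h3; move: `|K| `|l| (n%:R : rat) => x y z *; lra.
have n0 : 0 < n%:R :> rat by rewrite ltr0n; apply: leq_trans h2.
rewrite ler_pM2r // in h4.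
have := ler_normD (l - f n) (f n); rewrite subrK distrC => h5.
by move: h4 h5; move: `|l| `|f n| `|f n - l| => x y z *; lra.
Qed.

Lemma near_neq0 l f : l != 0 -> near l f -> ultimately (fun n => f n != 0).
Proof.
move=> l0 h; apply: ultimately_imp (near_lower l0 h) => n hn.
by rewrite -normr_gt0; apply: lt_le_trans hn; rewrite divr_gt0 ?normr_gt0.
Qed.

Lemma nearV l f : l != 0 -> near l f -> near l^-1 (fun n => (f n)^-1).
Proof.
move=> l0 h; have h1 := near_lower l0 h; have h2 := near_neq0 l0 h.
have l0' : 0 < `|l| by rewrite normr_gt0.
case: h => K hK; exists (`|K| * 2 / `|l| ^+ 2).
apply: ultimately_imp (ultimately_and hK (ultimately_and h1 h2)) => n [h3 [h4 h5]].
have -> : (f n)^-1 - l^-1 = (l - f n) * (l * f n)^-1.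
  by move: (f n) h5 => x x0; field; rewrite x0 l0.
rewrite normrM distrC normfV normrM mulrAC ler_pdivrMr ?mulr_gt0 ?normr_gt0 //.
apply: le_trans (le_trans h3 (ler_norm K)) _.
have f0 : 0 < `|f n| by rewrite normr_gt0.
have -> : `|K| * 2 / `|l| ^+ 2 * (`|l| * `|f n|) = `|K| * (`|f n| / (`|l| / 2)).
  by move: `|l| `|f n| `|K| (gt_eqF l0') => x y z x0; field; rewrite x0.
rewrite ler_peMr //.
by rewrite ler_pdivlMr ?divr_gt0 // mul1r.
Qed.

Lemma near_root (l0 l1 l2 : rat) (f0 f1 f2 : nat -> rat) : l0 != 0 -> l2 != 0 ->
  near l0 f0 -> near l1 f1 -> near l2 f2 ->
  exists2 K : rat, 0 < K & ultimately (fun n => forall x,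
    f2 n * x ^+ 2 + f1 n / n%:R * x + f0 n / n%:R ^+ 2 = 0 ->
    x != 0 /\ `|x| * n%:R <= K).
Proof.
move=> l00 l20 h0 h1 h2.
have [M1 M10 hM1] := near_bounded h1; have [M0 M00 hM0] := near_bounded h0.
have hl := near_lower l20 h2; have h00 := near_neq0 l00 h0.
pose k := `|l2| / 2; have k0 : 0 < k by rewrite divr_gt0 ?normr_gt0.
exists ((M1 + M0) / k + 1); first by rewrite addr_gt0 // divr_gt0 // addr_gt0.
apply: ultimately_imp (ultimately_and (ultimately_and hM1 hM0)
  (ultimately_and (ultimately_and hl h00) (ultimately_ge 1))).
move=> n [[b1 b0] [[b2 n00] n1]] x e.
have n0 : 0 < n%:R :> rat by rewrite ltr0n.
split.
  apply: contra_neq n00 => x0; move: e; rewrite x0 expr0n /= !mulr0 !add0r.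
  by move/eqP; rewrite mulf_eq0 invr_eq0 expf_eq0 /= (gt_eqF n0) orbF => /eqP.
rewrite leNgt; apply/negP => hx; set y := `|x| * n%:R in hx.
have ey : `|f2 n| * y ^+ 2 <= M1 * y + M0.
  have e2 : f2 n * (x * n%:R) ^+ 2 = - (f1 n * (x * n%:R) + f0 n).
    apply/eqP; rewrite -subr_eq0 opprK; apply/eqP.
    transitivity ((f2 n * x ^+ 2 + f1 n / n%:R * x + f0 n / n%:R ^+ 2) * n%:R ^+ 2).
      by move: (n%:R : rat) (gt_eqF n0) => t t0; field; rewrite t0.
    by rewrite e mul0r.
  have ynorm : `|x * n%:R| = y by rewrite normrM (@ger0_norm _ n%:R).
  rewrite -ynorm -normrX -normrM e2 normrN.
  apply: le_trans (ler_normD _ _) _; rewrite normrM lerD // ler_wpM2r //.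
have y1 : 1 < y by apply: le_lt_trans hx; rewrite lerDr ltW // divr_gt0 // addr_gt0.
have hy2 : (M1 + M0) < k * y.
  rewrite mulrC -ltr_pdivrMr //; apply: le_lt_trans hx; lra.
have b2' : k * y ^+ 2 <= `|f2 n| * y ^+ 2 by rewrite ler_wpM2r // exprn_ge0 //; lra.
have h3 : k * y ^+ 2 <= M1 * y + M0 by apply: le_trans ey.
clear -M10 M00 y1 hy2 h3.
have : M1 * y + M0 < k * y ^+ 2.
  apply: le_lt_trans (_ : (M1 + M0) * y < _).
    by rewrite mulrDl lerD2l ler_peMr // ltW.
  by rewrite expr2 mulrA ltr_pM2r //; lra.
by rewrite ltNge h3.
Qed.

(** The three ranges belong to the three families below. The upper exponents are the degrees of the
    parametrizations; the lower ones come from rational approximation or from bounded gcds. *)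
Lemma gram_range_3 (R : realFieldType) : gram_range R 1 3 1 3.
Proof.
move=> x y /andP[h1 h2] /andP[h3 h4].
have p1 : 0 <= (x - (1 - 1 / 100)) * (3 + 1 / 100 - x) by rewrite mulr_ge0 ?subr_ge0.
have p2 : 0 <= (y - (1 - 1 / 100)) * (3 + 1 / 100 - y) by rewrite mulr_ge0 ?subr_ge0.
have p3 : 0 <= (x - (1 - 1 / 100)) * (y - (1 - 1 / 100)) by rewrite mulr_ge0 ?subr_ge0.
lra.
Qed.

Lemma gram_range_4 (R : realFieldType) : gram_range R 4 4 2 4.
Proof.
move=> x y /andP[h1 h2] /andP[h3 h4].
have p1 : 0 <= (x - (4 - 1 / 100)) * (4 + 1 / 100 - x) by rewrite mulr_ge0 ?subr_ge0.
have p2 : 0 <= (y - (2 - 1 / 100)) * (4 + 1 / 100 - y) by rewrite mulr_ge0 ?subr_ge0.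
have p3 : 0 <= (x - (4 - 1 / 100)) * (y - (2 - 1 / 100)) by rewrite mulr_ge0 ?subr_ge0.
lra.
Qed.

Lemma gram_range_16 (R : realFieldType) : gram_range R 13 13 16 16.
Proof.
move=> x y /andP[h1 h2] /andP[h3 h4].
have p1 : 0 <= (x - (13 - 1 / 100)) * (13 + 1 / 100 - x) by rewrite mulr_ge0 ?subr_ge0.
have p2 : 0 <= (y - (16 - 1 / 100)) * (16 + 1 / 100 - y) by rewrite mulr_ge0 ?subr_ge0.
have p3 : 0 <= (x - (13 - 1 / 100)) * (y - (16 - 1 / 100)) by rewrite mulr_ge0 ?subr_ge0.
lra.
Qed.

Definition dominated (X Y : nat -> int) : Prop :=
  exists K : nat, ultimately (fun n => X n <= K%:Z * Y n).

Section Family.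
Variables (R : realType) (a b c : int).
Hypothesis hd : discr a b c != 0.
Variables l1 u1 l2 u2 : nat.
Hypothesis range : gram_range R l1 u1 l2 u2.
Let A : rat := (9 * b - 3 * a ^+ 2)%:~R.
Let B : rat := (27 * c - 9 * a * b + 2 * a ^+ 3)%:~R.
Variables z1 z2 r : nat -> rat.

Lemma rank_two_asymptotic :
  ultimately (fun n => [/\ depressed A B (z1 n) != 0,
     depressed A B (z2 n) = r n ^+ 2 * depressed A B (z1 n) & z1 n != z2 n]) ->
  dominated (fun n => n%:Z ^+ l1) (fun n => qnorm (z1 n)) ->
  dominated (fun n => qnorm (z1 n)) (fun n => n%:Z ^+ u1) ->
  dominated (fun n => n%:Z ^+ l2) (fun n => qnorm (z2 n)) ->
  dominated (fun n => qnorm (z2 n)) (fun n => n%:Z ^+ u2) ->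
  (exists K : nat, ultimately (fun n => forall z,
     sum_relation A B (z1 n) (z2 n) z -> n%:Z <= K%:Z * qnorm z)) ->
  exists (D : int) (hD : D != 0) (P : 'I_2 -> point (twistE hd hD)), independent P.
Proof.
move=> h0 [K1 h1] [K2 h2] [K3 h3] [K4 h4] [K5 h5].
have [N hN] := ultimately_and h0 (ultimately_and h1 (ultimately_and h2
  (ultimately_and h3 (ultimately_and h4 h5)))).
have up (K : nat) (x y : int) : 0 <= y -> x <= K%:Z * y ->
    (K <= K1 + K2 + K3 + K4 + K5)%N -> x <= (K1 + K2 + K3 + K4 + K5)%N%:Z * y.
  by move=> y0 h hK; apply: le_trans h _; rewrite ler_wpM2r // lez_nat.
apply: (@rank_two_family R a b c hd _ _ _ _ range z1 z2 r (K1 + K2 + K3 + K4 + K5) N).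
- by move=> n /hN[].
- move=> n /hN[_ [k1 [k2 [k3 [k4 _]]]]].
  split; [apply: up k1 _|apply: up k2 _|apply: up k3 _|apply: up k4 _];
  by rewrite ?exprn_ge0 ?(ltW (qnorm_gt0 _)) //; lia.
- move=> n z /hN[_ [_ [_ [_ [_ k]]]]] /k h.
  by apply: up h _; [exact: ltW (qnorm_gt0 _)|lia].
Qed.
End Family.

Lemma dominated_upper (z : nat -> rat) (N M : nat -> int) (u : nat) (l m : rat)
    (f g : nat -> rat) :
  ultimately (fun n => [/\ z n = (N n)%:~R / (M n)%:~R, M n != 0,
     (N n)%:~R = n%:R ^+ u * f n & (M n)%:~R = n%:R ^+ u * g n]) ->
  near l f -> near m g -> dominated (fun n => qnorm (z n)) (fun n => n%:Z ^+ u).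
Proof.
move=> h hf hg; have [K1 K10 h1] := near_bounded hf; have [K2 K20 h2] := near_bounded hg.
exists (Num.truncn (K1 + K2)).+1.
apply: ultimately_imp (ultimately_and h (ultimately_and h1 h2)) => n [[-> M0 eN eM] [b1 b2]].
apply: le_trans (qnorm_le _ M0) _.
have hK : K1 + K2 <= (Num.truncn (K1 + K2)).+1%:R by apply: ltW; apply: truncnS_gt.
have n0 : 0 <= n%:R ^+ u :> rat by rewrite exprn_ge0.
have bd (x : int) y : x%:~R = n%:R ^+ u * y -> `|y| <= K1 + K2 ->
    `|x| <= (Num.truncn (K1 + K2)).+1%:Z * n%:Z ^+ u.
  move=> e hy; rewrite -(ler_int rat) intr_norm e normrM (ger0_norm n0) intrM rmorphXn /=.
  by rewrite mulrC ler_wpM2r // (le_trans hy).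
rewrite ge_max (bd _ _ eN) ?(bd _ _ eM) //.
  by apply: le_trans b2 _; rewrite lerDr ltW.
by apply: le_trans b1 _; rewrite lerDl ltW.
Qed.

Lemma qnorm_ge_ratio (ga de : int) (K : rat) (d : nat) : exists K' : nat,
  forall n (al be : int) x, (0 < n)%N -> al%:~R * x + be%:~R != 0 ->
  `|al%:~R * x + be%:~R| * n%:R ^+ d <= K * `|ga%:~R * x + de%:~R| ->
  n%:Z ^+ d <= K'%:Z * qnorm x.
Proof.
pose S := `|ga| + `|de|.
exists (Num.truncn (`|K| * S%:~R)).+1 => n al be x n0 h0 h.
have nd : 0 < n%:R ^+ d :> rat by rewrite exprn_gt0 // ltr0n.
have := qnorm_ge_approx (ga := ga) (de := de) (eps := K / n%:R ^+ d) h0.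
rewrite mulrAC ler_pdivlMr // => /(_ h).
rewrite mulrAC ler_pdivlMr // mul1r intrM mulrA => h1.
have q0 := qnorm_gt0 x.
rewrite -(ler_int rat) rmorphXn intrM /=; apply: le_trans h1 _.
rewrite ler_wpM2r ?ler0z ?(ltW q0) //.
apply: le_trans (ltW (truncnS_gt _)).
by rewrite ler_wpM2r ?ler_norm // ler0z addr_ge0.
Qed.

Lemma dominated_lower (z : nat -> rat) (d : nat) (l : rat) (f : nat -> rat) :
  near l f -> ultimately (fun n => exists al be : int,
    al%:~R * z n + be%:~R != 0 /\ (al%:~R * z n + be%:~R) * n%:R ^+ d = f n) ->
  dominated (fun n => n%:Z ^+ d) (fun n => qnorm (z n)).
Proof.
move=> hf h; have [K K0 hK] := near_bounded hf.
have [K' hK'] := qnorm_ge_ratio 0 1 K d; exists K'.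
apply: ultimately_imp (ultimately_and (ultimately_and hK h) (ultimately_ge 1)).
move=> n [[b [al [be [h0 e]]]] n1]; apply: (hK' n al be) => //.
rewrite mul0r add0r normr1 mulr1; apply: le_trans b; rewrite -e normrM.
by rewrite (@ger0_norm _ (n%:R ^+ d)) // exprn_ge0.
Qed.

(** Limits by recursion on the expression. Inverses other than 1 / n must be available as
    hypotheses, because they require a nonzero limit. *)
Ltac near_tac := lazymatch goal with
  | |- near _ (fun=> ?x) => exact: near_const
  | |- near _ (fun n => n%:R^-1) => exact: near_inv
  | |- near _ (fun n => (?h n)^-1) =>
      match goal with H : near _ (fun n => (h n)^-1) |- _ => exact: H end
  | |- near _ (fun n => ?h n) => match goal with H : near _ h |- _ => exact: H end
  | |- near _ (fun n => @?f n + @?g n) => eapply (@nearD _ _ f g); near_tac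
  | |- near _ (fun n => - (@?f n)) => eapply (@nearN _ f); near_tac
  | |- near _ (fun n => @?f n * @?g n) => eapply (@nearM _ _ f g); near_tac
  | |- near _ (fun n => @?f n ^+ ?k) => eapply (@nearX _ f k); near_tac
  | |- near _ ?h => match goal with H : near _ h |- _ => exact: H end
  end.

Lemma dominated_roots (z1 z2 : nat -> rat) (A B : rat) (al be ga de : int) (K : rat) :
  ultimately (fun n => forall z, sum_relation A B (z1 n) (z2 n) z ->
     al%:~R * z + be%:~R != 0 /\
     `|al%:~R * z + be%:~R| * n%:R <= K * `|ga%:~R * z + de%:~R|) ->
  exists K' : nat, ultimately (fun n => forall z,
     sum_relation A B (z1 n) (z2 n) z -> n%:Z <= K'%:Z * qnorm z).
Proof.
move=> h; have [K' hK'] := qnorm_ge_ratio ga de K 1; exists K'.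
apply: ultimately_imp (ultimately_and h (ultimately_ge 1)) => n [hn n1] z /hn[z0 hz].
exact: hK' n al be z n1 z0 hz.
Qed.

(** * Twists of rank two when B = 0 *)

Section MiddleCase.
Variables (R : realType) (a b c : int).
Hypothesis hd : discr a b c != 0.
Let A := 9 * b - 3 * a ^+ 2.
Let B := 27 * c - 9 * a * b + 2 * a ^+ 3.
Hypotheses (B0 : B = 0) (A0 : A != 0).

Lemma rank_two_twist_B0 :
  exists (D : int) (hD : D != 0) (P : 'I_2 -> point (twistE hd hD)), independent P.
Proof.
have AQ : A%:~R != 0 :> rat by rewrite intr_eq0.
(* A curve on the surface g(z2) = r^2 g(z1) with g(z) = z^3 + A z. Here z1 is close to -8 A / n and
   z2 + 2 n to -18 A / n; these small nonzero quantities bound the heights of z1 and z2 from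
   below. *)
pose z1 (n : nat) : rat := 2 * A%:~R * (25 * A%:~R + 4 * n%:R ^+ 2) / (n%:R * (5 * A%:~R - n%:R ^+ 2)).
pose z2 (n : nat) : rat := 2 * n%:R * (4 * A%:~R + n%:R ^+ 2) / (5 * A%:~R - n%:R ^+ 2).
pose r (n : nat) : rat := n%:R ^+ 2 * (A%:~R + n%:R ^+ 2) / (A%:~R * (25 * A%:~R + n%:R ^+ 2)).
pose m' (n : nat) : rat := 5 * A%:~R * n%:R^-1 ^+ 2 + -1.
have near_m' : near (-1) m' by rewrite /m'; eapply near_lim; [|near_tac]; ring.
have near_m : near (-1) (fun n => (m' n)^-1).
  by eapply near_lim; [|eapply nearV; [|exact: near_m']].
pose p n := 2 * A%:~R * (25 * A%:~R * n%:R^-1 ^+ 2 + 4) * (m' n)^-1.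
pose q n := 2 * (4 * A%:~R * n%:R^-1 ^+ 2 + 1) * (m' n)^-1.
have near_p : near (- 8 * A%:~R) p by rewrite /p; eapply near_lim; [|near_tac]; ring.
have near_q : near (- 2) q by rewrite /q; eapply near_lim; [|near_tac]; ring.
have basic : ultimately (fun n => n%:R != 0 :> rat /\ 5 * A%:~R - n%:R ^+ 2 != 0 :> rat /\
    z1 n = p n * n%:R^-1 /\ z2 n = q n * n%:R /\ z2 n + 2 * n%:R = 18 * A%:~R * n%:R^-1 * (m' n)^-1).
  have h := near_neq0 _ near_m'.
  apply: ultimately_imp (ultimately_and (h _) (ultimately_ge 1)) => // n [m0 n1].
  have n0 : n%:R != 0 :> rat by rewrite pnatr_eq0 -lt0n.
  have e : 5 * A%:~R - n%:R ^+ 2 = n%:R ^+ 2 * m' n :> rat.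
    by rewrite /m'; move: (n%:R : rat) n0 => t t0; field.
  split=> //; split; first by rewrite e mulf_neq0 ?expf_neq0.
  rewrite /z1 /z2 /p /q e; move: (m' n) m0 e => x x0 e.
  have -> : (A%:~R : rat) = (n%:R ^+ 2 * x + n%:R ^+ 2) / 5.
    by move: e; move: (A%:~R : rat) (n%:R ^+ 2 : rat) => *; lra.
  by move: (n%:R : rat) n0 => t t0; do !split; field; rewrite ?x0 ?t0.
clearbody p q; clearbody m'.
have near_z2z1 : near (- 2) (fun n => q n + - (p n * n%:R^-1 ^+ 2)).
  by eapply near_lim; [|near_tac]; ring.
have near_25 : near 1 (fun n => 25 * A%:~R * n%:R^-1 ^+ 2 + 1).
  by eapply near_lim; [|near_tac]; ring.
have near_g : near A%:~R (fun n => (p n * n%:R^-1) ^+ 2 + A%:~R).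
  by eapply near_lim; [|near_tac]; ring.
have p0 : ultimately (fun n => p n != 0) by apply: near_neq0 near_p; rewrite mulf_neq0.
have zz0 : ultimately (fun n => q n + - (p n * n%:R^-1 ^+ 2) != 0) by apply: near_neq0 near_z2z1.
have u25 : ultimately (fun n => 25 * A%:~R * n%:R^-1 ^+ 2 + 1 != 0 :> rat) by apply: near_neq0 near_25.
have ug : ultimately (fun n => (p n * n%:R^-1) ^+ 2 + A%:~R != 0) by apply: near_neq0 near_g.
have H := @rank_two_asymptotic R a b c hd _ _ _ _ (@gram_range_3 R) z1 z2 r.
rewrite -/A -/B B0 in H. refine (H _ _ _ _ _ _); clear H.
- apply: ultimately_imp (ultimately_and basic (ultimately_and p0 (ultimately_and zz0
    (ultimately_and u25 ug)))) => n [[n0 [m0 [e1 [e2 _]]]] [p0n [zn [h25 hg]]]].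
  have h25' : 25 * A%:~R + n%:R ^+ 2 != 0 :> rat.
    rewrite (_ : _ + _ = (25 * A%:~R * n%:R^-1 ^+ 2 + 1) * n%:R ^+ 2).
      by rewrite mulf_neq0 ?expf_neq0.
    by move: (n%:R : rat) n0 => t t0; field.
  split.
  + rewrite /depressed e1 addr0 (_ : _ + _ = (p n * n%:R^-1) * ((p n * n%:R^-1) ^+ 2 + A%:~R)).
      by rewrite !mulf_neq0 ?invr_eq0.
    by ring.
  + rewrite /depressed /z1 /z2 /r; move: (n%:R : rat) (A%:~R : rat) n0 m0 AQ h25' => t x t0 m0 x0 h.
    by field; rewrite t0 m0 x0 h.
  + rewrite -subr_eq0 -oppr_eq0 opprB e1 e2.
    rewrite (_ : _ - _ = (q n + - (p n * n%:R^-1 ^+ 2)) * n%:R) ?mulf_neq0 //.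
    by move: (n%:R : rat) n0 => t t0; field.
- apply: dominated_lower near_p _.
  apply: ultimately_imp (ultimately_and basic p0) => n [[n0 [m0 [e1 _]]] p0n].
  exists 1, 0; rewrite mul1r addr0 e1 mulf_neq0 ?invr_eq0 //; split=> //.
  by rewrite expr1 divfK.
- apply: (@dominated_upper _ (fun n => 2 * A * (25 * A + 4 * n%:Z ^+ 2))
    (fun n => n%:Z * (5 * A - n%:Z ^+ 2)) _ _ _
    (fun n => 2 * A%:~R * (25 * A%:~R * n%:R^-1 ^+ 3 + 4 * n%:R^-1))
    (fun n => 5 * A%:~R * n%:R^-1 ^+ 2 + -1)); [|near_tac|near_tac].
  apply: ultimately_imp basic => n [n0 [m0 _]]; split.
  + by rewrite /z1; congr (_ / _); ring.
  + rewrite -(intr_eq0 rat) (_ : _%:~R = n%:R * (5 * A%:~R - n%:R ^+ 2)) ?mulf_neq0 //.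
    by ring.
  + transitivity (2 * A%:~R * (25 * A%:~R + 4 * n%:R ^+ 2) : rat); first by ring.
    by move: (n%:R : rat) n0 => t t0; field.
  + transitivity (n%:R * (5 * A%:~R - n%:R ^+ 2) : rat); first by ring.
    by move: (n%:R : rat) n0 => t t0; field.
- apply: (@dominated_lower _ _ _ (fun n => 18 * A%:~R * (m' n)^-1)); first by near_tac.
  apply: ultimately_imp (ultimately_and basic (near_neq0 _ near_m')) => // n.
  move=> [[n0 [m0 [_ [_ e]]]] mm0]; exists 1, (2 * n%:Z).
  rewrite mul1r (_ : (2 * n%:Z)%:~R = 2 * n%:R); last by ring.
  rewrite e !mulf_neq0 ?invr_eq0 //; split=> //.
  by rewrite expr1; move: (m' n) (n%:R : rat) mm0 n0 => x t x0 t0; field; rewrite x0 t0.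
- apply: (@dominated_upper _ (fun n => 2 * n%:Z * (4 * A + n%:Z ^+ 2))
    (fun n => (5 * A - n%:Z ^+ 2)) _ _ _
    (fun n => 2 * (4 * A%:~R * n%:R^-1 ^+ 2 + 1))
    (fun n => 5 * A%:~R * n%:R^-1 ^+ 3 + - n%:R^-1)); [|near_tac|near_tac].
  apply: ultimately_imp basic => n [n0 [m0 _]]; split.
  + by rewrite /z2; congr (_ / _); ring.
  + by rewrite -(intr_eq0 rat) (_ : _%:~R = 5 * A%:~R - n%:R ^+ 2) //; ring.
  + transitivity (2 * n%:R * (4 * A%:~R + n%:R ^+ 2) : rat); first by ring.
    by move: (n%:R : rat) n0 => t t0; field.
  + transitivity (5 * A%:~R - n%:R ^+ 2 : rat); first by ring.
    by move: (n%:R : rat) n0 => t t0; field.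
(* The abscissae of P + Q and P - Q are themselves O(1 / n). *)
- have hf0 : near (225 * A%:~R ^+ 2) (fun n => (p n * q n + - A%:~R) ^+ 2).
    by eapply near_lim; [|near_tac]; ring.
  have hf1 : near (2 * (16 * A%:~R + A%:~R) * 2)
      (fun n => - (2 * (p n * q n + A%:~R) * (q n + p n * n%:R^-1 ^+ 2))).
    by eapply near_lim; [|near_tac]; ring.
  have hf2 : near 4 (fun n => (q n + - (p n * n%:R^-1 ^+ 2)) ^+ 2).
    by eapply near_lim; [|near_tac]; ring.
  have [K K0 hK] : exists2 K : rat, 0 < K & _ :=
    near_root (mulf_neq0 (isT : 225 != 0 :> rat) (expf_neq0 2 AQ)) (isT : 4 != 0 :> rat) hf0 hf1 hf2.
  apply: (@dominated_roots _ _ _ _ 1 0 0 1 K).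
  apply: ultimately_imp (ultimately_and basic hK) => n [[n0 [m0 [e1 [e2 _]]]] h] z hz.
  rewrite mul1r addr0 mul0r add0r normr1 mulr1; apply: h.
  move: hz; rewrite /sum_relation e1 e2 => hz.
  rewrite -[RHS](mul0r (n%:R^-1 ^+ 2)) -hz.
  by move: (p n) (q n) (n%:R : rat) n0 => x y t t0; field.
Qed.
End MiddleCase.

(** * Twists of rank two when A = 0, with gcds bounded independently of n *)

Definition gcd_dvd (K x y : int) : Prop :=
  forall g : int, (g %| x)%Z -> (g %| y)%Z -> (g %| K)%Z.

Lemma gcd_dvd_bezout (u v K x y : int) : K = u * x + v * y -> gcd_dvd K x y.
Proof. by move=> -> g gx gy; apply: dvdz_add; apply: dvdz_mull. Qed.

Lemma gcd_dvd_sym K x y : gcd_dvd K x y -> gcd_dvd K y x.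
Proof. by move=> h g gy gx; apply: h. Qed.

Lemma gcd_dvdM K1 K2 x1 x2 y : gcd_dvd K1 x1 y -> gcd_dvd K2 x2 y ->
  gcd_dvd (K1 * K2) (x1 * x2) y.
Proof.
move=> h1 h2 g gx gy.
have d1 : (gcdz x1 y %| K1)%Z by apply: h1; rewrite ?dvdz_gcdl ?dvdz_gcdr.
have d2 : (gcdz x2 y %| K2)%Z by apply: h2; rewrite ?dvdz_gcdl ?dvdz_gcdr.
apply: dvdz_trans (dvdz_mul d1 d2).
have [u1 [v1 e1]] := Bezoutz x1 y; have [u2 [v2 e2]] := Bezoutz x2 y.
rewrite -e1 -e2.
have -> : (u1 * x1 + v1 * y) * (u2 * x2 + v2 * y)
  = u1 * u2 * (x1 * x2) + (u1 * x1 * v2 + v1 * (u2 * x2) + v1 * v2 * y) * y by ring.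
by apply: dvdz_add; apply: dvdz_mull.
Qed.

Lemma dominated_lower_gcd (N M : nat -> int) (z : nat -> rat) (K : int) (u : nat) (l : rat) f :
  K != 0 -> l != 0 -> near l f ->
  ultimately (fun n => [/\ z n = (N n)%:~R / (M n)%:~R, M n != 0, gcd_dvd K (N n) (M n) &
     (N n)%:~R = n%:R ^+ u * f n]) ->
  dominated (fun n => n%:Z ^+ u) (fun n => qnorm (z n)).
Proof.
move=> K0 l0 hf h; exists (Num.truncn (2 / `|l| * `|K|%:~R)).+1.
apply: ultimately_imp (ultimately_and h (near_lower l0 hf)) => n [[-> M0 hg eN] hl].
have := qnorm_ge M0 K0 (hg _ (dvdz_gcdl _ _) (dvdz_gcdr _ _)).
set q := qnorm _; have q0 : 0 < q := qnorm_gt0 _.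
have n0 : 0 <= n%:R ^+ u :> rat by rewrite exprn_ge0.
have eN' : `|N n|%:~R = n%:R ^+ u * `|f n| by rewrite intr_norm eN normrM (ger0_norm n0).
move=> hN; rewrite -(ler_int rat) eN' intrM in hN.
have l0' : 0 < `|l| by rewrite normr_gt0.
rewrite -(ler_int rat) rmorphXn intrM /=.
apply: le_trans (_ : (2 / `|l| * `|K|%:~R) * q%:~R <= _); last first.
  by rewrite ler_wpM2r ?ler0z ?(ltW q0) // ltW // truncnS_gt.
rewrite -mulrA mulrAC ler_pdivlMr // mulrC.
have := le_trans (ler_wpM2l n0 hl) hN.
by move: (n%:R ^+ u) (_ * q%:~R) `|l| => x y w *; lra.
Qed.

Section SexticTwists.
Variable B : int.
Hypothesis B0 : B != 0.

(* Numerators and denominators of a parametrization of the surface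
   (x1^3 + B) (x2^3 + B) = w^2 by the parameter s = t^3. *)
Definition num1 (s : int) : int := - (s + 2 * B) * (s - 8 * B) ^+ 3 + 64 * B * (s + B) ^+ 3.
Definition den1 (s : int) : int := (2 * s + B) * (s - 8 * B) ^+ 3 + 64 * B * (s + B) ^+ 3.
Definition num2 (s : int) : int := - (s - B) * (s - 8 * B) ^+ 3 - 128 * B * (s + B) ^+ 3.

(** The constants of this and the next two lemmas are the values of [den1] at s = 0, s = -B and s =
    8 B, to which it reduces modulo t, s + B and s - 8 B. *)
Lemma gcd_den1_t t : gcd_dvd (- 448 * B ^+ 4) t (den1 (t ^+ 3)).
Proof.
pose s := t ^+ 3.
apply: (@gcd_dvd_bezout (- (t ^+ 2) * (2 * s ^+ 3 + 17 * s ^+ 2 * B + 552 * s * B ^+ 2 - 640 * B ^+ 3)) 1).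
by rewrite /den1 /s; ring.
Qed.

Lemma gcd_den1_sB s : gcd_dvd (729 * B ^+ 4) (s + B) (den1 s).
Proof.
apply: (@gcd_dvd_bezout (- (2 * s ^+ 3 + 15 * s ^+ 2 * B + 537 * s * B ^+ 2 - 1177 * B ^+ 3)) 1).
by rewrite /den1; ring.
Qed.

Lemma gcd_den1_s8B s : gcd_dvd (6 ^+ 6 * B ^+ 4) (s - 8 * B) (den1 s).
Proof.
apply: (@gcd_dvd_bezout (- (2 * s ^+ 3 + 33 * s ^+ 2 * B + 816 * s * B ^+ 2 + 5888 * B ^+ 3)) 1).
by rewrite /den1; ring.
Qed.

(** The difference of [den1] and [num1] is 3 (s + B) (s - 8 B)^3, whose factors have been treated
    above. *)
Lemma gcd_num1_den1 s : gcd_dvd (3 * (729 * B ^+ 4) *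
  (6 ^+ 6 * B ^+ 4 * (6 ^+ 6 * B ^+ 4) * (6 ^+ 6 * B ^+ 4))) (num1 s) (den1 s).
Proof.
move=> g g1 g2.
have g3 : (g %| 3 * (s + B) * ((s - 8 * B) * (s - 8 * B) * (s - 8 * B)))%Z.
  rewrite (_ : _ * _ = den1 s + (- 1) * num1 s); last by rewrite /den1 /num1; ring.
  by apply: dvdz_add => //; apply: dvdz_mull.
apply: (gcd_dvdM _ _ g3 g2).
  by apply: gcd_dvdM; [apply: (@gcd_dvd_bezout 1 0); ring|apply: gcd_den1_sB].
by apply: gcd_dvdM; [apply: gcd_dvdM|]; apply: gcd_den1_s8B.
Qed.

(** [num1], [num2] and [den1] add up to 0. *)
Lemma gcd_num2_den1 s : gcd_dvd (3 * (729 * B ^+ 4) *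
  (6 ^+ 6 * B ^+ 4 * (6 ^+ 6 * B ^+ 4) * (6 ^+ 6 * B ^+ 4))) (num2 s) (den1 s).
Proof.
move=> g g2 g1; have g3 : (g %| num1 s)%Z.
  rewrite (_ : num1 s = (- 1) * num2 s + (- 1) * den1 s).
    by apply: dvdz_add; apply: dvdz_mull.
  by rewrite /num1 /num2 /den1; ring.
exact: gcd_num1_den1 g3 g1.
Qed.

Ltac neq0_tac := lazymatch goal with
  | |- is_true (_ * _ != 0) => apply: mulf_neq0; neq0_tac
  | |- is_true (_ ^+ _ != 0) => apply: expf_neq0; neq0_tac
  | |- is_true (?x != 0) => first [assumption | by rewrite ?oppr_eq0 pnatr_eq0]
  end.

Lemma gcd_fraction1 : exists2 K : int, K != 0 &
  forall t, gcd_dvd K (t * num1 (t ^+ 3)) (den1 (t ^+ 3)).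
Proof.
eexists; last by move=> t; apply: gcd_dvdM; [apply: gcd_den1_t|apply: gcd_num1_den1].
neq0_tac.
Qed.

Lemma gcd_fraction2 : exists2 K : int, K != 0 &
  forall t, gcd_dvd K (t * (t ^+ 3 - 8 * B) * num2 (t ^+ 3))
    (4 * (t ^+ 3 + B) * den1 (t ^+ 3)).
Proof.
have four x : gcd_dvd 4 4 x by apply: (@gcd_dvd_bezout 1 0); ring.
have step K1 K2 K3 x s : gcd_dvd K1 4 x -> gcd_dvd K2 (s + B) x -> gcd_dvd K3 (den1 s) x ->
    gcd_dvd (K1 * K2 * K3) x (4 * (s + B) * den1 s).
  by move=> *; apply: gcd_dvd_sym; apply: gcd_dvdM => //; apply: gcd_dvdM.
eexists; last first.
  move=> t; apply: gcd_dvdM; [apply: gcd_dvdM|]; apply: step; try apply: four.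
  - by apply: (@gcd_dvd_bezout 1 (- t ^+ 2) B); ring.
  - exact/gcd_dvd_sym/gcd_den1_t.
  - by apply: (@gcd_dvd_bezout 1 (- 1) (9 * B)); ring.
  - exact/gcd_dvd_sym/gcd_den1_s8B.
  - set s := t ^+ 3.
    apply: (@gcd_dvd_bezout (- (- s ^+ 3 - 102 * s ^+ 2 * B - 498 * s * B ^+ 2 + 818 * B ^+ 3)) 1
      (- 1458 * B ^+ 4)).
    by rewrite /num2; ring.
  - exact/gcd_dvd_sym/gcd_num2_den1.
neq0_tac.
Qed.
End SexticTwists.

Lemma sextic_identity (F : comNzRingType) (s B : F) :
  let X := (s - 8 * B) ^+ 3 in let Y := (s + B) ^+ 3 in
  let n1 := - (s + 2 * B) * X + 64 * B * Y in
  let d1 := (2 * s + B) * X + 64 * B * Y in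
  let n2 := - (s - B) * X - 128 * B * Y in
  (s * X * n2 ^+ 3 + 64 * B * Y * d1 ^+ 3) * (s + B) =
  (s ^+ 2 + 20 * B * s - 8 * B ^+ 2) ^+ 2 * (s * n1 ^+ 3 + B * d1 ^+ 3).
Proof. by move=> X Y n1 d1 n2; rewrite /n2 /d1 /n1 /X /Y; ring. Qed.

Lemma sextic_ratio (t s B : rat) : s = t ^+ 3 ->
  let X := (s - 8 * B) ^+ 3 in let Y := (s + B) ^+ 3 in
  let n1 := - (s + 2 * B) * X + 64 * B * Y in
  let d1 := (2 * s + B) * X + 64 * B * Y in
  let n2 := - (s - B) * X - 128 * B * Y in
  s + B != 0 -> d1 != 0 ->
  (t * (s - 8 * B) * n2 / (4 * (s + B) * d1)) ^+ 3 + B =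
  ((s ^+ 2 + 20 * B * s - 8 * B ^+ 2) / (8 * (s + B) ^+ 2)) ^+ 2
    * ((t * n1 / d1) ^+ 3 + B).
Proof.
move=> es X Y n1 d1 n2 sB0; have := sextic_identity s B; cbv zeta.
rewrite -/X -/Y -/n1 -/d1 -/n2; move: n1 d1 n2 => n1 d1 n2 id d0.
transitivity ((s * X * n2 ^+ 3 + 64 * B * Y * d1 ^+ 3) * (s + B) / (64 * (s + B) ^+ 4 * d1 ^+ 3)).
  rewrite expr_div_n !exprMn -es /X /Y; clear id es X Y.
  by move: d0 sB0 => d0 sB0; field; rewrite d0 sB0.
rewrite id; have -> : (t * n1 / d1) ^+ 3 = s * n1 ^+ 3 / d1 ^+ 3.
  by rewrite !expr_div_n exprMn -es.
by clear id es X Y; field; rewrite d0 sB0.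
Qed.

Section SexticCase.
Variables (R : realType) (a b c : int).
Hypothesis hd : discr a b c != 0.
Let A := 9 * b - 3 * a ^+ 2.
Let B := 27 * c - 9 * a * b + 2 * a ^+ 3.
Hypotheses (A0 : A = 0) (B0 : B != 0).

Lemma rank_two_twist_A0 :
  exists (D : int) (hD : D != 0) (P : 'I_2 -> point (twistE hd hD)), independent P.
Proof.
have BQ : B%:~R != 0 :> rat by rewrite intr_eq0.
pose s (n : nat) : int := n%:Z ^+ 3.
pose N1 (n : nat) : int := n%:Z * num1 B (s n).
pose M1 (n : nat) : int := den1 B (s n).
pose N2 (n : nat) : int := n%:Z * (s n - 8 * B) * num2 B (s n).
pose M2 (n : nat) : int := 4 * (s n + B) * den1 B (s n).
pose z1 (n : nat) : rat := (N1 n)%:~R / (M1 n)%:~R.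
pose z2 (n : nat) : rat := (N2 n)%:~R / (M2 n)%:~R.
pose r (n : nat) : rat := ((s n) ^+ 2 + 20 * B * s n - 8 * B ^+ 2)%:~R / (8 * (s n + B) ^+ 2)%:~R.
(* By homogeneity every polynomial in s and B is a power of n times a polynomial in [be] = B / n^3,
   which tends to 0. *)
pose be n : rat := B%:~R * n%:R^-1 ^+ 3.
have near_be : near 0 be by rewrite /be; eapply near_lim; [|near_tac]; ring.
have ebe n : (0 < n)%N -> B%:~R = be n * n%:R ^+ 3.
  move=> n0; have t0 : n%:R != 0 :> rat by rewrite pnatr_eq0 -lt0n.
  by rewrite /be -mulrA -exprMn mulVf // expr1n mulr1.
clearbody be.
pose n1 n := - (1 + 2 * be n) * (1 + - (8 * be n)) ^+ 3 + 64 * be n * (1 + be n) ^+ 3.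
pose d1 n := (2 + be n) * (1 + - (8 * be n)) ^+ 3 + 64 * be n * (1 + be n) ^+ 3.
pose n2 n := - (1 + - be n) * (1 + - (8 * be n)) ^+ 3 + - (128 * be n * (1 + be n) ^+ 3).
have near_n1 : near (- 1) n1 by rewrite /n1; eapply near_lim; [|near_tac]; ring.
have near_d1 : near 2 d1 by rewrite /d1; eapply near_lim; [|near_tac]; ring.
have near_n2 : near (- 1) n2 by rewrite /n2; eapply near_lim; [|near_tac]; ring.
have es (n : nat) : (s n)%:~R = n%:R ^+ 3 :> rat by rewrite /s rmorphXn.
have eN1 n : (0 < n)%N -> (num1 B (s n))%:~R = n%:R ^+ 12 * n1 n.
  move=> n0; transitivity (- ((s n)%:~R + 2 * B%:~R) * ((s n)%:~R - 8 * B%:~R) ^+ 3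
    + 64 * B%:~R * ((s n)%:~R + B%:~R) ^+ 3 : rat); first by rewrite /num1; ring.
  by rewrite es (ebe _ n0) /n1; ring.
have eM1 n : (0 < n)%N -> (den1 B (s n))%:~R = n%:R ^+ 12 * d1 n.
  move=> n0; transitivity ((2 * (s n)%:~R + B%:~R) * ((s n)%:~R - 8 * B%:~R) ^+ 3
    + 64 * B%:~R * ((s n)%:~R + B%:~R) ^+ 3 : rat); first by rewrite /den1; ring.
  by rewrite es (ebe _ n0) /d1; ring.
have eN2 n : (0 < n)%N -> (num2 B (s n))%:~R = n%:R ^+ 12 * n2 n.
  move=> n0; transitivity (- ((s n)%:~R - B%:~R) * ((s n)%:~R - 8 * B%:~R) ^+ 3
    - 128 * B%:~R * ((s n)%:~R + B%:~R) ^+ 3 : rat); first by rewrite /num2; ring.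
  by rewrite es (ebe _ n0) /n2; ring.
clearbody n1 d1 n2.
have near_1b : near 1 (fun n => 1 + be n) by eapply near_lim; [|near_tac]; ring.
have near_1b8 : near 1 (fun n => 1 + - (8 * be n)) by eapply near_lim; [|near_tac]; ring.
have near_d1V : near (2^-1) (fun n => (d1 n)^-1) by apply: nearV.
have near_1bV : near 1 (fun n => (1 + be n)^-1).
  by eapply near_lim; [|eapply nearV; [|exact: near_1b]].
pose p n := n1 n * (d1 n)^-1.
pose q n := 4^-1 * ((1 + - (8 * be n)) * n2 n * ((1 + be n)^-1 * (d1 n)^-1)).
have near_p : near (- 2^-1) p by rewrite /p; eapply near_lim; [|near_tac]; ring.
have near_q : near (- 8^-1) q.
  rewrite /q; eapply near_lim; last first.
    apply: nearM; first exact: near_const.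
    apply: nearM; first by apply: nearM; [exact: near_1b8|exact: near_n2].
    by apply: nearM; [exact: near_1bV|exact: near_d1V].
  by [].
have u1 := near_neq0 (isT : 2 != 0 :> rat) near_d1.
have u2 := near_neq0 (isT : 1 != 0 :> rat) near_1b.
have basic : ultimately (fun n => [/\ (0 < n)%N, M1 n != 0, M2 n != 0,
    (s n + B)%:~R != 0 :> rat & z1 n = p n * n%:R /\ z2 n = q n * n%:R]).
  apply: ultimately_imp (ultimately_and (ultimately_ge 1) (ultimately_and u1 u2)) => n [n0 [d0 b0]].
  have t0 : n%:R != 0 :> rat by rewrite pnatr_eq0 -lt0n.
  have eM : (M1 n)%:~R != 0 :> rat by rewrite /M1 eM1 // mulf_neq0 ?expf_neq0.
  have esB : (s n + B)%:~R = n%:R ^+ 3 * (1 + be n) :> rat.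
    by rewrite rmorphD /= es (ebe _ n0); ring.
  have sB0 : (s n + B)%:~R != 0 :> rat by rewrite esB mulf_neq0 ?expf_neq0.
  have eMM : (M2 n)%:~R = 4 * (s n + B)%:~R * (M1 n)%:~R :> rat by rewrite /M2 /M1; ring.
  have eM2 : (M2 n)%:~R != 0 :> rat by rewrite eMM !mulf_neq0.
  split => //; first by rewrite -(intr_eq0 rat).
    by rewrite -(intr_eq0 rat).
  split.
    have -> : z1 n = n%:R * (num1 B (s n))%:~R / (den1 B (s n))%:~R.
      by rewrite /z1 /N1 /M1; congr (_ / _); ring.
    rewrite eN1 // eM1 // /p; move: (n1 n) (d1 n) (n%:R : rat) d0 t0 => x y t y0 t0.
    by field; rewrite y0 t0.
  have -> : z2 n = n%:R * ((s n)%:~R - 8 * B%:~R) * (num2 B (s n))%:~R /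
       (4 * (s n + B)%:~R * (den1 B (s n))%:~R).
    by rewrite /z2 /N2 /M2; congr (_ / _); ring.
  rewrite esB eN2 // eM1 // es (ebe _ n0) /q.
  move: (n2 n) (d1 n) (be n) (n%:R : rat) d0 b0 t0 => x y w t y0 b0 t0.
  by field; rewrite y0 t0 b0.
clearbody p q.
have near_g : near (- 8^-1) (fun n => p n ^+ 3 + be n) by eapply near_lim; [|near_tac]; by [].
have near_z : near (- (3 / 8)) (fun n => p n + - q n) by eapply near_lim; [|near_tac]; by [].
have ug := near_neq0 (isT : - 8^-1 != 0 :> rat) near_g.
have uz := near_neq0 (isT : - (3 / 8) != 0 :> rat) near_z.
have [K1 K10 hK1] := gcd_fraction1 B0.
have [K2 K20 hK2] := gcd_fraction2 B0.
have H := @rank_two_asymptotic R a b c hd _ _ _ _ (@gram_range_16 R) z1 z2 r.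
rewrite -/A -/B A0 in H; apply: H.
- apply: ultimately_imp (ultimately_and basic (ultimately_and ug uz)).
  move=> n [[n0 M10 M20 sB0 [e1 e2]] [hg hz]].
  have t0 : n%:R != 0 :> rat by rewrite pnatr_eq0 -lt0n.
  split.
  + rewrite /depressed e1 mul0r addr0 (ebe _ n0).
    rewrite (_ : _ + _ = (p n ^+ 3 + be n) * n%:R ^+ 3); last by ring.
    by rewrite mulf_neq0 ?expf_neq0.
  + have eM : (M1 n)%:~R = (2 * (s n)%:~R + B%:~R) * ((s n)%:~R - 8 * B%:~R) ^+ 3
        + 64 * B%:~R * ((s n)%:~R + B%:~R) ^+ 3 :> rat by rewrite /M1 /den1; ring.
    have d0 := M10; rewrite -(intr_eq0 rat) eM in d0.
    have sB0' : (s n)%:~R + B%:~R != 0 :> rat by rewrite -rmorphD.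
    have := sextic_ratio (es n) sB0' d0.
    rewrite /depressed !mul0r !addr0 => h.
    have E (x1 x2 x3 y1 y2 y3 w : rat) : x1 = y1 -> x2 = y2 -> x3 = y3 ->
      x2 ^+ 3 + w = x3 ^+ 2 * (x1 ^+ 3 + w) -> y2 ^+ 3 + w = y3 ^+ 2 * (y1 ^+ 3 + w).
      by move=> -> -> ->.
    apply: E h.
    * by rewrite /z1 /N1 /M1 /num1 /den1; congr (_ / _); ring.
    * by rewrite /z2 /N2 /M2 /num2 /den1; congr (_ / _); ring.
    * by rewrite /r; congr (_ / _); ring.
  + rewrite -subr_eq0 e1 e2 (_ : _ - _ = (p n + - q n) * n%:R); last by ring.
    by rewrite mulf_neq0.
- apply: (@dominated_lower_gcd N1 M1 _ K1 _ (- 1) n1) => //.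
  apply: ultimately_imp basic => n [n0 M10 M20 sB0 [e1 e2]]; split => //.
    exact: hK1.
  by rewrite /N1 rmorphM /= eN1 // mulrA -exprS.
- apply: (@dominated_upper _ N1 M1 _ _ _ n1 (fun n => n%:R^-1 * d1 n)); [|near_tac|near_tac].
  apply: ultimately_imp basic => n [n0 M10 M20 sB0 [e1 e2]]; split => //.
    by rewrite /N1 rmorphM /= eN1 // mulrA -exprS.
  have t0 : n%:R != 0 :> rat by rewrite pnatr_eq0 -lt0n.
  by rewrite /M1 eM1 //; move: (d1 n) (n%:R : rat) t0 => x t t0; field.
- apply: (@dominated_lower_gcd N2 M2 _ K2 _ (- 1)
    (fun n => (1 + - (8 * be n)) * n2 n)) => //.
    by eapply near_lim; [|near_tac]; by [].
  apply: ultimately_imp basic => n [n0 M10 M20 sB0 [e1 e2]]; split => //.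
    exact: hK2.
  transitivity (n%:R * ((s n)%:~R - 8 * B%:~R) * (num2 B (s n))%:~R : rat).
    by rewrite /N2; ring.
  rewrite eN2 // es (ebe _ n0).
  by move: (n2 n) (be n) (n%:R : rat) => *; ring.
- apply: (@dominated_upper _ N2 M2 _ _ _ (fun n => (1 + - (8 * be n)) * n2 n)
    (fun n => n%:R^-1 * (4 * (1 + be n) * d1 n))); [|near_tac|near_tac].
  apply: ultimately_imp basic => n [n0 M10 M20 sB0 [e1 e2]]; split => //.
    transitivity (n%:R * ((s n)%:~R - 8 * B%:~R) * (num2 B (s n))%:~R : rat).
      by rewrite /N2; ring.
    rewrite eN2 // es (ebe _ n0).
    by move: (n2 n) (be n) (n%:R : rat) => *; ring.
  have t0 : n%:R != 0 :> rat by rewrite pnatr_eq0 -lt0n.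
  transitivity (4 * ((s n)%:~R + B%:~R) * (den1 B (s n))%:~R : rat).
    by rewrite /M2; ring.
  rewrite eM1 // es (ebe _ n0).
  by move: (d1 n) (be n) (n%:R : rat) t0 => x y t t0; field.
(* The abscissae of P + Q and P - Q have order at least n, so [near_root] is applied to their
   inverses. *)
- have hf0 : near (9 / 64) (fun n => (q n + - p n) ^+ 2).
    by eapply near_lim; [|near_tac]; by [].
  have hf1 : near (5 / 64) (fun n => - (2 * (p n * q n * (p n + q n) + 2 * be n))).
    by eapply near_lim; [|near_tac]; by [].
  have hf2 : near (1 / 256) (fun n => (p n * q n) ^+ 2 + - (4 * be n * (p n + q n))).
    by eapply near_lim; [|near_tac]; by [].
  have [K K0 hK] := near_root (isT : 9 / 64 != 0 :> rat) (isT : 1 / 256 != 0 :> rat) hf0 hf1 hf2.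
  apply: (@dominated_roots _ _ _ _ 0 1 1 0 K).
  have uf := near_neq0 (isT : 1 / 256 != 0 :> rat) hf2.
  apply: ultimately_imp (ultimately_and basic (ultimately_and uf hK)).
  move=> n [[n0 _ _ _ [e1 e2]] [f0 h]] z.
  have t0 : n%:R != 0 :> rat by rewrite pnatr_eq0 -lt0n.
  rewrite /sum_relation e1 e2 (ebe _ n0) => hz.
  have z0 : z != 0.
    apply: contra_neq f0 => z0; apply: (mulIf (expf_neq0 4 t0)); rewrite mul0r -hz z0.
    by move: (p n) (q n) (be n) (n%:R : rat) => *; ring.
  have [|_ hle] := h z^-1.
    rewrite -[RHS](mul0r (z ^+ 2 * n%:R ^+ 4)^-1) -hz.
    by move: (p n) (q n) (be n) (n%:R : rat) t0 z0 => x y w t t0 z0; field; rewrite t0 z0.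
  rewrite mul0r add0r oner_eq0 normr1 mul1r addr0 mul1r; split => //.
  by rewrite normfV in hle; rewrite -ler_pdivrMr ?normr_gt0 // mulrC.
Qed.
End SexticCase.

(** * Twists of rank two when A and B are not 0 *)

Section GenericCase.
Variables (R : realType) (a b c : int).
Hypothesis hd : discr a b c != 0.
Let A := 9 * b - 3 * a ^+ 2.
Let B := 27 * c - 9 * a * b + 2 * a ^+ 3.
Hypotheses (A0 : A != 0) (B0 : B != 0).

Lemma rank_two_twist_AB :
  exists (D : int) (hD : D != 0) (P : 'I_2 -> point (twistE hd hD)), independent P.
Proof.
have AQ : A%:~R != 0 :> rat by rewrite intr_eq0.
have BQ : B%:~R != 0 :> rat by rewrite intr_eq0.
pose k : rat := - B%:~R / A%:~R.
have k0 : k != 0 by rewrite mulf_neq0 ?oppr_eq0 ?invr_eq0.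
have eB : B%:~R = - (A%:~R * k) by rewrite /k mulrCA divff // mulr1 opprK.
(* Mestre: the equation g (t ^ 2 z) = t ^ 6 g z for the depressed cubic g is
   linear in z; [z1] is its solution for t = n, and [z2] is n ^ 2 [z1]. *)
pose z1 (n : nat) : rat := k * (n%:R ^+ 4 + n%:R ^+ 2 + 1) / (n%:R ^+ 2 * (n%:R ^+ 2 + 1)).
pose z2 (n : nat) : rat := k * (n%:R ^+ 4 + n%:R ^+ 2 + 1) / (n%:R ^+ 2 + 1).
have near_m' : near 1 (fun n => 1 + n%:R^-1 ^+ 2).
  by eapply near_lim; [|near_tac]; ring.
pose m (n : nat) : rat := (1 + n%:R^-1 ^+ 2)^-1.
have near_m : near 1 m by eapply near_lim; [|eapply nearV; [|exact: near_m']].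
pose p (n : nat) : rat := k * (1 + n%:R^-1 ^+ 4 * m n).
have near_p : near k p by rewrite /p; eapply near_lim; [|near_tac]; ring.
have basic : ultimately (fun n => [/\ (0 < n)%N, n%:R ^+ 2 + 1 != 0 :> rat, m n != 0,
    z1 n = p n /\ z2 n = p n * n%:R ^+ 2 & m n = n%:R ^+ 2 / (n%:R ^+ 2 + 1)]).
  apply: ultimately_imp (ultimately_ge 1) => n n0.
  have t0 : n%:R != 0 :> rat by rewrite pnatr_eq0 -lt0n.
  have t1 : n%:R ^+ 2 + 1 != 0 :> rat by rewrite gt_eqF // ltr_wpDl // exprn_ge0.
  have em : m n = n%:R ^+ 2 / (n%:R ^+ 2 + 1).
    rewrite /m; move: (n%:R : rat) t0 t1 => t t0 t1.
    have -> : 1 + t^-1 ^+ 2 = (t ^+ 2 + 1) / t ^+ 2 by field.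
    by rewrite invf_div.
  split => //; first by rewrite em mulf_neq0 ?expf_neq0 ?invr_eq0.
  rewrite /z1 /z2 /p em; move: (n%:R : rat) t0 t1 => t t0 t1.
  by split; field; rewrite t0 t1.
have ep n : p n = k * (1 + n%:R^-1 ^+ 4 * m n) by [].
clearbody p m k.
have near_g : near (k ^+ 3) (fun n => p n ^+ 3 + A%:~R * p n + B%:~R).
  by eapply near_lim; [|near_tac]; rewrite eB; ring.
have near_z : near k (fun n => p n * (1 + - (n%:R^-1 ^+ 2))).
  by eapply near_lim; [|near_tac]; ring.
have ug := near_neq0 (expf_neq0 3 k0) near_g.
have uz := near_neq0 k0 near_z.
have near_Bm : near (- B%:~R) (fun n => - B%:~R * m n).
  by eapply near_lim; [|near_tac]; ring.
have H := @rank_two_asymptotic R a b c hd _ _ _ _ (@gram_range_4 R) z1 z2 (fun n => n%:R ^+ 3).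
rewrite -/A -/B in H; apply: H.
- apply: ultimately_imp (ultimately_and basic (ultimately_and ug uz)).
  move=> n [[n0 t1 _ [e1 e2] em] [hg hz]].
  have t0 : n%:R != 0 :> rat by rewrite pnatr_eq0 -lt0n.
  split; first by rewrite e1.
  + rewrite /depressed /z1 /z2 eB; move: (n%:R : rat) (A%:~R : rat) t0 t1 => t x t0 t1.
    by field; rewrite t0 t1.
  + rewrite -subr_eq0 -oppr_eq0 opprB e1 e2.
    have -> : p n * n%:R ^+ 2 - p n = p n * (1 + - (n%:R^-1 ^+ 2)) * n%:R ^+ 2.
      by move: (n%:R : rat) t0 => t t0; field.
    by rewrite mulf_neq0 ?expf_neq0.
(* z1 approximates k = -B / A with an error of order n^-4, so its height is at least of order
   n^4. *)
- apply: dominated_lower near_Bm _.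
  apply: ultimately_imp basic => n [n0 t1 m0 [e1 e2] em]; exists A, B.
  have t0 : n%:R != 0 :> rat by rewrite pnatr_eq0 -lt0n.
  have e : A%:~R * z1 n + B%:~R = - B%:~R * m n * n%:R^-1 ^+ 4.
    by rewrite e1 ep eB; move: (n%:R^-1 ^+ 4 : rat) => t; ring.
  rewrite e; split; first by rewrite !mulf_neq0 ?oppr_eq0 ?expf_neq0 ?invr_eq0.
  by move: (n%:R : rat) t0 => t t0; field.
- apply: (@dominated_upper _ (fun n => - B * (n%:Z ^+ 4 + n%:Z ^+ 2 + 1))
    (fun n => A * n%:Z ^+ 2 * (n%:Z ^+ 2 + 1)) _ _ _
    (fun n => - B%:~R * (1 + n%:R^-1 ^+ 2 + n%:R^-1 ^+ 4))
    (fun n => A%:~R * (1 + n%:R^-1 ^+ 2))); [|near_tac|near_tac].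
  apply: ultimately_imp basic => n [n0 t1 _ _ _].
  have t0 : n%:R != 0 :> rat by rewrite pnatr_eq0 -lt0n.
  have eM : (A * n%:Z ^+ 2 * (n%:Z ^+ 2 + 1))%:~R = A%:~R * n%:R ^+ 2 * (n%:R ^+ 2 + 1) :> rat.
    by ring.
  have eN : (- B * (n%:Z ^+ 4 + n%:Z ^+ 2 + 1))%:~R
    = - B%:~R * (n%:R ^+ 4 + n%:R ^+ 2 + 1) :> rat by ring.
  split.
  + rewrite eN eM /z1 eB; move: (n%:R : rat) (A%:~R : rat) AQ t0 t1 => t x x0 t0 t1.
    by field; rewrite t0 t1 x0.
  + by rewrite -(intr_eq0 rat) eM !mulf_neq0 ?expf_neq0.
  + by rewrite eN; move: (n%:R : rat) t0 => t t0; field.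
  + by rewrite eM; move: (n%:R : rat) t0 => t t0; field.
(* z2 approximates k n^2 with an error of order n^-2 only, hence the lower exponent 2. *)
- apply: dominated_lower near_Bm _.
  apply: ultimately_imp basic => n [n0 t1 m0 [e1 e2] em]; exists A, (B * n%:Z ^+ 2).
  have t0 : n%:R != 0 :> rat by rewrite pnatr_eq0 -lt0n.
  have e : A%:~R * z2 n + (B * n%:Z ^+ 2)%:~R = - B%:~R * m n * n%:R^-1 ^+ 2.
    have -> : (B * n%:Z ^+ 2)%:~R = B%:~R * n%:R ^+ 2 :> rat by ring.
    by rewrite e2 ep eB; move: (n%:R : rat) t0 => t t0; field.
  rewrite e; split; first by rewrite !mulf_neq0 ?oppr_eq0 ?expf_neq0 ?invr_eq0.
  by move: (n%:R : rat) t0 => t t0; field.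
- apply: (@dominated_upper _ (fun n => - B * (n%:Z ^+ 4 + n%:Z ^+ 2 + 1))
    (fun n => A * (n%:Z ^+ 2 + 1)) _ _ _
    (fun n => - B%:~R * (1 + n%:R^-1 ^+ 2 + n%:R^-1 ^+ 4))
    (fun n => A%:~R * (n%:R^-1 ^+ 2 + n%:R^-1 ^+ 4))); [|near_tac|near_tac].
  apply: ultimately_imp basic => n [n0 t1 _ _ _].
  have t0 : n%:R != 0 :> rat by rewrite pnatr_eq0 -lt0n.
  have eM : (A * (n%:Z ^+ 2 + 1))%:~R = A%:~R * (n%:R ^+ 2 + 1) :> rat by ring.
  have eN : (- B * (n%:Z ^+ 4 + n%:Z ^+ 2 + 1))%:~R
    = - B%:~R * (n%:R ^+ 4 + n%:R ^+ 2 + 1) :> rat by ring.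
  split.
  + rewrite eN eM /z2 eB; move: (n%:R : rat) (A%:~R : rat) AQ t0 t1 => t x x0 t0 t1.
    by field; rewrite t1 x0.
  + by rewrite -(intr_eq0 rat) eM !mulf_neq0.
  + by rewrite eN; move: (n%:R : rat) t0 => t t0; field.
  + by rewrite eM; move: (n%:R : rat) t0 => t t0; field.
(* The abscissae of P + Q and P - Q approach k at the rate 1 / n: [f1] and [f0] are the scaled
   coefficients of the relation rewritten in z - k. *)
- pose f1 n := - (2 * p n ^+ 2 * k * n%:R^-1 ^+ 3 * m n)
    + n%:R^-1 * (- (4 * k * p n ^+ 2) + 2 * k * p n ^+ 2 * n%:R^-1 ^+ 2
         + - (2 * A%:~R * p n) + - (2 * p n ^+ 3) + - (2 * A%:~R * p n * n%:R^-1 ^+ 2))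
    + - (4 * B%:~R * n%:R^-1 ^+ 3).
  pose f0 n := p n ^+ 2 * k ^+ 2 * n%:R^-1 ^+ 6 * m n ^+ 2
    + (- (2 * k ^+ 2 * p n ^+ 2) + - (2 * k * p n ^+ 3) + - (2 * k * A%:~R * p n)
       + - (2 * A%:~R * p n ^+ 2) + - (4 * B%:~R * p n))
    + n%:R^-1 ^+ 2 * (k ^+ 2 * p n ^+ 2 + - (2 * k * A%:~R * p n) + - (4 * k * B%:~R)
       + A%:~R ^+ 2 + - (4 * B%:~R * p n)).
  have hf0 : near (- 4 * k ^+ 4) f0.
    by rewrite /f0; eapply near_lim; [|near_tac]; rewrite eB; ring.
  have hf1 : near 0 f1 by rewrite /f1; eapply near_lim; [|near_tac]; ring.
  have hf2 : near (k ^+ 2) (fun n => (p n * (1 + - (n%:R^-1 ^+ 2))) ^+ 2).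
    by eapply near_lim; [|near_tac]; ring.
  have l0 : - 4 * k ^+ 4 != 0 by rewrite mulf_neq0 // expf_neq0.
  have [K K0 hK] := near_root l0 (expf_neq0 2 k0) hf0 hf1 hf2.
  apply: (@dominated_roots _ _ _ _ A B 0 1 (`|A|%:~R * K)).
  apply: ultimately_imp (ultimately_and basic hK) => n [[n0 t1 _ [e1 e2] _] h] z.
  have t0 : n%:R != 0 :> rat by rewrite pnatr_eq0 -lt0n.
  rewrite /sum_relation e1 e2 => hz.
  have eAz : A%:~R * z + B%:~R = A%:~R * (z - k) by rewrite eB; ring.
  have [|z0 hle] := h (z - k).
    rewrite -[RHS](mul0r (n%:R ^+ 4)^-1) -hz /f1 /f0 eB ep.
    move: (m n) (n%:R : rat) (A%:~R : rat) t0 => y t x t0.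
    by field.
  rewrite eAz mul0r add0r normr1 mulr1 mulf_neq0 //; split => //.
  by rewrite normrM -mulrA -intr_norm ler_wpM2l // ler0z.
Qed.
End GenericCase.

(** * The equivalences *)

(** Divided differences of the three root equations give the Vieta formulas, and the discriminant
    becomes the square of the product of the differences of the roots. *)
Lemma discr_neq0 (R : realType) (a b c : int) :
  has_three_distinct_complex_roots R (cubic a b c) -> discr a b c != 0.
Proof.
case=> [[|x [|y [|w [|? ?]]]]] [] //= us _ /and4P[rx ry rw _].
have ev (t : complex R) : root (map_poly intr (cubic a b c)) t ->
    t ^+ 3 + a%:~R * t ^+ 2 + b%:~R * t + c%:~R = 0.
  move/rootP; rewrite /cubic !rmorphD /= !linearZ /= !map_polyXn map_polyX map_polyC /=.
  by rewrite !hornerE => <-; ring.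
move: us; rewrite !inE negb_or andbT => /andP[/andP[xy xw] yw].
have ex := ev _ rx; have ey := ev _ ry; have ew := ev _ rw.
rewrite -(intr_eq0 (complex R)) -discr_intr.
move: (a%:~R : complex R) (b%:~R : complex R) (c%:~R : complex R) ex ey ew => A B C ex ey ew.
have quo (t u : complex R) : t != u -> t ^+ 3 + A * t ^+ 2 + B * t + C = 0 ->
    u ^+ 3 + A * u ^+ 2 + B * u + C = 0 -> t ^+ 2 + t * u + u ^+ 2 + A * (t + u) + B = 0.
  rewrite -subr_eq0 => tu et eu; apply: (mulfI tu); rewrite mulr0 -[RHS](subrr 0) -{1}et -eu; ring.
have e1 := quo _ _ xy ex ey; have e2 := quo _ _ xw ex ew.
have eA : A = - (x + y + w).
  have yw' : y - w != 0 by rewrite subr_eq0.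
  by apply: (mulfI yw'); apply/eqP; rewrite -subr_eq0 -[X in _ == X](subrr 0) -{1}e1 -e2; apply/eqP; ring.
have eB : B = x * y + x * w + y * w.
  by apply/eqP; rewrite -subr_eq0 -e1 eA; apply/eqP; ring.
have eC : C = - (x * y * w).
  by apply/eqP; rewrite -subr_eq0 -ex eA eB; apply/eqP; ring.
have -> : discr A B C = ((x - y) * (y - w) * (x - w)) ^+ 2.
  by rewrite /discr eA eB eC; ring.
by rewrite expf_neq0 // !mulf_neq0 // subr_eq0.
Qed.

(** Since 729 [discr] = -4 A^3 - 27 B^2 for the coefficients A, B of the depressed cubic, these do
    not both vanish and the three families cover all cases. *)
Lemma rank_two_twist (R : realType) (a b c : int) (hd : discr a b c != 0) :
  exists (D : int) (hD : D != 0) (P : 'I_2 -> point (twistE hd hD)), independent P.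
Proof.
have [A0|A0] := eqVneq (9 * b - 3 * a ^+ 2) 0; last first.
  have [B0|B0] := eqVneq (27 * c - 9 * a * b + 2 * a ^+ 3) 0.
    exact: rank_two_twist_B0.
  exact: rank_two_twist_AB.
have [B0|B0] := eqVneq (27 * c - 9 * a * b + 2 * a ^+ 3) 0; last exact: rank_two_twist_A0.
have : 729 * discr a b c = - 4 * (9 * b - 3 * a ^+ 2) ^+ 3
    - 27 * (27 * c - 9 * a * b + 2 * a ^+ 3) ^+ 2 by rewrite /discr; ring.
by rewrite A0 B0 !expr0n !mulr0 subr0 => /eqP; rewrite mulf_eq0 (negbTE hd).
Qed.

Section Equivalences.
Variables (R : realType) (a b c : int).
Hypothesis hd : discr a b c != 0.
Variable omega : forall d d' : nat, 'I_(d ^ 2) -> int * int.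
Hypothesis homega : shortest_vector_choice R a b c omega.
Variable j : R.
Hypothesis j0 : 0 < j.

Let rank_lt := forall D : int, D != 0 -> (ec_rank R a b c D < (2 * j)%:E)%E.

Lemma rank_lt_S_E : rank_lt -> forall k, 1 <= k -> (S_E a b c j k < +oo)%E.
Proof.
move=> hrank k k1.
have hind D (hD : D != 0) n (P : 'I_n -> point (twistE hd hD)) : independent P ->
    n%:R < 2 * j.
  by apply: ec_rank_lt; apply: hrank.
(* The two independent points on a twist give 2 < 2 j. *)
have j1 : 1 < j.
  have [D [hD [P /hind]]] := rank_two_twist R hd.
  by rewrite -[ltLHS]mulr1 ltr_pM2l.
(* The bound r must be an integer strictly below 2 j: it is the integral part m, or m - 1 when 2 j
   is itself an integer. *)
pose m := Num.truncn (2 * j).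
have [lem ltm] : m%:R <= 2 * j /\ 2 * j < m.+1%:R.
  by apply/andP; apply: truncn_itv; rewrite mulr_ge0 // ltW.
have [mlt|mge] := ltP m%:R (2 * j).
  apply: (S_E_bounded (hd := hd) (r := m)) => // D hD n P /hind h.
  by rewrite -ltnS -(ltr_nat R) (lt_trans h).
have m0 : (0 < m)%N by rewrite -(ltr_nat R); apply: lt_le_trans mge; rewrite mulr_gt0.
apply: (S_E_bounded (hd := hd) (r := m.-1)) => // [D hD n P /hind h|].
  by rewrite -ltnS prednK // -(ltr_nat R) (lt_le_trans h).
by apply: lt_le_trans lem; rewrite ltr_nat prednK.
Qed.

Lemma Q_E_rank_lt : (exists k, 1 <= k /\ (Q_E a b c omega j k < +oo)%E) -> rank_lt.
Proof.
move=> [k [k1 hQ]] D hD; rewrite ltNge; apply/negP => hle.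
have [n [P [indP hn]]] := @ec_rank_ge R (twistE hd hD) (2 * j) hle.
exact: Q_E_infinite homega indP j0 hn k1 hQ.
Qed.
End Equivalences.

Theorem theorem1 (R : realType) (a b c : int)
    (hf : has_three_distinct_complex_roots R (cubic a b c))
    (omega : forall d d' : nat, 'I_(d ^ 2) -> int * int)
    (homega : shortest_vector_choice R a b c omega)
    (j : R) (hj : 0 < j) :
  [<-> forall D : int, D != 0 -> (ec_rank R a b c D < (2 * j)%:E)%E;
       exists k : R, 1 <= k /\ (S_E a b c j k < +oo)%E;
       forall k : R, 1 <= k -> (S_E a b c j k < +oo)%E;
       exists k : R, 1 <= k /\ (R_E a b c j k < +oo)%E;
       forall k : R, 1 <= k -> (R_E a b c j k < +oo)%E;
       exists k : R, 1 <= k /\ (Q_E a b c omega j k < +oo)%E;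
       forall k : R, 1 <= k -> (Q_E a b c omega j k < +oo)%E].
Proof.
have hd := discr_neq0 hf.
have aS := rank_lt_S_E hd hj; have Qa := Q_E_rank_lt hd homega hj.
have SR k : 1 <= k -> (S_E a b c j k < +oo)%E -> (R_E a b c j k < +oo)%E.
  exact: R_E_finite.
have RQ k : 1 <= k -> (R_E a b c j k < +oo)%E -> (Q_E a b c omega j k < +oo)%E.
  exact: Q_E_finite.
have RS k : (R_E a b c j k < +oo)%E -> (S_E a b c j k < +oo)%E.
  exact: le_lt_trans (S_E_le_R_E _ _ _ _ _).
have Sa : (exists k : R, 1 <= k /\ (S_E a b c j k < +oo)%E) ->
    forall D : int, D != 0 -> (ec_rank R a b c D < (2 * j)%:E)%E.
  by move=> [k [k1 h]]; apply: Qa; exists k; split=> //; apply: RQ => //; apply: SR.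
have one : 1 <= 1 :> R by [].
tfae.
- by move=> /aS h; exists 1; split=> //; apply: h.
- by move=> /Sa h k k1; apply: aS.
- by move=> h; exists 1; split=> //; apply: SR => //; apply: h.
- move=> [k [k1 /RS h]] k' k'1; apply: SR => //; apply: aS => //; apply: Sa.
  by exists k.
- by move=> h; exists 1; split=> //; apply: RQ => //; apply: h.
- by move=> /Qa/aS h k k1; apply: RQ => //; apply: SR => //; apply: h.
- by move=> h; apply: Qa; exists 1; split=> //; apply: h.
Qed.
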